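(* Let $D\subset\mathbb{C}$ be a domain, let $\mathcal{F}$ be a family of holomorphic functions on $D$, let $m\ge 0$ be an integer, and let $\psi\not\equiv 0$ be a holomorphic function on $D$ all of whose zeros have multiplicity at most $m$. Suppose that for every $f\in\mathcal{F}$ all zeros of $f$ have multiplicity at least $2(m+1)$, and that every pair $f,g\in\mathcal{F}$ shares $\psi$ IM in $D$. Then $\mathcal{F}$ is normal in $D$.
   Context: A domain is a nonempty connected open subset of $\mathbb{C}$. Two functions $f,g$ share a function $h$ IM in $D$ if $\{z\in D: f(z)=h(z)\}=\{z\in D: g(z)=h(z)\}$. A family of holomorphic functions on $D$ is normal in $D$ if every sequence in the family has a subsequence which converges uniformly on compact subsets of $D$, with respect to the spherical metric, to a holomorphic function on $D$ or to the constant $\infty$. *)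

(* Defs.v *)
From HB Require Import structures.
From mathcomp Require Import all_boot all_order all_algebra.
From mathcomp Require Import complex.
From mathcomp Require Import all_classical all_reals all_analysis.

Set Implicit Arguments.
Unset Strict Implicit.
Unset Printing Implicit Defensive.

Import Order.TTheory GRing.Theory Num.Theory.
Import numFieldNormedType.Exports.

Local Open Scope classical_set_scope.
Local Open Scope ring_scope.

(* R[i] itself carries no topology; packing it as a numClosedFieldType gives
   access to the norm topology and derivatives of numFieldNormedType. *)
Definition Cplx (R : realType) : numClosedFieldType := complex R.

Section NormalFamilies.
Variable R : realType.
Local Notation C := (Cplx R).

Definition domain (D : set C) : Prop := [/\ D !=set0, open D & connected D].

(* Functions on D are total functions whose values outside D are irrelevant;
   [derivable f z 1] is complex differentiability, since the scalars are C. *)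
Definition holomorphic_on (D : set C) (f : C -> C) : Prop :=
  forall z, D z -> derivable f z 1.

(* The multiplicity of f at z is the order of vanishing of f at z (0 if f z is
   not 0, infinite if f vanishes identically near z). *)
Definition multiplicity_ge (f : C -> C) (z : C) (n : nat) : Prop :=
  forall j, (j < n)%N -> derive1n j f z = 0.

Definition multiplicity_le (f : C -> C) (z : C) (n : nat) : Prop :=
  ~ multiplicity_ge f z n.+1.

Definition shares_IM (D : set C) (f g h : C -> C) : Prop :=
  [set z | D z /\ f z = h z] = [set z | D z /\ g z = h z].

(* The Riemann sphere, with None as the point at infinity. *)
Definition sphere := option C.

(* Half the Euclidean distance between the images of the two points under
   stereographic projection to the unit sphere. *)
Definition half_chord (p q : sphere) : R :=
  let w (z : C) := Num.sqrt (1 + Normc.normc z ^+ 2) in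
  match p, q with
  | Some z, Some z' => Normc.normc (z - z') / (w z * w z')
  | Some z, None | None, Some z => (w z)^-1
  | None, None => 0
  end.

(* Great-circle distance on the unit sphere, i.e. the distance induced by the
   line element 2 |dz| / (1 + |z|^2). *)
Definition spherical_dist (p q : sphere) : R := 2 * asin (half_chord p q).

Definition spherically_cvg_on_compacts
    (D : set C) (f : nat -> C -> C) (g : C -> sphere) : Prop :=
  forall K : set C, compact K -> K `<=` D ->
  forall e : R, 0 < e ->
  exists N : nat, forall n, (N <= n)%N ->
  forall z, K z -> spherical_dist (Some (f n z)) (g z) < e.

Definition normal_family (D : set C) (F : set (C -> C)) : Prop :=
  forall f : nat -> C -> C, (forall n, F (f n)) ->
  exists phi : nat -> nat,
    (forall i j, (i < j)%N -> (phi i < phi j)%N) /\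
    ((exists2 g : C -> C, holomorphic_on D g &
        spherically_cvg_on_compacts D (fun n => f (phi n))
          (fun z => Some (g z))) \/
     spherically_cvg_on_compacts D (fun n => f (phi n)) (fun=> None)).

End NormalFamilies.

(* Main.v *)
Require Import Defs.
From mathcomp Require Import all_boot all_order all_algebra.
From mathcomp Require Import complex.
From mathcomp Require Import all_classical all_reals all_analysis.
From mathcomp Require Import ring lra.
Import Order.TTheory GRing.Theory Num.Theory.
Import numFieldNormedType.Exports.

Set Implicit Arguments.
Unset Strict Implicit.
Unset Printing Implicit Defensive.

Local Open Scope classical_set_scope.
Local Open Scope ring_scope.

(** The common set [E] of [psi]-points of the family is discrete, unless the family consists
    of [psi] alone. Off [E] and the zeros of [psi], the function [v = 1 - f / psi] omits [0], and
    every point where [v = 1] is critical. For such [v] a Schottky theorem holds: write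
    [v = exp (2 i pi w)], so that [w] is ramified over all integers, and compare, in the manner of
    Ahlfors, the hyperbolic metric of the disc with the metric
    [max (1 / (2 (|Im w| + 12)), 15 / (t (400 - t^6))) |dw|], where [t^4] is the distance
    from [w] to the integers; it is locally bounded below by pull-backs of hyperbolic
    metrics under [w |-> w + 12 i] (to a half-plane) and [w |-> (w - k)^(3/4) / 20] (to the disc).
    Hence [|w'| = O(1 + |Im w|)] and [|v|] is controlled along paths.

    Around an exceptional point [a] the Schottky theorem, applied in the coordinate
    [log (z - a)], controls [v] on a whole small circle by its value at one point. So along a
    subsequence either [f_n] is bounded on these circles, hence locally bounded by the maximum
    principle, and Montel's theorem applies, or [f_n] tends to infinity on these circles. In
    the second case [f_n] tends to infinity near [a]: if [a] is not in [E], by the maximum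
    principle for [1 / (f_n - psi)]; if [a] is in [E] and [psi a = 0], the maximum principle for
    [(z - a)^p / (f_n - psi)], with [p] the order of [psi] at [a], gives a contradiction, since
    [f_n] vanishes at [a] to an order greater than [p]; if [a] is in [E] and
    [psi a <> 0], then [v_n a = 0], some circle around [a] meets [|v_n| = 1/2], and its image
    is a loop too short to surround [0].

    The theory of holomorphic functions needed on the way is derived from Goursat's lemma in
    logarithmic coordinates, which gives the mean value property; the maximum principle follows by
    composing with Moebius maps, and differentiability of [f'] from the mean value formula for
    [f']. *)

(** * Complex numbers and complex derivatives *)

(** The sphere with 0 and infinity removed and a cone point of order 2 at 1 has Euler characteristic
    2 - 1 - 1 - 1/2 < 0: this hyperbolic orbifold is the reason for the Schottky theorem. Passing
    from v to w trades the two punctures for a row of cone points at the integers, near which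
    explicit metrics can be written down without any uniformization. The exponent 3/4 lies between
    1/2 and 1 for two reasons. Above 1/2, it makes the density, of size |w - k|^(-1/4), times |w'|
    tend to 0 where w - k vanishes at least doubly, so a maximum is never attained over an integer.
    Below 1, it makes the density decrease away from k, so that the nearest integer gives the
    largest pull-back. The Schottky bound is one-sided: v may come close to 0, and only upper bounds
    for |v| travel. This is why tending to infinity has to be carried into a disc by a separate
    argument for each kind of centre. The multiplicity 2 (m + 1) acts twice: being at least 2, it
    makes the points with v = 1 critical; exceeding m, it makes f vanish faster than psi at a common
    zero. *)

Section Basics.
Variable R : realType.
Local Notation C := (Cplx R).

Definition nrm (z : C) : R := Normc.normc z.
Definition rc (x : R) : C := real_complex R x.
Definition cI : C := Complex 0 1.
Definition mkC (x y : R) : C := Complex x y.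
Definition cRe (z : C) : R := complex.Re z.
Definition cIm (z : C) : R := complex.Im z.
Definition cj (z : C) : C := conjc z.

Lemma normE (z : C) : `|z| = rc (nrm z). Proof. by []. Qed.

Lemma nrm0 : nrm 0 = 0. Proof. exact: Normc.normc0. Qed.
Lemma nrm1 : nrm 1 = 1. Proof. exact: Normc.normc1. Qed.
Lemma nrm0_eq0 z : nrm z = 0 -> z = 0. Proof. exact: Normc.eq0_normc. Qed.
Lemma nrmM z w : nrm (z * w) = nrm z * nrm w. Proof. exact: Normc.normcM. Qed.
Lemma nrmV z : nrm z^-1 = (nrm z)^-1. Proof. exact: Normc.normcV. Qed.
Lemma nrmD z w : nrm (z + w) <= nrm z + nrm w. Proof. exact: le_normcD. Qed.
Lemma nrmN z : nrm (- z) = nrm z. Proof. exact: normcN. Qed.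
Lemma nrmB z w : nrm (z - w) <= nrm z + nrm w.
Proof. by rewrite -(nrmN w); exact: nrmD. Qed.
Lemma nrmC z w : nrm (z - w) = nrm (w - z).
Proof. by rewrite -nrmN opprB. Qed.
Lemma nrmX z n : nrm (z ^+ n) = nrm z ^+ n.
Proof. by elim: n => [|n IH]; rewrite ?expr0 ?nrm1 // !exprS nrmM IH. Qed.
Lemma nrm_ge0 z : 0 <= nrm z.
Proof. by case: z => a b; exact: sqrtr_ge0. Qed.
Lemma nrm_eq0 z : (nrm z == 0) = (z == 0).
Proof. by apply/eqP/eqP => [/nrm0_eq0|->]; rewrite ?nrm0. Qed.
Lemma nrm_gt0 z : (0 < nrm z) = (z != 0).
Proof. by rewrite lt_def nrm_eq0 nrm_ge0 andbT. Qed.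
Lemma nrm_sub_gt0 z w : (0 < nrm (z - w)) = (z != w).
Proof. by rewrite nrm_gt0 subr_eq0. Qed.
Lemma nrmBl z w : nrm z - nrm w <= nrm (z - w).
Proof. by rewrite lerBlDr -{1}(subrK w z) nrmD. Qed.
Lemma nrm_dist z w : `|nrm z - nrm w| <= nrm (z - w).
Proof.
rewrite ler_norml nrmBl andbT lerNl opprB; apply: le_trans (nrmBl _ _) _.
by rewrite nrmC.
Qed.

Lemma rc0 : rc 0 = 0. Proof. by []. Qed.
Lemma rc1 : rc 1 = 1. Proof. by []. Qed.
Lemma rcB x y : rc (x - y) = rc x - rc y. Proof. exact: rmorphB. Qed.
Lemma rcM x y : rc (x * y) = rc x * rc y. Proof. exact: rmorphM. Qed.
Lemma rcV x : rc x^-1 = (rc x)^-1. Proof. exact: fmorphV. Qed.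
Lemma rc_nat n : rc n%:R = n%:R. Proof. exact: rmorph_nat. Qed.
Lemma nrm_rc x : nrm (rc x) = `|x|.
Proof. by rewrite /nrm /= expr0n addr0 sqrtr_sqr. Qed.
Lemma nrm_nat n : nrm (n%:R) = n%:R.
Proof. by rewrite -rc_nat nrm_rc ger0_norm. Qed.
Lemma rc_eq0 x : (rc x == 0) = (x == 0).
Proof. by rewrite -nrm_eq0 nrm_rc normr_eq0. Qed.

Lemma nrm_sqr z : nrm z ^+ 2 = cRe z ^+ 2 + cIm z ^+ 2.
Proof. by case: z => a b; rewrite /nrm /= sqr_sqrtr // addr_ge0 // sqr_ge0. Qed.
Lemma nrm_Re z : `|cRe z| <= nrm z.
Proof.
by rewrite -(ler_pXn2r (n := 2)) ?nnegrE ?nrm_ge0 // nrm_sqr real_normK ?num_real // lerDl sqr_ge0.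
Qed.
Lemma nrm_Im z : `|cIm z| <= nrm z.
Proof.
by rewrite -(ler_pXn2r (n := 2)) ?nnegrE ?nrm_ge0 // nrm_sqr real_normK ?num_real // lerDr sqr_ge0.
Qed.
Lemma nrm_le z : nrm z <= `|cRe z| + `|cIm z|.
Proof.
rewrite -(ler_pXn2r (n := 2)) ?nnegrE ?nrm_ge0 ?addr_ge0 // nrm_sqr sqrrD.
by rewrite !real_normK ?num_real // lerD2r lerDl mulrn_wge0 // mulr_ge0.
Qed.

Lemma mkCE x y : mkC x y = rc x + cI * rc y.
Proof. by rewrite /mkC /rc /cI; apply/eqP; rewrite eq_complex /=; apply/andP; split; apply/eqP; ring. Qed.
Lemma mkC_ReIm z : mkC (cRe z) (cIm z) = z. Proof. by case: z. Qed.
Lemma cRe_mk x y : cRe (mkC x y) = x. Proof. by []. Qed.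
Lemma cIm_mk x y : cIm (mkC x y) = y. Proof. by []. Qed.
Lemma cReD z w : cRe (z + w) = cRe z + cRe w. Proof. by case: z w => ? ? [? ?]. Qed.
Lemma cImD z w : cIm (z + w) = cIm z + cIm w. Proof. by case: z w => ? ? [? ?]. Qed.
Lemma cReN z : cRe (- z) = - cRe z. Proof. by case: z. Qed.
Lemma cImN z : cIm (- z) = - cIm z. Proof. by case: z. Qed.
Lemma cReB z w : cRe (z - w) = cRe z - cRe w. Proof. by rewrite cReD cReN. Qed.
Lemma cImB z w : cIm (z - w) = cIm z - cIm w. Proof. by rewrite cImD cImN. Qed.
Lemma cReM z w : cRe (z * w) = cRe z * cRe w - cIm z * cIm w.
Proof. by case: z w => ? ? [? ?]. Qed.
Lemma cImM z w : cIm (z * w) = cRe z * cIm w + cIm z * cRe w.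
Proof. by case: z w => ? ? [? ?]. Qed.
Lemma cRe_rc x : cRe (rc x) = x. Proof. by []. Qed.
Lemma cIm_rc x : cIm (rc x) = 0. Proof. by []. Qed.
Lemma c_ext z w : cRe z = cRe w -> cIm z = cIm w -> z = w.
Proof. by case: z w => ? ? [? ?] /= -> ->. Qed.
Lemma nrm_cI : nrm cI = 1.
Proof. by rewrite /nrm /= expr0n add0r expr1n sqrtr1. Qed.
Lemma cI_neq0 : cI != 0.
Proof. by rewrite -nrm_eq0 nrm_cI oner_eq0. Qed.

Lemma mul_cj z : z * cj z = rc (nrm z ^+ 2).
Proof.
by apply: c_ext; rewrite ?cReM ?cImM ?cRe_rc ?cIm_rc ?nrm_sqr; case: z => a b /=; ring.
Qed.
Lemma nrm_cj z : nrm (cj z) = nrm z.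
Proof. by case: z => a b; rewrite /nrm /= sqrrN. Qed.
Lemma nbhs_nrm (z : C) (A : set C) :
  nbhs z A <-> exists2 e : R, 0 < e & forall w, nrm (w - z) < e -> A w.
Proof.
split=> [/nbhs_ballP[e /= e0 eA]|[e e0 eA]].
  have ee : e = rc (cRe e).
    apply: c_ext; rewrite ?cRe_rc ?cIm_rc //.
    by move: e0; rewrite ltcE => /andP[/eqP].
  exists (cRe e); first by move: e0; rewrite ee ltcR.
  move=> w wz; apply: eA; rewrite -ball_normE /ball_ /= ee normE ltcR.
  by rewrite nrmC.
apply/nbhs_ballP; exists (rc e); first by rewrite /= ltcR.
move=> w; rewrite -ball_normE /ball_ /= normE ltcR nrmC; exact: eA.
Qed.

Lemma open_nrm (A : set C) :
  open A <-> forall z, A z -> exists2 e : R, 0 < e & forall w, nrm (w - z) < e -> A w.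
Proof.
rewrite openE; split=> [oA z Az|oA z Az]; first by have /nbhs_nrm := oA z Az.
by apply/nbhs_nrm; exact: oA.
Qed.

(** Increment form: without a quotient, w = z needs no exclusion and composition is a plain
    estimate. [derivable_cder] and [cder_derivable] connect it with the derivative of the
    statement. *)
Definition cder (f : C -> C) (z l : C) := forall e : R, 0 < e ->
  exists2 d : R, 0 < d & forall w, nrm (w - z) < d ->
    nrm (f w - f z - l * (w - z)) <= e * nrm (w - z).

Definition ccont (f : C -> C) (z : C) := forall e : R, 0 < e ->
  exists2 d : R, 0 < d & forall w, nrm (w - z) < d -> nrm (f w - f z) < e.

Lemma cder_derivable f z l : cder f z l -> is_derive z 1 f l.
Proof.
move=> fl.
have cv : (fun h : C => h^-1 *: ((f \o shift z) (h *: (1:C)) - f z)) @ 0^' --> (l : C).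
  apply/cvgrPdist_le => /= e e0.
  have ee : e = rc (cRe e).
    apply: c_ext; rewrite ?cRe_rc ?cIm_rc //.
    by move: e0; rewrite ltcE => /andP[/eqP].
  have [d d0 dl] := fl (cRe e) ltac:(by move: e0; rewrite ee ltcR).
  rewrite /dnbhs/= near_withinE; apply/nbhs_nrm; exists d => // h; rewrite subr0 => hd h0.
  rewrite ee normE lecR /= -[h *: 1]/(h * 1) mulr1.
  have := dl (h + z); rewrite addrK => /(_ hd) H.
  have h0' : 0 < nrm h by rewrite nrm_gt0.
  rewrite -[h^-1 *: _]/(h^-1 * _) nrmC -(ler_pM2r h0') -nrmM mulrBl mulrAC mulVf ?mul1r//.
split; first by apply/cvg_ex; exists l.
exact: cvg_lim cv.
Qed.

Lemma derivable_cder (f : C -> C) (z : C) : derivable f z 1 -> cder f z (derive1 f z).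
Proof.
move=> df e e0; rewrite derive1E.
have cv : (fun h : C => h^-1 *: ((f \o shift z) (h *: (1:C)) - f z)) @ 0^' --> ('D_1 f z : C).
  exact: df.
move/cvgrPdist_le : cv => /(_ (rc e)); rewrite ltcR => /(_ e0).
rewrite /dnbhs/= near_withinE => /nbhs_nrm[d d0 H].
exists d => // w wz; have [->|wz0] := eqVneq w z.
  by rewrite !subrr mulr0 subr0 nrm0 mulr0.
have wz0' : w - z != 0 by rewrite subr_eq0.
have := H (w - z); rewrite subr0 => /(_ wz wz0').
rewrite normE lecR /= -[(w - z) *: 1]/((w - z) * 1) mulr1 subrK.
rewrite -[_^-1 *: _]/((w - z)^-1 * _).
have wz1 : 0 < nrm (w - z) by rewrite nrm_gt0.
by rewrite -(ler_pM2r wz1) -nrmM mulrBl mulrAC mulVf ?mul1r// (nrmC ('D_1 f z * _)) => ->.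
Qed.

Lemma cder_unique f z l l' : cder f z l -> cder f z l' -> l = l'.
Proof. by move=> /cder_derivable[_ <-] /cder_derivable[_ <-]. Qed.

Lemma cder_derive1 f z l : cder f z l -> derive1 f z = l.
Proof. by move=> /cder_derivable[_ <-]; rewrite derive1E. Qed.

Lemma cder_cont f z l : cder f z l -> ccont f z.
Proof.
move=> fl e e0; have [d d0 H] := fl 1 ltr01.
have k0 : 0 < 1 + nrm l by apply: ltr_pwDl => //; exact: nrm_ge0.
exists (Num.min d (e / (1 + nrm l))); first by rewrite lt_min d0 divr_gt0.
move=> w; rewrite lt_min => /andP[/H H1]; rewrite ltr_pdivlMr// => H2.
apply: le_lt_trans H2; rewrite mulrC -[f w - f z](subrK (l * (w - z))).
by rewrite (le_trans (nrmD _ _))// mulrDl nrmM lerD2r.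
Qed.

Lemma cder_near f g z l : (exists2 d : R, 0 < d & forall w, nrm (w - z) < d -> f w = g w) ->
  cder f z l -> cder g z l.
Proof.
move=> [d d0 fg] cf e e0; have [d' d'0 H] := cf e e0.
exists (Num.min d d'); first by rewrite lt_min d0.
move=> w; rewrite lt_min => /andP[w1 w2]; rewrite -!fg ?subrr ?nrm0//; exact: H.
Qed.

Lemma cder_eq f z l l' : cder f z l -> l = l' -> cder f z l'.
Proof. by move=> ? <-. Qed.

Lemma cder_cst a z : cder (fun=> a) z 0.
Proof. by move=> e e0; exists 1 => // w _; rewrite subrr mul0r subr0 nrm0 mulr_ge0// ?nrm_ge0// ltW. Qed.

Lemma cder_id z : cder (fun w => w) z 1.
Proof. by move=> e e0; exists 1 => // w _; rewrite mul1r subrr nrm0 mulr_ge0// ?nrm_ge0// ltW. Qed.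

Lemma cderD f g z l m : cder f z l -> cder g z m -> cder (fun w => f w + g w) z (l + m).
Proof.
move=> fl gm e e0; have e2 : 0 < e / 2 by rewrite divr_gt0.
have [d d0 H] := fl _ e2; have [d' d'0 H'] := gm _ e2.
exists (Num.min d d'); first by rewrite lt_min d0.
move=> w; rewrite lt_min => /andP[/H H1 /H' H2].
rewrite (_ : _ - _ - _ = (f w - f z - l * (w - z)) + (g w - g z - m * (w - z))); last by ring.
rewrite (le_trans (nrmD _ _))// (_ : e = e / 2 + e / 2); last by field.
by rewrite mulrDl lerD.
Qed.

Lemma cderN f z l : cder f z l -> cder (fun w => - f w) z (- l).
Proof.
move=> fl e e0; have [d d0 H] := fl _ e0; exists d => // w /H.
by rewrite -nrmN; congr (nrm _ <= _); ring.
Qed.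

Lemma cderB f g z l m : cder f z l -> cder g z m -> cder (fun w => f w - g w) z (l - m).
Proof. by move=> fl gm; apply: cderD => //; exact: cderN. Qed.

Lemma cder_comp f g z l m : cder f z l -> cder g (f z) m -> cder (fun w => g (f w)) z (m * l).
Proof.
move=> fl gm e e0.
have k0 : 0 < 1 + nrm l by apply: ltr_pwDl => //; exact: nrm_ge0.
have k1 : 0 < 1 + nrm m by apply: ltr_pwDl => //; exact: nrm_ge0.
(* The error of [f] gets multiplied by [m], that of [g] by the Lipschitz constant [1 + nrm l] of [f]
   at [z]; the cap at 1 provides the latter. *)
set e1 := Num.min 1 (e / 2 / (1 + nrm m)).
have e10 : 0 < e1 by rewrite lt_min ltr01 divr_gt0// divr_gt0.
set e2 := e / 2 / (1 + nrm l).
have e20 : 0 < e2 by rewrite divr_gt0// divr_gt0.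
have [d d0 H] := fl _ e10; have [d' d'0 H'] := gm _ e20.
have [d2 d20 H2] := cder_cont fl d'0.
exists (Num.min d d2); first by rewrite lt_min d0.
move=> w; rewrite lt_min => /andP[/H {}H /H2 /H' {}H'].
rewrite (_ : _ - _ - _ = (g (f w) - g (f z) - m * (f w - f z)) + m * (f w - f z - l * (w - z))); last by ring.
have A : nrm (f w - f z) <= (1 + nrm l) * nrm (w - z).
  rewrite -[f w - f z](subrK (l * (w - z))) (le_trans (nrmD _ _))// mulrDl nrmM lerD2r.
  by rewrite (le_trans H)// ler_wpM2r ?nrm_ge0// ge_min lexx.
rewrite (le_trans (nrmD _ _))// (_ : e = e / 2 + e / 2); last by field.
rewrite mulrDl lerD//.
  rewrite (le_trans H')// (le_trans (ler_wpM2l (ltW e20) A))// mulrA ler_wpM2r ?nrm_ge0//.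
  by rewrite /e2 divfK// gt_eqF.
rewrite nrmM (le_trans (ler_wpM2l (nrm_ge0 _) H))// mulrA ler_wpM2r ?nrm_ge0//.
have : e1 <= e / 2 / (1 + nrm m) by rewrite ge_min lexx orbT.
rewrite ler_pdivlMr// => h; apply: le_trans h.
by rewrite mulrC ler_wpM2l ?(ltW e10)// lerDr.
Qed.

Lemma cderM f g z l m : cder f z l -> cder g z m ->
  cder (fun w => f w * g w) z (l * g z + f z * m).
Proof.
move=> fl gm e e0.
set k := 1 + nrm (g z) + nrm (f z) + nrm l + nrm m.
have k0 : 0 < k by rewrite /k; have := nrm_ge0 (g z); have := nrm_ge0 (f z);
   have := nrm_ge0 l; have := nrm_ge0 m; lra.
set e1 := Num.min 1 (e / (3 * k)).
have e1_0 : 0 < e1 by rewrite lt_min ltr01 divr_gt0// mulr_gt0.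
have [d d0 H] := fl _ e1_0; have [d' d'0 H'] := gm _ e1_0.
have [d2 d20 H2] := cder_cont fl e1_0.
exists (Num.min d (Num.min d2 d')); first by rewrite !lt_min d0 d20.
move=> w; rewrite !lt_min => /andP[/H {}H /andP[/H2 {}H2 /H' {}H']].
rewrite (_ : _ - _ - _ = (f w - f z - l * (w - z)) * g z + f z * (g w - g z - m * (w - z))
  + (f w - f z) * (g w - g z)); last by ring.
have e1le : e1 <= e / (3 * k) by rewrite ge_min lexx orbT.
have e1l1 : e1 <= 1 by rewrite ge_min lexx.
have {}e1le : 3 * (e1 * k) <= e by move: e1le; rewrite ler_pdivlMr ?mulr_gt0// mulrCA.
have A : nrm (g w - g z) <= (1 + nrm m) * nrm (w - z).
  rewrite -[g w - g z](subrK (m * (w - z))) (le_trans (nrmD _ _))// mulrDl nrmM lerD2r.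
  by rewrite (le_trans H')// ler_wpM2r ?nrm_ge0.
have B : nrm (g z) <= k by rewrite /k; have := nrm_ge0 (g z); have := nrm_ge0 (f z);
   have := nrm_ge0 l; have := nrm_ge0 m; lra.
have B' : nrm (f z) <= k by rewrite /k; have := nrm_ge0 (g z); have := nrm_ge0 (f z);
   have := nrm_ge0 l; have := nrm_ge0 m; lra.
have B2 : 1 + nrm m <= k by rewrite /k; have := nrm_ge0 (g z); have := nrm_ge0 (f z);
   have := nrm_ge0 l; have := nrm_ge0 m; lra.
rewrite (le_trans (nrmD _ _))// (le_trans (lerD (nrmD _ _) (lexx _)))// !nrmM.
have n0 := nrm_ge0 (w - z).
have X1 : nrm (f w - f z - l * (w - z)) * nrm (g z) <= e1 * nrm (w - z) * k.
  by apply: ler_pM => //; exact: nrm_ge0.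
have X2 : nrm (f z) * nrm (g w - g z - m * (w - z)) <= k * (e1 * nrm (w - z)).
  by apply: ler_pM => //; exact: nrm_ge0.
have X3 : nrm (f w - f z) * nrm (g w - g z) <= e1 * (k * nrm (w - z)).
  apply: ler_pM; rewrite ?nrm_ge0 ?(ltW H2)// (le_trans A)// ler_wpM2r//.
have := ler_wpM2r n0 e1le; lra.
Qed.

Lemma cderZ a f z l : cder f z l -> cder (fun w => a * f w) z (a * l).
Proof. by move=> fl; have := cderM (cder_cst a z) fl; rewrite mul0r add0r. Qed.

Lemma cderX f z l n : cder f z l -> cder (fun w => f w ^+ n) z (n%:R * f z ^+ n.-1 * l).
Proof.
move=> fl; elim: n => [|n IH]; first by rewrite !mul0r; exact: cder_cst.
have -> : (fun w => f w ^+ n.+1) = (fun w => f w * f w ^+ n) by apply/funext => w; rewrite exprS.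
apply: cder_eq (cderM fl IH) _.
case: n {IH} => [|n]; first by rewrite expr0 !mul0r mulr0 addr0 !mulr1 mul1r.
rewrite -pred_Sn exprS -[n.+2]addn1 natrD; ring.
Qed.

Lemma cder_inv (z : C) : z != 0 -> cder (fun w => w^-1) z (- z ^- 2).
Proof.
move=> z0 e e0.
have nz : 0 < nrm z by rewrite nrm_gt0.
exists (Num.min (nrm z / 2) (e * nrm z ^+ 3 / 2)).
  by rewrite lt_min !divr_gt0// mulr_gt0// exprn_gt0.
move=> w; rewrite lt_min => /andP[h1 h2].
have w2 : nrm z / 2 <= nrm w by have := nrmBl z w; rewrite nrmC; lra.
have w0 : w != 0 by rewrite -nrm_gt0; lra.
rewrite (_ : _ - _ - _ = (w - z) ^+ 2 / (w * z ^+ 2)); last by field; rewrite z0 w0.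
rewrite nrmM nrmV nrmX (nrmM w) nrmX ler_pdivrMr; last by rewrite mulr_gt0 ?exprn_gt0 ?nrm_gt0.
set W := nrm w * _; have HW : nrm (w - z) <= e * W.
  apply: le_trans (ltW h2) _.
  rewrite (_ : _ / 2 = e * ((nrm z / 2) * nrm z ^+ 2)); last by field.
  by rewrite ler_wpM2l ?(ltW e0)// ler_wpM2r// exprn_ge0// ltW.
by rewrite (mulrC e) -mulrA (expr2 (nrm _)) ler_wpM2l// nrm_ge0.
Qed.

Lemma cderV f z l : cder f z l -> f z != 0 -> cder (fun w => (f w)^-1) z (- l / f z ^+ 2).
Proof. by move=> fl f0; apply: cder_eq (cder_comp fl (cder_inv f0)) _; ring. Qed.

Lemma cder_div f g z l m : cder f z l -> cder g z m -> g z != 0 ->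
  cder (fun w => f w / g w) z ((l * g z - f z * m) / g z ^+ 2).
Proof.
by move=> fl gm g0; apply: cder_eq (cderM fl (cderV gm g0)) _; field.
Qed.
End Basics.

(** * Paths and integrals *)

Section Paths.
Variable R : realType.
Local Notation C := (Cplx R).
Implicit Types (p q P : R -> C) (t : R).

Definition rder (f : R -> R) (t l : R) := forall e : R, 0 < e ->
  exists2 d : R, 0 < d & forall s, `|s - t| < d ->
    `|f s - f t - l * (s - t)| <= e * `|s - t|.

Definition pder (p : R -> C) (t : R) (l : C) := forall e : R, 0 < e ->
  exists2 d : R, 0 < d & forall s, `|s - t| < d ->
    nrm (p s - p t - l * rc (s - t)) <= e * `|s - t|.

Definition pcont (p : R -> C) (t : R) := forall e : R, 0 < e ->
  exists2 d : R, 0 < d & forall s, `|s - t| < d -> nrm (p s - p t) < e.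

Lemma is_derive_rder (f : R -> R) (t l : R) : is_derive t 1 f l <-> rder f t l.
Proof.
split=> [[df <-] e e0|fl].
  have cv : (fun h : R => h^-1 *: ((f \o shift t) (h *: (1:R)) - f t)) @ 0^' --> ('D_1 f t : R).
    exact: df.
  move/cvgrPdist_le : cv => /(_ e e0).
  rewrite /dnbhs/= near_withinE => /nbhs_ballP[d /= d0 H].
  exists d => // s st; have [->|st0] := eqVneq s t.
    by rewrite !subrr mulr0 subr0 normr0 mulr0.
  have st0' : s - t != 0 by rewrite subr_eq0.
  have := H (s - t); rewrite -ball_normE /ball_ /= sub0r normrN => /(_ st st0').
  rewrite /= -[(s - t) *: 1]/((s - t) * 1) mulr1 subrK.
  rewrite -[_^-1 *: _]/((s - t)^-1 * _).
  have st1 : 0 < `|s - t| by rewrite normr_gt0.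
  by rewrite -(ler_pM2r st1) -normrM mulrBl mulrAC mulVf ?mul1r// (distrC ('D_1 f t * _)) => ->.
have cv : (fun h : R => h^-1 *: ((f \o shift t) (h *: (1:R)) - f t)) @ 0^' --> (l : R).
  apply/cvgrPdist_le => /= e e0; have [d d0 dl] := fl e e0.
  rewrite /dnbhs/= near_withinE; apply/nbhs_ballP; exists d => // h.
  rewrite -ball_normE /ball_ /= sub0r normrN => hd h0.
  rewrite /= -[h *: 1]/(h * 1) mulr1.
  have := dl (h + t); rewrite addrK => /(_ hd) H.
  have h0' : 0 < `|h| by rewrite normr_gt0.
  by rewrite -[h^-1 *: _]/(h^-1 * _) distrC -(ler_pM2r h0') -normrM mulrBl mulrAC mulVf ?mul1r.
split; first by apply/cvg_ex; exists l.
exact: cvg_lim cv.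
Qed.

Lemma pder_Re p t l : pder p t l -> is_derive t 1 (fun s => cRe (p s)) (cRe l).
Proof.
move=> pl; apply/is_derive_rder => e e0; have [d d0 H] := pl e e0; exists d => // s /H {}H.
apply: le_trans H; apply: le_trans (nrm_Re _).
by rewrite !cReB cReM cRe_rc cIm_rc mulr0 subr0.
Qed.

Lemma pder_Im p t l : pder p t l -> is_derive t 1 (fun s => cIm (p s)) (cIm l).
Proof.
move=> pl; apply/is_derive_rder => e e0; have [d d0 H] := pl e e0; exists d => // s /H {}H.
apply: le_trans H; apply: le_trans (nrm_Im _).
by rewrite !cImB cImM cRe_rc cIm_rc mulr0 add0r.
Qed.

Lemma pder_mk (f g : R -> R) (t a b : R) : is_derive t 1 f a -> is_derive t 1 g b ->
  pder (fun s => mkC (f s) (g s)) t (mkC a b).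
Proof.
move=> /is_derive_rder fa /is_derive_rder gb e e0.
have e2 : 0 < e / 2 by rewrite divr_gt0.
have [d d0 H] := fa _ e2; have [d' d'0 H'] := gb _ e2.
exists (Num.min d d'); first by rewrite lt_min d0.
move=> s; rewrite lt_min => /andP[/H {}H /H' {}H'].
apply: le_trans (nrm_le _) _; rewrite (_ : e = e / 2 + e / 2); last by field.
rewrite mulrDl lerD//.
  by rewrite !cReB cReM cRe_rc cIm_rc mulr0 subr0.
by rewrite !cImB cImM cRe_rc cIm_rc mulr0 add0r.
Qed.

Lemma pder_eq p t l l' : pder p t l -> l = l' -> pder p t l'.
Proof. by move=> ? <-. Qed.

Lemma pder_cont p t l : pder p t l -> pcont p t.
Proof.
move=> fl e e0; have [d d0 H] := fl 1 ltr01.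
have k0 : 0 < 1 + nrm l by apply: ltr_pwDl => //; exact: nrm_ge0.
exists (Num.min d (e / (1 + nrm l))); first by rewrite lt_min d0 divr_gt0.
move=> w; rewrite lt_min => /andP[/H H1]; rewrite ltr_pdivlMr// => H2.
apply: le_lt_trans H2; rewrite mulrC -[p w - p t](subrK (l * rc (w - t))).
by rewrite (le_trans (nrmD _ _))// mulrDl nrmM nrm_rc lerD2r.
Qed.

Lemma cder_pder f p t l m : cder f (p t) l -> pder p t m -> pder (fun s => f (p s)) t (l * m).
Proof.
move=> gm fl e e0.
have k0 : 0 < 1 + nrm m by apply: ltr_pwDl => //; exact: nrm_ge0.
have k1 : 0 < 1 + nrm l by apply: ltr_pwDl => //; exact: nrm_ge0.
set e1 := Num.min 1 (e / 2 / (1 + nrm l)).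
have e10 : 0 < e1 by rewrite lt_min ltr01 divr_gt0// divr_gt0.
set e2 := e / 2 / (1 + nrm m).
have e20 : 0 < e2 by rewrite divr_gt0// divr_gt0.
have [d d0 H] := fl _ e10; have [d' d'0 H'] := gm _ e20.
have [d2 d20 H2] := pder_cont fl d'0.
exists (Num.min d d2); first by rewrite lt_min d0.
move=> w; rewrite lt_min => /andP[/H {}H /H2 /H' {}H'].
rewrite (_ : _ - _ - _ = (f (p w) - f (p t) - l * (p w - p t)) + l * (p w - p t - m * rc (w - t))); last by ring.
have A : nrm (p w - p t) <= (1 + nrm m) * `|w - t|.
  rewrite -[p w - p t](subrK (m * rc (w - t))) (le_trans (nrmD _ _))// mulrDl nrmM nrm_rc lerD2r.
  by rewrite (le_trans H)// ler_wpM2r// ge_min lexx.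
rewrite (le_trans (nrmD _ _))// (_ : e = e / 2 + e / 2); last by field.
rewrite mulrDl lerD//.
  rewrite (le_trans H')// (le_trans (ler_wpM2l (ltW e20) A))// mulrA ler_wpM2r//.
  by rewrite /e2 divfK// gt_eqF.
rewrite nrmM (le_trans (ler_wpM2l (nrm_ge0 _) H))// mulrA ler_wpM2r//.
have : e1 <= e / 2 / (1 + nrm l) by rewrite ge_min lexx orbT.
rewrite ler_pdivlMr// => h; apply: le_trans h.
by rewrite mulrC ler_wpM2l ?(ltW e10)// lerDr.
Qed.

Lemma ccont_pcont f p t : ccont f (p t) -> pcont p t -> pcont (fun s => f (p s)) t.
Proof.
move=> cf cp e e0; have [d d0 H] := cf e e0; have [d' d'0 H'] := cp d d0.
by exists d' => // s /H' /H.
Qed.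

Lemma pderD p q t l m : pder p t l -> pder q t m -> pder (fun s => p s + q s) t (l + m).
Proof.
move=> fl gm e e0; have e2 : 0 < e / 2 by rewrite divr_gt0.
have [d d0 H] := fl _ e2; have [d' d'0 H'] := gm _ e2.
exists (Num.min d d'); first by rewrite lt_min d0.
move=> w; rewrite lt_min => /andP[/H H1 /H' H2].
rewrite (_ : _ - _ - _ = (p w - p t - l * rc (w - t)) + (q w - q t - m * rc (w - t))); last by ring.
rewrite (le_trans (nrmD _ _))// (_ : e = e / 2 + e / 2); last by field.
by rewrite mulrDl lerD.
Qed.

Lemma pder_cst a t : pder (fun=> a) t 0.
Proof. by move=> e e0; exists 1 => // w _; rewrite subrr mul0r subr0 nrm0 mulr_ge0// ltW. Qed.

Lemma pder_rc t : pder (@rc R) t 1.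
Proof. by move=> e e0; exists 1 => // w _; rewrite mul1r -rcB subrr nrm0 mulr_ge0// ltW. Qed.

Lemma pderZ a p t l : pder p t l -> pder (fun s => a * p s) t (a * l).
Proof.
move=> pl; have := cder_pder (f := fun z => a * z) (cderZ a (cder_id (p t))) pl.
by rewrite mulr1.
Qed.

Lemma pderB p q t l m : pder p t l -> pder q t m -> pder (fun s => p s - q s) t (l - m).
Proof.
move=> pl qm; have := pderD pl (pderZ (-1) qm); rewrite mulN1r.
by under eq_fun do rewrite mulN1r.
Qed.

Lemma pderM p q t l m : pder p t l -> pder q t m ->
  pder (fun s => p s * q s) t (l * q t + p t * m).
Proof.
move=> pl qm.
(* Polarisation reduces products to squares, and those are covered by the chain rule for a complex
   polynomial along a path. *)
have sq r k : pder r t k -> pder (fun s => r s ^+ 2) t (2 * r t * k).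
  move=> rk; apply: pder_eq (cder_pder (f := fun z => z ^+ 2) (cderX 2 (cder_id (r t))) rk) _.
  by rewrite expr1 mulr1.
have H := pderZ (4^-1) (pderB (sq _ _ (pderD pl qm)) (sq _ _ (pderB pl qm))).
have -> : (fun s => p s * q s) = (fun s => 4^-1 * ((p s + q s) ^+ 2 - (p s - q s) ^+ 2)).
  by apply/funext => s; field.
by apply: pder_eq H _; field.
Qed.

Lemma pcont_cst a t : pcont (fun=> a) t.
Proof. exact: pder_cont (pder_cst a t). Qed.

Lemma pcontD p q t : pcont p t -> pcont q t -> pcont (fun s => p s + q s) t.
Proof.
move=> fl gm e e0; have e2 : 0 < e / 2 by rewrite divr_gt0.
have [d d0 H] := fl _ e2; have [d' d'0 H'] := gm _ e2.
exists (Num.min d d'); first by rewrite lt_min d0.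
move=> w; rewrite lt_min => /andP[/H H1 /H' H2].
rewrite (_ : _ - _ = (p w - p t) + (q w - q t)); last by ring.
by rewrite (le_lt_trans (nrmD _ _))// (_ : e = e / 2 + e / 2) ?ltrD//; field.
Qed.

Lemma pcontZ a p t : pcont p t -> pcont (fun s => a * p s) t.
Proof.
by move=> cp; apply: (ccont_pcont (f := fun z => a * z)) => //; apply: cder_cont (cderZ a (cder_id _)).
Qed.

Lemma pcontB p q t : pcont p t -> pcont q t -> pcont (fun s => p s - q s) t.
Proof.
move=> cp cq; have := pcontD cp (pcontZ (-1) cq).
by under eq_fun do rewrite mulN1r.
Qed.

Lemma pcontM p q t : pcont p t -> pcont q t -> pcont (fun s => p s * q s) t.
Proof.
move=> pl qm.
have sq r : pcont r t -> pcont (fun s => r s ^+ 2) t.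
  by move=> cr; apply: (ccont_pcont (f := fun z => z ^+ 2)) => //; apply: cder_cont (cderX 2 (cder_id _)).
have H := pcontZ (4^-1) (pcontB (sq _ (pcontD pl qm)) (sq _ (pcontB pl qm))).
have -> : (fun s => p s * q s) = (fun s => 4^-1 * ((p s + q s) ^+ 2 - (p s - q s) ^+ 2)).
  by apply/funext => s; field.
exact: H.
Qed.

(** Rotating an increment onto the nonnegative real axis lets the real mean value theorem bound it
    without loss. *)
Lemma rotation (z : C) : exists2 a : C, nrm a = 1 & cRe (a * z) = nrm z.
Proof.
have [->|z0] := eqVneq z 0; first by exists 1; rewrite ?nrm1// mulr0 nrm0.
have n0 : nrm z != 0 by rewrite nrm_eq0.
exists (cj z * rc (nrm z)^-1).
  by rewrite nrmM nrm_cj nrm_rc ger0_norm ?invr_ge0 ?nrm_ge0// divff.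
by rewrite mulrAC (mulrC (cj z)) mul_cj -rcM cRe_rc expr2 mulfK.
Qed.

Lemma real_MVI (f df : R -> R) (a b M : R) : a <= b ->
  (forall t, a <= t <= b -> is_derive t 1 f (df t)) ->
  (forall t, a <= t <= b -> df t <= M) -> f b - f a <= M * (b - a).
Proof.
move=> ab fd dfM.
have [||c cab ->] := @MVT_segment R f df a b ab.
- by move=> x; rewrite in_itv/= => /andP[/ltW h1 /ltW h2]; apply: fd; rewrite h1.
- apply: derivable_within_continuous => x; rewrite in_itv/= => h.
  by have [] := fd x h.
- by rewrite ler_wpM2r ?subr_ge0// dfM//; move: cab; rewrite in_itv.
Qed.

Lemma path_MVI p (dp : R -> C) (a b M : R) : a <= b ->
  (forall t, a <= t <= b -> pder p t (dp t)) ->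
  (forall t, a <= t <= b -> nrm (dp t) <= M) -> nrm (p b - p a) <= M * (b - a).
Proof.
move=> ab pd dM; have [c c1 <-] := rotation (p b - p a).
rewrite mulrBr cReB.
apply: (@real_MVI (fun s => cRe (c * p s)) (fun s => cRe (c * dp s))) => // t /[dup] tab /pd H.
  exact: pder_Re (pderZ c H).
apply: le_trans (dM t tab); apply: le_trans (ler_norm _) _.
by apply: le_trans (nrm_Re _) _; rewrite nrmM c1 mul1r.
Qed.

Definition primitive (p P : R -> C) (a b : R) := forall t, a <= t <= b -> pder P t (p t).

Lemma pcont_Re p t : pcont p t -> {for t, continuous (fun s => cRe (p s))}.
Proof.
move=> cp; apply/cvgrPdist_lt => e e0; have [d d0 H] := cp e e0.
apply/nbhs_ballP; exists d => // s; rewrite /ball_ /= distrC => /H {}H.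
by rewrite distrC -cReB; apply: le_lt_trans (nrm_Re _) H.
Qed.

Lemma pcont_Im p t : pcont p t -> {for t, continuous (fun s => cIm (p s))}.
Proof.
move=> cp; apply/cvgrPdist_lt => e e0; have [d d0 H] := cp e e0.
apply/nbhs_ballP; exists d => // s; rewrite /ball_ /= distrC => /H {}H.
by rewrite distrC -cImB; apply: le_lt_trans (nrm_Im _) H.
Qed.

Lemma real_primitive_exists (f : R -> R) (a b : R) : continuous f ->
  exists F : R -> R, forall t, a <= t <= b -> is_derive t 1 F (f t).
Proof.
move=> cf.
(* Integration starts at a - 1 so that [a] becomes an interior point, where the fundamental theorem
   yields a two-sided derivative. *)
exists (fun x => (\int[@lebesgue_measure R]_(t in [set` `[a - 1, x]%R]) f t)%R) => t /andP[at_ tb].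
have tu : t < b + 1 by lra.
have au : a - 1 < t by lra.
have intf : (@lebesgue_measure R).-integrable `[a - 1, b + 1]%classic (EFin \o f).
  apply: continuous_compact_integrable; first exact: segment_compact.
  by apply: continuous_subspaceT => x; exact: cf.
have [d1 d2] := continuous_FTC1_closed tu intf au (cf t).
by split => //; rewrite -derive1E.
Qed.

Lemma primitive_exists p (a b : R) : (forall t, pcont p t) -> exists P, primitive p P a b.
Proof.
move=> cp.
have [F HF] := @real_primitive_exists (fun s => cRe (p s)) a b (fun t => pcont_Re (cp t)).
have [G HG] := @real_primitive_exists (fun s => cIm (p s)) a b (fun t => pcont_Im (cp t)).
exists (fun s => mkC (F s) (G s)) => t tab; rewrite -(mkC_ReIm (p t)).
by apply: pder_mk; [exact: HF|exact: HG].
Qed.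

(** Integration through an arbitrarily chosen primitive: by [path_MVI] the choice does not matter
    when a <= b, and [primitive_exists] supplies one for integrands continuous everywhere. Without a
    primitive the value is 0. *)
Definition cint p (a b : R) : C :=
  let P := xget (fun=> 0) [set P | primitive p P a b] in P b - P a.

Lemma cintE p P (a b : R) : a <= b -> primitive p P a b -> cint p a b = P b - P a.
Proof.
move=> ab pP; rewrite /cint; case: xgetP => [Q _ /= pQ|/(_ P)//].
apply/eqP; rewrite -subr_eq0 -nrm_eq0 eq_le nrm_ge0 andbT.
rewrite (_ : _ - _ = (Q b - P b) - (Q a - P a)); last by ring.
rewrite -(mul0r (b - a)).
apply: (@path_MVI (fun s => Q s - P s) (fun s => p s - p s)) => // t tab.
  by apply: pderB; [exact: pQ|exact: pP].
by rewrite subrr nrm0.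
Qed.

Lemma cint_primitive p (a b : R) : a <= b -> (forall t, pcont p t) ->
  exists2 P, primitive p P a b & cint p a b = P b - P a.
Proof. by move=> ab cp; have [P pP] := primitive_exists a b cp; exists P => //; exact: cintE. Qed.

Lemma cintD p q (a b : R) : a <= b -> (forall t, pcont p t) -> (forall t, pcont q t) ->
  cint (fun s => p s + q s) a b = cint p a b + cint q a b.
Proof.
move=> ab cp cq; have [P pP ->] := cint_primitive ab cp; have [Q qQ ->] := cint_primitive ab cq.
rewrite (@cintE _ (fun s => P s + Q s))// => [|t tab]; first by ring.
by apply: pderD; [exact: pP|exact: qQ].
Qed.

Lemma cintZ c p (a b : R) : a <= b -> (forall t, pcont p t) ->
  cint (fun s => c * p s) a b = c * cint p a b.
Proof.
move=> ab cp; have [P pP ->] := cint_primitive ab cp.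
rewrite (@cintE _ (fun s => c * P s))// => [|t tab]; first by ring.
by apply: pderZ; exact: pP.
Qed.

Lemma cintB p q (a b : R) : a <= b -> (forall t, pcont p t) -> (forall t, pcont q t) ->
  cint (fun s => p s - q s) a b = cint p a b - cint q a b.
Proof.
move=> ab cp cq; have [P pP ->] := cint_primitive ab cp; have [Q qQ ->] := cint_primitive ab cq.
rewrite (@cintE _ (fun s => P s - Q s))// => [|t tab]; first by ring.
by apply: pderB; [exact: pP|exact: qQ].
Qed.

Lemma cint_split p (a b c : R) : a <= b -> b <= c -> (forall t, pcont p t) ->
  cint p a c = cint p a b + cint p b c.
Proof.
move=> ab bc cp; have [P pP ->] := cint_primitive (le_trans ab bc) cp.
rewrite (@cintE _ P a b)// => [|t /andP[h1 h2]]; last by apply: pP; rewrite h1 (le_trans h2).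
rewrite (@cintE _ P b c)// => [|t /andP[h1 h2]]; last by apply: pP; rewrite h2 (le_trans ab).
by ring.
Qed.

Lemma cint_cst c (a b : R) : a <= b -> cint (fun=> c) a b = c * rc (b - a).
Proof.
move=> ab; rewrite (@cintE _ (fun s => c * rc s))// => [|t tab].
  by rewrite -mulrBr -rcB.
by have := pderZ c (pder_rc t); rewrite mulr1.
Qed.

Lemma cint_bound p (a b M : R) : a <= b -> (forall t, pcont p t) ->
  (forall t, a <= t <= b -> nrm (p t) <= M) -> nrm (cint p a b) <= M * (b - a).
Proof.
by move=> ab cp pM; have [P pP ->] := cint_primitive ab cp; apply: (@path_MVI P p).
Qed.

Lemma cint_affine (c d : C) (a b : R) : a <= b ->
  cint (fun s => c + d * rc s) a b = c * rc (b - a) + d * (rc b ^+ 2 - rc a ^+ 2) / 2.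
Proof.
move=> ab; rewrite (@cintE _ (fun s => c * rc s + d / 2 * rc s ^+ 2))// => [|t tab].
  by rewrite rcB; field.
have H := pderD (pderZ c (pder_rc t))
   (pderZ (d / 2) (cder_pder (f := fun z => z ^+ 2) (cderX 2 (cder_id (rc t))) (pder_rc t))).
by apply: pder_eq H _; rewrite expr1; field.
Qed.
End Paths.

(** * Goursat's lemma *)

Section Goursat.
Variable R : realType.
Local Notation C := (Cplx R).

Lemma pder_horizontal (c t : R) : pder (fun s => mkC s c) t 1.
Proof.
have -> : (fun s : R => mkC s c) = (fun s => rc s + cI R * rc c) by apply/funext => s; rewrite mkCE.
by have := pderD (pder_rc t) (pder_cst (cI R * rc c) t); rewrite addr0.
Qed.

Lemma pder_vertical (c t : R) : pder (fun s => mkC c s) t (cI R).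
Proof.
have -> : (fun s : R => mkC c s) = (fun s => rc c + cI R * rc s) by apply/funext => s; rewrite mkCE.
by have := pderD (pder_cst (rc c) t) (pderZ (cI R) (pder_rc t)); rewrite add0r mulr1.
Qed.

Definition rect_int (G : C -> C) (a b c d : R) : C :=
  cint (fun x => G (mkC x c)) a b + cI R * cint (fun y => G (mkC b y)) c d
  - cint (fun x => G (mkC x d)) a b - cI R * cint (fun y => G (mkC a y)) c d.

Lemma small_dyadic (x r : R) : 0 < r -> exists n : nat, x / 2 ^+ n < r.
Proof.
move=> r0; exists (Num.truncn (x / r)).+1; set n := _.+1.
rewrite ltr_pdivrMr ?exprn_gt0// mulrC -ltr_pdivrMr//.
apply: lt_trans (truncnS_gt _) _; rewrite -/n -natrX ltr_nat.
exact: ltn_expl.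
Qed.

Section OneFunction.
Variables (G : C -> C).
Hypothesis contG : forall z, ccont G z.

Lemma pcont_h c t : pcont (fun s => G (mkC s c)) t.
Proof. exact: ccont_pcont (pder_cont (pder_horizontal c t)). Qed.
Lemma pcont_v c t : pcont (fun s => G (mkC c s)) t.
Proof. exact: ccont_pcont (pder_cont (pder_vertical c t)). Qed.

Lemma rect_int_split (a m b c n d : R) : a <= m -> m <= b -> c <= n -> n <= d ->
  rect_int G a b c d = rect_int G a m c n + rect_int G m b c n
                     + rect_int G a m n d + rect_int G m b n d.
Proof.
move=> am mb cn nd; rewrite /rect_int.
rewrite (cint_split am mb (pcont_h c)) (cint_split am mb (pcont_h d)).
rewrite (cint_split cn nd (pcont_v a)) (cint_split cn nd (pcont_v b)).
by ring.
Qed.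

Lemma rect_int_affine (u l : C) (a b c d : R) : a <= b -> c <= d ->
  rect_int (fun z => u + l * z) a b c d = 0.
Proof.
move=> ab cd; rewrite /rect_int.
have h y : (fun x : R => u + l * mkC x y) = (fun x => (u + l * cI R * rc y) + l * rc x).
  by apply/funext => x; rewrite mkCE; ring.
have v x : (fun y : R => u + l * mkC x y) = (fun y => (u + l * rc x) + l * cI R * rc y).
  by apply/funext => y; rewrite mkCE; ring.
rewrite !h !v !cint_affine// !rcB.
by field.
Qed.

(** Affine functions integrate to 0 around a rectangle, so only the deviation from one, times the
    perimeter, contributes. *)
Lemma rect_int_sub_affine (u l : C) (a b c d e : R) : a <= b -> c <= d ->
  (forall x y, a <= x <= b -> c <= y <= d -> nrm (G (mkC x y) - (u + l * mkC x y)) <= e) ->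
  nrm (rect_int G a b c d) <= e * (2 * ((b - a) + (d - c))).
Proof.
move=> ab cd H.
have contA z : ccont (fun z => u + l * z) z.
  apply: cder_cont; apply: cderD; [exact: cder_cst|exact: cderZ (cder_id _)].
have contD z : ccont (fun z => G z - (u + l * z)) z.
  move=> e1 e10; have e2 : 0 < e1 / 2 by rewrite divr_gt0.
  have [d1 d10 H1] := contG z e2; have [d2 d20 H2] := contA z _ e2.
  exists (Num.min d1 d2); first by rewrite lt_min d10.
  move=> w; rewrite lt_min => /andP[/H1 {}H1 /H2 {}H2].
  rewrite (_ : _ - _ - _ = (G w - G z) - (u + l * w - (u + l * z))); last by ring.
  by rewrite (le_lt_trans (nrmB _ _))// (_ : e1 = e1 / 2 + e1 / 2) ?ltrD//; field.
have -> : rect_int G a b c d = rect_int (fun z => G z - (u + l * z)) a b c d.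
  rewrite -[LHS]subr0 -[in LHS](@rect_int_affine u l a b c d)// /rect_int.
  have ch y t : pcont (fun x => u + l * mkC x y) t.
    exact: ccont_pcont (contA _) (pder_cont (pder_horizontal y t)).
  have cv x t : pcont (fun y => u + l * mkC x y) t.
    exact: ccont_pcont (contA _) (pder_cont (pder_vertical x t)).
  rewrite !cintB//; try (by move=> t; exact: pcont_h); try (by move=> t; exact: pcont_v).
  by ring.
have cDh y t : pcont (fun x => G (mkC x y) - (u + l * mkC x y)) t.
  exact: (ccont_pcont (f := fun z => G z - (u + l * z))) (contD _) (pder_cont (pder_horizontal y t)).
have cDv x t : pcont (fun y => G (mkC x y) - (u + l * mkC x y)) t.
  exact: (ccont_pcont (f := fun z => G z - (u + l * z))) (contD _) (pder_cont (pder_vertical x t)).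
rewrite /rect_int.
have hb y : c <= y <= d -> nrm (cint (fun x => G (mkC x y) - (u + l * mkC x y)) a b) <= e * (b - a).
  by move=> yc; apply: cint_bound => // t tab; exact: H.
have vb x : a <= x <= b -> nrm (cint (fun y => G (mkC x y) - (u + l * mkC x y)) c d) <= e * (d - c).
  by move=> xa; apply: cint_bound => // t tab; exact: H.
have X1 := hb c ltac:(by rewrite lexx cd).
have X2 := hb d ltac:(by rewrite lexx cd).
have X3 := vb a ltac:(by rewrite lexx ab).
have X4 := vb b ltac:(by rewrite lexx ab).
apply: le_trans (nrmB _ _) _; rewrite nrmM nrm_cI mul1r.
apply: le_trans (lerD (nrmB _ _) (lexx _)) _.
apply: le_trans (lerD (lerD (nrmD _ _) (lexx _)) (lexx _)) _; rewrite nrmM nrm_cI mul1r.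
lra.
Qed.

(** If each of the four quarters carried less than a fourth of the integral, their sum could not
    reach it. *)
Lemma rect_int_quarter (a c w h : R) : 0 <= w -> 0 <= h ->
  exists p : R * R, [/\ (a <= p.1) && (p.1 + w / 2 <= a + w), (c <= p.2) && (p.2 + h / 2 <= c + h) &
    nrm (rect_int G a (a + w) c (c + h)) / 4
      <= nrm (rect_int G p.1 (p.1 + w / 2) p.2 (p.2 + h / 2))].
Proof.
move=> w0 h0; apply: contrapT => nex.
have bad x y : (a <= x) && (x + w / 2 <= a + w) -> (c <= y) && (y + h / 2 <= c + h) ->
    nrm (rect_int G x (x + w / 2) y (y + h / 2)) < nrm (rect_int G a (a + w) c (c + h)) / 4.
  by move=> hx hy; rewrite ltNge; apply/negP => H; apply: nex; exists (x, y).
have w2 : a + w / 2 + w / 2 = a + w by field.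
have h2 : c + h / 2 + h / 2 = c + h by field.
have B1 := bad a c ltac:(lra) ltac:(lra).
have B2 := bad (a + w / 2) c ltac:(lra) ltac:(lra).
have B3 := bad a (c + h / 2) ltac:(lra) ltac:(lra).
have B4 := bad (a + w / 2) (c + h / 2) ltac:(lra) ltac:(lra).
rewrite w2 in B2 B4; rewrite h2 in B3 B4.
have S := @rect_int_split a (a + w / 2) (a + w) c (c + h / 2) (c + h)
   ltac:(lra) ltac:(lra) ltac:(lra) ltac:(lra).
have : nrm (rect_int G a (a + w) c (c + h)) < nrm (rect_int G a (a + w) c (c + h)); last by rewrite ltxx.
rewrite {1}S.
apply: le_lt_trans (nrmD _ _) _.
apply: le_lt_trans (lerD (nrmD _ _) (lexx _)) _.
apply: le_lt_trans (lerD (lerD (nrmD _ _) (lexx _)) (lexx _)) _.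
lra.
Qed.

Lemma nested_limit (x : nat -> R) (w : R) :
  (forall n, (x n <= x n.+1) && (x n.+1 + w / 2 ^+ n.+1 <= x n + w / 2 ^+ n)) -> 0 <= w ->
  exists y, forall n, x n <= y <= x n + w / 2 ^+ n.
Proof.
move=> H w0.
have wn n : 0 <= w / 2 ^+ n by rewrite divr_ge0// exprn_ge0.
have mono n k : (x n <= x (n + k)%N) && (x (n + k)%N + w / 2 ^+ (n + k) <= x n + w / 2 ^+ n).
  elim: k => [|k IH]; first by rewrite addn0 !lexx.
  rewrite addnS; have := H (n + k)%N; move: IH => /andP[i1 i2] /andP[j1 j2].
  by rewrite (le_trans i1 j1) (le_trans j2 i2).
have cross m n : x m <= x n + w / 2 ^+ n.
  have /andP[m1 m2] := mono m n; have /andP[n1 n2] := mono n m.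
  rewrite addnC in n1 n2; apply: le_trans m1 _; apply: le_trans n2.
  by rewrite lerDl.
have hs : has_sup (range x).
  split; first by exists (x 0%N), 0%N.
  by exists (x 0%N + w / 2 ^+ 0) => _ [m _ <-].
exists (sup (range x)) => n; apply/andP; split.
  by apply: ub_le_sup; [case: hs|exists n].
by apply: sup_le_ub; [case: hs|move=> _ [m _ <-]].
Qed.

(** Differentiability is asked only relative to the closed rectangle: the intended [G] is a
    continuous extension that stops being holomorphic beyond one side. *)
Lemma goursat (a b c d : R) : a <= b -> c <= d ->
  (forall x y, a <= x <= b -> c <= y <= d -> exists l, forall e : R, 0 < e ->
     exists2 r : R, 0 < r & forall x' y', a <= x' <= b -> c <= y' <= d ->
       `|x' - x| < r -> `|y' - y| < r ->
       nrm (G (mkC x' y') - G (mkC x y) - l * (mkC x' y' - mkC x y)) <= e * (`|x' - x| + `|y' - y|)) ->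
  rect_int G a b c d = 0.
Proof.
move=> ab cd dG; apply/eqP; rewrite -nrm_eq0 eq_le nrm_ge0 andbT leNgt; apply/negP => J0.
set w := b - a; set h := d - c; set J := nrm _ in J0.
have w0 : 0 <= w by rewrite subr_ge0.
have h0 : 0 <= h by rewrite subr_ge0.
have wn n : 0 <= w / 2 ^+ n by rewrite divr_ge0// exprn_ge0.
have hn n : 0 <= h / 2 ^+ n by rewrite divr_ge0// exprn_ge0.
have halfn (v : R) n : v / 2 ^+ n / 2 = v / 2 ^+ n.+1 by rewrite exprS; field; rewrite expf_neq0.
pose good (n : nat) (p q : R * R) :=
  [/\ (p.1 <= q.1) && (q.1 + w / 2 ^+ n.+1 <= p.1 + w / 2 ^+ n),
      (p.2 <= q.2) && (q.2 + h / 2 ^+ n.+1 <= p.2 + h / 2 ^+ n) &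
    nrm (rect_int G p.1 (p.1 + w / 2 ^+ n) p.2 (p.2 + h / 2 ^+ n)) / 4
      <= nrm (rect_int G q.1 (q.1 + w / 2 ^+ n.+1) q.2 (q.2 + h / 2 ^+ n.+1))].
have step np : exists q, good np.1 np.2 q.
  have [q] := @rect_int_quarter np.2.1 np.2.2 _ _ (wn np.1) (hn np.1).
  by rewrite !halfn => Hq; exists q.
have [nxt Hnxt] := choice step.
pose s := fix s n := if n is k.+1 then nxt (k, s k) else (a, c).
have sS n : good n (s n) (s n.+1) by apply: (Hnxt (n, s n)).
have [x Hx] := @nested_limit (fun n => (s n).1) w (fun n => let: And3 p _ _ := sS n in p) w0.
have [y Hy] := @nested_limit (fun n => (s n).2) h (fun n => let: And3 _ p _ := sS n in p) h0.
have JS n : J / 4 ^+ n <= nrm (rect_int G (s n).1 ((s n).1 + w / 2 ^+ n) (s n).2 ((s n).2 + h / 2 ^+ n)).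
  elim: n => [|n IH].
    by rewrite expr0 !divr1 /= /J /w /h (addrC a) (addrC c) !subrK.
  have [_ _] := sS n; apply: le_trans.
  rewrite (_ : J / 4 ^+ n.+1 = J / 4 ^+ n / 4); last by rewrite exprS; field; rewrite expf_neq0.
  by rewrite ler_pM2r.
have inx n : a <= (s n).1 /\ (s n).1 + w / 2 ^+ n <= b.
  elim: n => [|n [i1 i2]]; first by rewrite expr0 divr1 /= /w; split; lra.
  by have [/andP[p1 p2] _ _] := sS n; split; [exact: le_trans i1 p1|exact: le_trans p2 i2].
have iny n : c <= (s n).2 /\ (s n).2 + h / 2 ^+ n <= d.
  elim: n => [|n [i1 i2]]; first by rewrite expr0 divr1 /= /h; split; lra.
  by have [_ /andP[p1 p2] _] := sS n; split; [exact: le_trans i1 p1|exact: le_trans p2 i2].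
have xab : a <= x <= b by have := Hx 0%N; rewrite expr0 divr1 /= /w; lra.
have ycd : c <= y <= d by have := Hy 0%N; rewrite expr0 divr1 /= /h; lra.
have [l Hl] := dG x y xab ycd.
(* A rectangle reduced to a point is excluded before dividing by w + h. *)
have wh : 0 < w + h.
  rewrite lt_def addr_ge0// andbT; apply/negP => /eqP wh0.
  have ww : w = 0 by lra.
  have hh : h = 0 by lra.
  have : J <= 0; last by rewrite leNgt J0.
  have H := @rect_int_sub_affine 0 0 a b c d (nrm (G (mkC a c))) ab cd.
  apply: le_trans (H _) _; last by rewrite -/w -/h ww hh addr0 !mulr0.
  move=> x' y' H1 H2; rewrite mul0r addr0 subr0.
  have -> : x' = a by rewrite /w in ww; lra.
  by have -> : y' = c by rewrite /h in hh; lra.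
(* At depth n, deviation times perimeter is then 2 e (w + h)^2 / 4^n, which is half of the lower
   bound J / 4^n. *)
set e := J / (4 * (w + h) ^+ 2).
have e0 : 0 < e by rewrite divr_gt0// mulr_gt0// exprn_gt0.
have [r r0 Hr] := Hl e e0.
have [n Hn] := small_dyadic (w + h) r0.
have wr : w / 2 ^+ n < r by apply: le_lt_trans Hn; rewrite ler_pM2r ?invr_gt0 ?exprn_gt0// lerDl.
have hr : h / 2 ^+ n < r by apply: le_lt_trans Hn; rewrite ler_pM2r ?invr_gt0 ?exprn_gt0// lerDr.
have [ix1 ix2] := inx n; have [iy1 iy2] := iny n.
have {Hx}/andP[hx1 hx2] := Hx n; have {Hy}/andP[hy1 hy2] := Hy n.
set wn' := w / 2 ^+ n in wr ix2 hx2; set hn' := h / 2 ^+ n in hr iy2 hy2.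
have wn0 : 0 <= wn' := wn n; have hn0 : 0 <= hn' := hn n.
have := @rect_int_sub_affine (G (mkC x y) - l * mkC x y) l (s n).1 ((s n).1 + wn')
  (s n).2 ((s n).2 + hn') (e * (wn' + hn')) ltac:(lra) ltac:(lra).
have HH : forall x0 y0, (s n).1 <= x0 <= (s n).1 + wn' -> (s n).2 <= y0 <= (s n).2 + hn' ->
   nrm (G (mkC x0 y0) - (G (mkC x y) - l * mkC x y + l * mkC x0 y0)) <= e * (wn' + hn').
  move=> x' y' /andP[p1 p2] /andP[q1 q2].
  rewrite (_ : _ - _ = G (mkC x' y') - G (mkC x y) - l * (mkC x' y' - mkC x y)); last by ring.
  have X1 : `|x' - x| <= wn' by rewrite ler_norml; lra.
  have X2 : `|y' - y| <= hn' by rewrite ler_norml; lra.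
  apply: le_trans (Hr _ _ _ _ _ _) _; try lra.
  by rewrite ler_pM2l// lerD.
move=> /(_ HH); apply/negP; rewrite -ltNge; apply: lt_le_trans (JS n).
rewrite (_ : _ * _ = J / 4 ^+ n / 2); last first.
  rewrite /e /wn' /hn' (_ : 4 ^+ n = 2 ^+ n * 2 ^+ n :> R); last by rewrite -exprMn -natrM.
  by field; rewrite expf_neq0//= gt_eqF.
have : 0 < J / 4 ^+ n by rewrite divr_gt0// exprn_gt0.
lra.
Qed.
End OneFunction.
End Goursat.

(** * The mean value property *)

Section MeanValue.
Variable R : realType.
Local Notation C := (Cplx R).

Definition cis (y : R) : C := mkC (cos y) (sin y).
Definition cexp (z : C) : C := rc (expR (cRe z)) * cis (cIm z).

Lemma nrm_cis y : nrm (cis y) = 1.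
Proof. by rewrite /nrm /= cos2Dsin2 sqrtr1. Qed.
Lemma cisD x y : cis (x + y) = cis x * cis y.
Proof.
apply: c_ext; rewrite ?cReM ?cImM /cis /cRe /cIm /= ?cosD ?sinD//; ring.
Qed.
Lemma cis0 : cis 0 = 1. Proof. by rewrite /cis cos0 sin0. Qed.
Lemma cis2pi : cis (pi *+ 2) = 1. Proof. by rewrite /cis cos2pi sin2pi. Qed.
Lemma nrm_cexp z : nrm (cexp z) = expR (cRe z).
Proof. by rewrite nrmM nrm_cis mulr1 nrm_rc ger0_norm ?expR_ge0. Qed.
Lemma cexp_neq0 z : cexp z != 0.
Proof. by rewrite -nrm_eq0 nrm_cexp expR_eq0. Qed.
Lemma cexpD z w : cexp (z + w) = cexp z * cexp w.
Proof. by rewrite /cexp cReD cImD expRD rcM cisD; ring. Qed.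
Lemma cexp0 : cexp 0 = 1.
Proof. by rewrite /cexp -rc0 cRe_rc cIm_rc expR0 cis0 mulr1. Qed.

Lemma pder_cis t : pder cis t (cI R * cis t).
Proof.
have -> : cI R * cis t = mkC (- sin t) (cos t).
  by apply: c_ext; rewrite ?cReM ?cImM /cis /cRe /cIm /=; ring.
exact: pder_mk.
Qed.

Lemma cder_cexp0 : cder cexp 0 1.
Proof.
move=> e e0; have e3 : 0 < e / 3 by rewrite divr_gt0.
have [d1 d10 H1] := (is_derive_rder _ _ _).1 (is_derive_expR (0:R)) _ e3.
have [d2 d20 H2] := @pder_cis 0 _ e3.
have [d3 d30 H3] := pder_cont (@pder_cis 0) e3.
exists (Num.min d1 (Num.min d2 d3)); first by rewrite !lt_min d10 d20.
move=> z; rewrite !lt_min subr0 => /andP[z1 /andP[z2 z3]].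
have {}H1 := H1 (cRe z) ltac:(by rewrite subr0; apply: le_lt_trans (nrm_Re _) z1).
have {}H2 := H2 (cIm z) ltac:(by rewrite subr0; apply: le_lt_trans (nrm_Im _) z2).
have {}H3 := H3 (cIm z) ltac:(by rewrite subr0; apply: le_lt_trans (nrm_Im _) z3).
rewrite subr0 expR0 mul1r in H1; rewrite subr0 cis0 mulr1 in H2; rewrite cis0 in H3.
rewrite cexp0 mul1r /cexp.
set c := cis _ in H2 H3 *; set E := expR _ in H1 *.
(* The error of the real exponential, a mixed product of second order, and the error of [cis]: each
   receives a third of [e]. *)
rewrite (_ : _ - _ - z = rc (E - 1 - cRe z) * c + rc (cRe z) * (c - 1) + (c - 1 - cI R * rc (cIm z))); last first.
  by rewrite -{1}(mkC_ReIm z) mkCE !rcB rc1; ring.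
apply: le_trans (nrmD _ _) _; apply: le_trans (lerD (nrmD _ _) (lexx _)) _.
rewrite !nrmM nrm_cis mulr1 !nrm_rc.
have zr := nrm_Re z; have zi := nrm_Im z.
have X1 : `|E - 1 - cRe z| <= e / 3 * nrm z.
  by apply: le_trans H1 _; rewrite ler_pM2l.
have X2 : nrm (c - 1 - cI R * rc (cIm z)) <= e / 3 * nrm z.
  by apply: le_trans H2 _; rewrite ler_pM2l.
have X3 : `|cRe z| * nrm (c - 1) <= nrm z * (e / 3).
  by apply: ler_pM => //; [exact: nrm_ge0|exact: ltW].
lra.
Qed.

Lemma cder_cexp z : cder cexp z (cexp z).
Proof.
have H : cder (fun w => cexp z * cexp (w - z)) z (cexp z).
  have h : cder (fun w => w - z) z 1.
    by have := cderB (cder_id z) (cder_cst z z); rewrite subr0.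
  have := cder_comp (g := cexp) h; rewrite subrr => /(_ _ cder_cexp0).
  by move=> /(cderZ (cexp z)); rewrite !mulr1.
by apply: cder_near H; exists 1 => // w _; rewrite -cexpD addrC subrK.
Qed.

Definition circ_int (g : C -> C) (w : C) (r : R) : C :=
  cint (fun t => g (w + rc r * cis t)) 0 (pi *+ 2).

Lemma two_pi_gt0 : 0 < pi *+ 2 :> R. Proof. by rewrite mulrn_wgt0// pi_gt0. Qed.

Lemma pder_circle w (r t : R) : pder (fun t => w + rc r * cis t) t (rc r * (cI R * cis t)).
Proof. by have := pderD (pder_cst w t) (pderZ (rc r) (pder_cis t)); rewrite add0r. Qed.

Lemma pcont_circ g w (r : R) : 0 < r -> (forall z, nrm (z - w) = r -> ccont g z) ->
  forall t, pcont (fun t => g (w + rc r * cis t)) t.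
Proof.
move=> r0 cg t; apply: ccont_pcont; last exact: pder_cont (pder_circle _ _ _).
by apply: cg; rewrite (addrC w) addrK nrmM nrm_cis mulr1 nrm_rc gtr0_norm.
Qed.

Definition hol_at (g : C -> C) z := exists l, cder g z l.

Lemma cancel_I (A X Y : C) : A + cI R * X - A - cI R * Y = 0 -> Y = X.
Proof.
move=> H; apply: (mulfI (cI_neq0 R)); apply/esym/eqP; rewrite -subr_eq0 -H.
by apply/eqP; ring.
Qed.

(* In logarithmic coordinates circles become vertical segments, and the horizontal
   sides of the rectangle cancel by periodicity. *)
Lemma circ_int_indep (f : C -> C) w (x1 x2 : R) : x1 <= x2 ->
  (forall z, 0 < nrm (z - w) <= expR x2 -> hol_at f z) ->
  circ_int f w (expR x1) = circ_int f w (expR x2).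
Proof.
move=> x12 hf.
pose g z := f (w + cexp z).
have hg z : cRe z <= x2 -> hol_at g z.
  move=> zx; have [l fl] := hf (w + cexp z) ltac:(by rewrite (addrC w) addrK nrm_cexp expR_gt0 ler_expR).
  exists (l * cexp z); apply: (cder_comp (f := fun z => w + cexp z)) => //.
  by have := cderD (cder_cst w z) (cder_cexp z); rewrite add0r.
(* [goursat] wants continuity on the whole plane, while [g] is controlled only for real parts up to
   [x2]; capping the real part extends it continuously. *)
pose G z := g (mkC (Num.min (cRe z) x2) (cIm z)).
have minB (x y : R) : `|Num.min x x2 - Num.min y x2| <= `|x - y|.
  have h1 := ler_norm (x - y); have h2 := ler_norm (y - x); rewrite distrC in h2.
  by rewrite ler_norml; case: (leP x x2) => h3; case: (leP y x2) => h4; apply/andP; split; lra.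
have contG z : ccont G z.
  have [l gl] := hg (mkC (Num.min (cRe z) x2) (cIm z)) ltac:(by rewrite cRe_mk ge_min lexx orbT).
  move=> e e0; have [d d0 H] := cder_cont gl e0.
  exists (d / 2) => [|z' zz]; first by rewrite divr_gt0.
  apply: H; apply: le_lt_trans (nrm_le _) _; rewrite cReB cImB !cRe_mk !cIm_mk.
  have := minB (cRe z') (cRe z); have := nrm_Re (z' - z); have := nrm_Im (z' - z).
  rewrite cReB cImB; lra.
have J := @goursat R G contG x1 x2 0 (pi *+ 2) x12 (ltW two_pi_gt0).
have GE x y : x <= x2 -> G (mkC x y) = g (mkC x y).
  by move=> h; rewrite /G cRe_mk cIm_mk min_l.
have {}J : rect_int G x1 x2 0 (pi *+ 2) = 0.
  apply: J => x y /andP[hx1 hx2] hy; have [l gl] := hg (mkC x y) hx2.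
  exists l => e e0; have [d d0 H] := gl e e0.
  exists (d / 2) => [|x' y' /andP[hx1' hx2'] hy' xx yy]; first by rewrite divr_gt0.
  have nn : nrm (mkC x' y' - mkC x y) <= `|x' - x| + `|y' - y|.
    by apply: le_trans (nrm_le _) _; rewrite cReB cImB.
  rewrite !GE//; apply: le_trans (H _ _) _; first by apply: le_lt_trans nn _; lra.
  by rewrite ler_pM2l.
have per x : G (mkC x 0) = G (mkC x (pi *+ 2)).
  by rewrite /G /g /cexp !cRe_mk !cIm_mk cis0 cis2pi.
move: J; rewrite /rect_int (_ : (fun x => G (mkC x 0)) = (fun x => G (mkC x (pi *+ 2)))); last first.
  by apply/funext => x; exact: per.
have E x : x <= x2 -> (fun y => G (mkC x y)) = (fun y => f (w + rc (expR x) * cis y)).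
  by move=> h; apply/funext => y; rewrite GE.
by rewrite (E _ (lexx x2)) (E _ x12); exact: cancel_I.
Qed.

(** The circle may be shrunk because holomorphy is used off the centre, and continuity at [w] gives
    the limit. A continuous isolated singularity at [w] is thus allowed, which the formula for the
    derivative exploits. *)
Lemma circ_int_MVP (f : C -> C) w (r : R) : 0 < r ->
  (forall z, 0 < nrm (z - w) <= r -> hol_at f z) -> ccont f w ->
  circ_int f w r = rc (pi *+ 2) * f w.
Proof.
move=> r0 hf cf; have p0 := two_pi_gt0.
have cc z : 0 < nrm (z - w) <= r -> ccont f z by move=> /hf[l /cder_cont].
apply/eqP; rewrite -subr_eq0 -nrm_eq0 eq_le nrm_ge0 andbT; apply/ler_addgt0Pr => e e0; rewrite add0r.
have [d d0 H] := cf (e / (pi *+ 2)) ltac:(by rewrite divr_gt0).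
pose s := Num.min r (d / 2).
have s0 : 0 < s by rewrite lt_min r0 divr_gt0.
have sr : s <= r by rewrite ge_min lexx.
have sd : s <= d / 2 by rewrite ge_min lexx orbT.
have -> : circ_int f w r = circ_int f w s.
  have rE : expR (ln r) = r by rewrite lnK ?posrE.
  have sE : expR (ln s) = s by rewrite lnK ?posrE.
  have H1 : ln s <= ln r by rewrite ler_ln ?posrE.
  have := @circ_int_indep f w (ln s) (ln r) H1; rewrite rE sE => -> //.
have -> : rc (pi *+ 2) * f w = cint (fun=> f w) 0 (pi *+ 2).
  by rewrite cint_cst ?(ltW p0)// subr0 mulrC.
have cs t : pcont (fun t => f (w + rc s * cis t)) t.
  by apply: pcont_circ => // z zs; apply: cc; rewrite zs s0.
rewrite /circ_int -cintB ?(ltW p0)//; last by move=> t; exact: pcont_cst.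
have -> : e = e / (pi *+ 2) * (pi *+ 2 - 0) by rewrite subr0 divfK// gt_eqF.
apply: cint_bound (ltW p0) _ _ => t.
  by apply: pcontB => //; exact: pcont_cst.
move=> _; apply/ltW/H; rewrite (addrC w) addrK nrmM nrm_cis mulr1 nrm_rc gtr0_norm//.
lra.
Qed.
End MeanValue.

(** * The maximum principle and derivatives *)

Section Holomorphic.
Variable R : realType.
Local Notation C := (Cplx R).
Implicit Types (f g : C -> C) (z w a : C).

(* Sealed, because comparing [derive1 f z] with [derive1 f w] by conversion does not terminate
   in practice. *)
Fact dv_key : unit. Proof. exact: tt. Qed.
Definition dv f : C -> C := locked_with dv_key (derive1 f).
Lemma dvE f : dv f = derive1 f. Proof. by rewrite /dv unlock. Qed.

Lemma hol_cont f z : hol_at f z -> ccont f z.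
Proof. by case=> l /cder_cont. Qed.
Lemma hol_cder f z : hol_at f z -> cder f z (dv f z).
Proof. by case=> l fl; rewrite dvE (cder_derive1 fl). Qed.
Lemma cder_dv f z l : cder f z l -> dv f z = l.
Proof. by move=> fl; rewrite dvE (cder_derive1 fl). Qed.
Lemma hol_cst a z : hol_at (fun=> a) z.
Proof. by exists 0; exact: cder_cst. Qed.
Lemma hol_id z : hol_at (fun w => w) z.
Proof. by exists 1; exact: cder_id. Qed.
Lemma holD f g z : hol_at f z -> hol_at g z -> hol_at (fun w => f w + g w) z.
Proof. by case=> l fl [m gm]; exists (l + m); exact: cderD. Qed.
Lemma holB f g z : hol_at f z -> hol_at g z -> hol_at (fun w => f w - g w) z.
Proof. by case=> l fl [m gm]; exists (l - m); exact: cderB. Qed.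
Lemma holM f g z : hol_at f z -> hol_at g z -> hol_at (fun w => f w * g w) z.
Proof. by case=> l fl [m gm]; eexists; exact: cderM fl gm. Qed.
Lemma holX f n z : hol_at f z -> hol_at (fun w => f w ^+ n) z.
Proof. by case=> l fl; eexists; exact: cderX fl. Qed.
Lemma holV f z : hol_at f z -> f z != 0 -> hol_at (fun w => (f w)^-1) z.
Proof. by case=> l fl f0; eexists; exact: cderV fl f0. Qed.
Lemma hol_div f g z : hol_at f z -> hol_at g z -> g z != 0 -> hol_at (fun w => f w / g w) z.
Proof. by case=> l fl [m gm] g0; eexists; exact: cder_div fl gm g0. Qed.
Lemma hol_comp f g z : hol_at f z -> hol_at g (f z) -> hol_at (fun w => g (f w)) z.
Proof. by case=> l fl [m gm]; eexists; exact: cder_comp fl gm. Qed.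
Lemma hol_near f g z : (exists2 d : R, 0 < d & forall w, nrm (w - z) < d -> f w = g w) ->
  hol_at f z -> hol_at g z.
Proof. by move=> h [l fl]; exists l; exact: cder_near fl. Qed.

Lemma max_center f w (r M : R) : 0 < r -> (forall z, nrm (z - w) <= r -> hol_at f z) ->
  (forall z, nrm (z - w) = r -> nrm (f z) <= M) -> nrm (f w) <= M.
Proof.
move=> r0 hf fM; have p0 := two_pi_gt0 R.
have MV : circ_int f w r = rc (pi *+ 2) * f w.
  apply: circ_int_MVP => // [z /andP[_ /hf]//|].
  by apply: hol_cont; apply: hf; rewrite subrr nrm0 ltW.
have := @cint_bound R (fun t => f (w + rc r * cis t)) 0 (pi *+ 2) M (ltW p0).
rewrite -/(circ_int f w r) MV nrmM nrm_rc (gtr0_norm p0) subr0 mulrC ler_pM2r//; apply.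
  by apply: pcont_circ => // z zr; apply: hol_cont; apply: hf; rewrite zr.
by move=> t _; apply: fM; rewrite (addrC w) addrK nrmM nrm_cis mulr1 nrm_rc gtr0_norm.
Qed.

(** Shows that z -> (z + a) / (1 + conj a z) preserves the unit disc and circle when |a| < 1; it
    also computes the hyperbolic factors 1 - |z|^2 in [schwarz_pick_local]. *)
Lemma moebius_identity a z :
  nrm (1 + cj a * z) ^+ 2 - nrm (z + a) ^+ 2 = (1 - nrm a ^+ 2) * (1 - nrm z ^+ 2).
Proof.
rewrite !nrm_sqr; case: a z => [a b] [x y].
by rewrite /cj /cRe /cIm /= ; ring.
Qed.

Theorem max_modulus f w (r M : R) : 0 < r -> (forall z, nrm (z - w) <= r -> hol_at f z) ->
  (forall z, nrm (z - w) = r -> nrm (f z) <= M) -> forall z, nrm (z - w) <= r -> nrm (f z) <= M.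
Proof.
move=> r0 hf fM a; rewrite le_eqVlt => /orP[/eqP/fM//|ar].
have r0' : rc r != 0 by rewrite rc_eq0 gt_eqF.
set al := (a - w) / rc r.
have al1 : nrm al < 1 by rewrite nrmM nrmV nrm_rc gtr0_norm// ltr_pdivrMr// mul1r.
have den z : nrm z <= 1 -> 1 + cj al * z != 0.
  move=> z1; rewrite -nrm_gt0; have := nrmBl 1 (- (cj al * z)).
  rewrite nrm1 nrmN opprK nrmM nrm_cj; apply: lt_le_trans; rewrite subr_gt0.
  by apply: le_lt_trans al1; rewrite ler_piMr// nrm_ge0.
pose phi z := w + rc r * ((z + al) / (1 + cj al * z)).
have nphi z : nrm (phi z - w) = r * (nrm (z + al) / nrm (1 + cj al * z)).
  by rewrite /phi (addrC w) addrK !nrmM nrmV nrm_rc gtr0_norm.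
have phi1 z : nrm z <= 1 -> nrm (phi z - w) <= r.
  move=> z1; rewrite nphi ger_pMr// ler_pdivrMr ?nrm_gt0 ?den// mul1r.
  rewrite -(ler_pXn2r (n := 2)) ?nnegrE ?nrm_ge0// -subr_ge0 moebius_identity.
  by rewrite mulr_ge0// subr_ge0 expr_le1 ?nrm_ge0// ltW.
have phi2 z : nrm z = 1 -> nrm (phi z - w) = r.
  move=> z1; have := moebius_identity al z; rewrite z1 expr1n subrr mulr0 => /eqP.
  rewrite subr_eq0 eqrXn2 ?nrm_ge0// nphi => /eqP <-.
  by rewrite divff ?mulr1// nrm_eq0 den// z1.
have hphi z : nrm z <= 1 -> hol_at phi z.
  move=> z1; apply: holD; first exact: hol_cst.
  apply: holM; first exact: hol_cst.
  apply: hol_div; [by apply: holD; [exact: hol_id|exact: hol_cst]| |exact: den].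
  by apply: holD; [exact: hol_cst|apply: holM; [exact: hol_cst|exact: hol_id]].
have := @max_center (fun z => f (phi z)) 0 1 M ltr01.
have -> : phi 0 = a by rewrite /phi add0r mulr0 addr0 divr1 mulrC divfK// addrC subrK.
apply=> z; rewrite subr0 => z1.
  by apply: hol_comp; [exact: hphi|apply: hf; exact: phi1].
by apply: fM; exact: phi2.
Qed.

Definition dquot f w z := (f z - f w) / (z - w).

(** The difference quotient extends continuously to [w] by the derivative, so the mean value
    property turns into an integral formula for f'. *)
Lemma derive_circ_int f w (r : R) : 0 < r -> (forall z, nrm (z - w) <= r -> hol_at f z) ->
  circ_int (dquot f w) w r = rc (pi *+ 2) * dv f w.
Proof.
move=> r0 hf; pose g z := if z == w then dv f w else dquot f w z.
have gz z : z != w -> exists2 d : R, 0 < d & forall z', nrm (z' - z) < d -> dquot f w z' = g z'.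
  move=> zw; exists (nrm (z - w)); rewrite ?nrm_sub_gt0// => z' zz'.
  by rewrite /g; case: eqP zz' => // ->; rewrite nrmC ltxx.
have -> : circ_int (dquot f w) w r = circ_int g w r.
  rewrite /circ_int; congr (cint _ _ _); apply/funext => t; rewrite /g ifF//.
  by apply/negbTE; rewrite -nrm_sub_gt0 (addrC w) addrK nrmM nrm_cis mulr1 nrm_rc gtr0_norm.
rewrite (circ_int_MVP (f := g) (w := w) r0); first by rewrite /g eqxx.
  move=> z /andP[z0 zr]; rewrite nrm_sub_gt0 in z0; apply: hol_near (gz _ z0) _.
  apply: hol_div; [apply: holB; [exact: hf|exact: hol_cst]|apply: holB; [exact: hol_id|exact: hol_cst]|].
  by rewrite subr_eq0.
move=> e e0.
have [d d0 H] := hol_cder (hf w ltac:(by rewrite subrr nrm0 ltW)) (divr_gt0 e0 (ltr0Sn _ 1)).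
exists d => // z zd; rewrite /g eqxx; case: eqP => [_|/eqP zw]; first by rewrite subrr nrm0.
have nz : 0 < nrm (z - w) by rewrite nrm_sub_gt0.
have zw' : z - w != 0 by rewrite subr_eq0.
apply: le_lt_trans (_ : _ <= e / 2) _; last by lra.
rewrite -(ler_pM2r nz) -nrmM mulrBl divfK//.
exact: H.
Qed.

Lemma circ_int_bound f w (r M : R) : 0 < r -> (forall z, nrm (z - w) = r -> ccont f z) ->
  (forall z, nrm (z - w) = r -> nrm (f z) <= M) -> nrm (circ_int f w r) <= M * (pi *+ 2).
Proof.
move=> r0 cf fM; rewrite -{1}(subr0 (pi *+ 2)); apply: cint_bound.
- exact: ltW (two_pi_gt0 R).
- exact: pcont_circ.
- by move=> t _; apply: fM; rewrite (addrC w) addrK nrmM nrm_cis mulr1 nrm_rc gtr0_norm.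
Qed.

Lemma segment_MVI f (df : C -> C) z w (L : R) :
  (forall t : R, 0 <= t <= 1 -> cder f (w + rc t * (z - w)) (df (w + rc t * (z - w)))) ->
  (forall t : R, 0 <= t <= 1 -> nrm (df (w + rc t * (z - w))) <= L) ->
  nrm (f z - f w) <= L * nrm (z - w).
Proof.
move=> fd dL.
have := @path_MVI R (fun t => f (w + rc t * (z - w))) (fun t => df (w + rc t * (z - w)) * (z - w))
  0 1 (L * nrm (z - w)) ler01.
rewrite rc1 rc0 mul1r mul0r addr0 (addrC w) subrK subr0 mulr1; apply=> t t01.
  apply: cder_pder; first exact: fd.
  have -> : (fun t => w + rc t * (z - w)) = (fun t => w + (z - w) * rc t).
    by apply/funext => s; rewrite mulrC.
  by have := pderD (pder_cst w t) (pderZ (z - w) (pder_rc t)); rewrite add0r mulr1.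
by rewrite nrmM ler_wpM2r ?nrm_ge0// dL.
Qed.

Lemma segment_dist a z w (r t : R) : 0 <= t <= 1 -> nrm (z - a) < r -> nrm (w - a) < r ->
  nrm (w + rc t * (z - w) - a) < r.
Proof.
move=> /andP[t0 t1] za wa.
rewrite (_ : _ - a = rc (1 - t) * (w - a) + rc t * (z - a)); last by rewrite rcB rc1; ring.
apply: le_lt_trans (nrmD _ _) _; rewrite !nrmM !nrm_rc !ger0_norm ?subr_ge0//.
have [->|tn0] := eqVneq t 0; first by rewrite subr0 mul1r mul0r addr0.
have tp : 0 < t by rewrite lt_def tn0.
rewrite (_ : r = (1 - t) * r + t * r); last by ring.
by apply: ler_ltD; [rewrite ler_wpM2l ?subr_ge0// ltW|rewrite ltr_pM2l].
Qed.

Lemma segment_len z w (t : R) : 0 <= t <= 1 -> nrm (w + rc t * (z - w) - w) <= nrm (z - w).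
Proof.
by move=> /andP[t0 t1]; rewrite (addrC w) addrK nrmM nrm_rc ger0_norm// ler_piMl ?nrm_ge0.
Qed.

Lemma dv_bound f w (r M : R) : 0 < r -> (forall z, nrm (z - w) <= r -> hol_at f z) ->
  (forall z, nrm (z - w) = r -> nrm (f z - f w) <= M) -> nrm (dv f w) <= M / r.
Proof.
move=> r0 hf fM; have p0 := two_pi_gt0 R.
have := @circ_int_bound (dquot f w) w r (M / r) r0.
rewrite derive_circ_int// nrmM nrm_rc (gtr0_norm p0) (mulrC (pi *+ 2)) ler_pM2r//; apply=> z zr.
  apply: hol_cont; apply: hol_div; [apply: holB; [apply: hf; rewrite zr//|exact: hol_cst]|
    apply: holB; [exact: hol_id|exact: hol_cst]|].
  by rewrite -nrm_gt0 zr.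
by rewrite nrmM nrmV zr ler_pM2r ?invr_gt0// fM.
Qed.

Lemma two_pi_cancel (X : C) (M : R) :
  nrm (rc (pi *+ 2) * X) <= M * (pi *+ 2 - 0) -> nrm X <= M.
Proof.
have p0 := two_pi_gt0 R.
by rewrite nrmM nrm_rc (gtr0_norm p0) (mulrC (pi *+ 2)) subr0 ler_pM2r.
Qed.

(** A bootstrap through [repr], which expresses f' by circles of one fixed radius: bounded f gives f
    Lipschitz, then f' Lipschitz, then the second-order bound [f2] for f; inserted into the same
    integral, [f2] differentiates f'. *)
Theorem hol_dv f w0 (r0 : R) : 0 < r0 -> (forall z, nrm (z - w0) < r0 -> hol_at f z) ->
  hol_at (dv f) w0.
Proof.
move=> r00 hf; have p0 := two_pi_gt0 R.
have [d1 d10 Hd1] := hol_cont (hf w0 ltac:(by rewrite subrr nrm0)) ltr01.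
(* Circles of radius [d] about points within 3 d of [w0] have to stay in the disc of radius 5 d
   where [f] is bounded. *)
pose d := Num.min r0 d1 / 5.
have d0 : 0 < d by rewrite divr_gt0// lt_min r00.
have dr : d * 5 <= r0 by rewrite /d divfK// ge_min lexx.
have dd1 : d * 5 <= d1 by rewrite /d divfK// ge_min lexx orbT.
set M := nrm (f w0) + 1.
have fM z : nrm (z - w0) < d * 5 -> nrm (f z) <= M.
  move=> zd; rewrite -(subrK (f w0) (f z)) (le_trans (nrmD _ _))// addrC lerD2l.
  by apply/ltW/Hd1; lra.
have tri z w : nrm (z - w0) <= nrm (z - w) + nrm (w - w0).
  by rewrite (_ : z - w0 = (z - w) + (w - w0)) ?nrmD//; ring.
have hf' z : nrm (z - w0) < d * 5 -> hol_at f z by move=> ?; apply: hf; lra.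
pose L := (M + M) / d.
have dL w : nrm (w - w0) < d * 3 -> nrm (dv f w) <= L.
  move=> wd; apply: dv_bound => // z zw.
    by apply: hf'; have := tri z w; lra.
  apply: le_trans (nrmB _ _) _; apply: lerD; apply: fM; last by lra.
  by have := tri z w; lra.
have L0 : 0 <= L.
  by apply: le_trans (dL w0 _); rewrite ?nrm_ge0// subrr nrm0 mulr_gt0.
have fL z w : nrm (z - w0) < d * 3 -> nrm (w - w0) < d * 3 -> nrm (f z - f w) <= L * nrm (z - w).
  move=> zd wd; apply: (@segment_MVI f (dv f)) => t t01; have H := segment_dist t01 zd wd.
    by apply: hol_cder; apply: hf'; lra.
  exact: dL.
have repr w : nrm (w - w0) < d * 3 ->
   cint (fun t => (f (w + rc d * cis t) - f w) / (rc d * cis t)) 0 (pi *+ 2) = rc (pi *+ 2) * dv f w.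
  move=> wd; rewrite -(@derive_circ_int _ _ d)// => [|z zw]; last first.
    by apply: hf'; have := tri z w; lra.
  rewrite /circ_int; congr (cint _ _ _); apply/funext => t; rewrite /dquot.
  by congr (_ / _); rewrite (addrC w) addrK.
have nd t : nrm (rc d * cis t) = d by rewrite nrmM nrm_cis mulr1 nrm_rc gtr0_norm.
have cpath (g : C -> C) w t : (forall z, nrm (z - w) = d -> ccont g z) ->
    pcont (fun t => (g (w + rc d * cis t) - g w) / (rc d * cis t)) t.
  move=> cg; apply: pcontM; first by apply: pcontB; [exact: pcont_circ|exact: pcont_cst].
  apply: (ccont_pcont (f := fun z => z^-1)); last exact: pder_cont (pderZ _ (pder_cis t)).
  by apply: cder_cont (cder_inv _); rewrite -nrm_gt0 nd.
have cpf w t : nrm (w - w0) < d * 3 -> pcont (fun t => (f (w + rc d * cis t) - f w) / (rc d * cis t)) t.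
  by move=> wd; apply: cpath => z zw; apply: hol_cont; apply: hf'; have := tri z w; lra.
pose K := (L + L) / d.
have dK z w : nrm (z - w0) < d * 2 -> nrm (w - w0) < d * 2 ->
    nrm (dv f z - dv f w) <= K * nrm (z - w).
  move=> zd wd.
  have z3 : nrm (z - w0) < d * 3 by lra.
  have w3 : nrm (w - w0) < d * 3 by lra.
  apply: two_pi_cancel; rewrite mulrBr -(repr z z3) -(repr w w3).
  rewrite -cintB ?(ltW p0)//; try by move=> t; exact: cpf.
  apply: cint_bound (ltW p0) _ _ => t.
    by apply: pcontB; exact: cpf.
  move=> _; rewrite -mulrBl nrmM nrmV nd /K mulrAC ler_pM2r ?invr_gt0//.
  rewrite (_ : _ - _ - _ = (f (z + rc d * cis t) - f (w + rc d * cis t)) - (f z - f w)); last by ring.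
  apply: le_trans (nrmB _ _) _; rewrite mulrDl; apply: lerD; last exact: fL.
  apply: le_trans (fL _ _ _ _) _.
  - by have := tri (z + rc d * cis t) z; rewrite (addrC z) addrK nd; lra.
  - by have := tri (w + rc d * cis t) w; rewrite (addrC w) addrK nd; lra.
  - by rewrite (_ : _ - _ = z - w)//; ring.
have K0 : 0 <= K by rewrite divr_ge0 ?(ltW d0)// addr_ge0.
have f2 z w : nrm (z - w0) < d * 2 -> nrm (w - w0) < d * 2 ->
    nrm (f z - f w - dv f w * (z - w)) <= K * nrm (z - w) * nrm (z - w).
  move=> zd wd.
  rewrite (_ : _ - _ - _ = (f z - dv f w * z) - (f w - dv f w * w)); last by ring.
  apply: (@segment_MVI (fun u => f u - dv f w * u) (fun u => dv f u - dv f w)) => t t01;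
    have H := segment_dist t01 zd wd.
    apply: cderB; first by apply: hol_cder; apply: hf'; lra.
    by have := cderZ (dv f w) (cder_id (w + rc t * (z - w))); rewrite mulr1.
  by apply: le_trans (dK _ _ _ _) _ => //; rewrite ler_wpM2l// segment_len.
have cdf z : nrm (z - w0) < d * 2 -> ccont (dv f) z.
  move=> zd e e0; exists (Num.min (d * 2 - nrm (z - w0)) (e / (K + 1))).
    by rewrite lt_min subr_gt0 zd divr_gt0// ltr_wpDl.
  move=> z'; rewrite lt_min => /andP[h1]; rewrite ltr_pdivlMr ?ltr_wpDl// => h2.
  apply: le_lt_trans (dK _ _ _ zd) _; first by have := tri z' z; lra.
  by apply: le_lt_trans h2; rewrite mulrC ler_wpM2l ?nrm_ge0// lerDl.
have cpd t : pcont (fun t => (dv f (w0 + rc d * cis t) - dv f w0) / (rc d * cis t)) t.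
  by apply: cpath => z zw; apply: cdf; lra.
(* The derivative predicted by differentiating [repr] under the integral sign. *)
set l := cint (fun t => (dv f (w0 + rc d * cis t) - dv f w0) / (rc d * cis t)) 0 (pi *+ 2)
   / rc (pi *+ 2).
have p0' : rc (pi *+ 2) != 0 :> C by rewrite rc_eq0 gt_eqF.
have w00 : nrm (w0 - w0) < d by rewrite subrr nrm0.
exists l => e e0; pose N := (K + K) / d.
have N0 : 0 <= N by rewrite divr_ge0 ?(ltW d0)// addr_ge0.
exists (Num.min (d / 2) (e / (N + 1))).
  by rewrite lt_min; apply/andP; split; apply: divr_gt0 => //; apply: ltr_wpDl.
move=> w; rewrite lt_min => /andP[h1]; rewrite ltr_pdivlMr ?ltr_wpDl// => h2.
apply: (@le_trans _ _ (N * nrm (w - w0) * nrm (w - w0))); last first.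
  rewrite ler_wpM2r ?nrm_ge0//; apply: le_trans (ltW h2); rewrite mulrC.
  by rewrite ler_wpM2l ?nrm_ge0// lerDl.
have w3 : nrm (w - w0) < d * 3 by lra.
have w03 : nrm (w0 - w0) < d * 3 by lra.
apply: two_pi_cancel; rewrite 2!mulrBr -(repr w w3) -(repr w0 w03).
rewrite (_ : rc (pi *+ 2) * (l * (w - w0)) = (w - w0) * (l * rc (pi *+ 2))); last by ring.
rewrite /l divfK// -cintZ ?(ltW p0)//.
rewrite -!cintB ?(ltW p0)//; try by move=> t; apply: cpf; lra.
- apply: cint_bound (ltW p0) _ _ => t.
    by apply: pcontB; [apply: pcontB; apply: cpf; lra|exact: pcontZ].
  move=> _; rewrite mulrA -!mulrBl nrmM nrmV nd /N -!mulrA (mulrC d^-1) !mulrA ler_pM2r ?invr_gt0//.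
  set e1 := rc d * cis t.
  rewrite (_ : _ - _ - _ = (f (w + e1) - f (w0 + e1) - dv f (w0 + e1) * ((w + e1) - (w0 + e1)))
     - (f w - f w0 - dv f w0 * (w - w0))); last by ring.
  apply: le_trans (nrmB _ _) _; rewrite !mulrDl; apply: lerD; last by apply: f2; lra.
  have ne : nrm e1 = d := nd t.
  have E : w + e1 - (w0 + e1) = w - w0 by ring.
  rewrite -E; apply: f2.
  + by have := tri (w + e1) w; rewrite (addrC w) addrK ne; lra.
  + by rewrite (addrC w0) addrK ne; lra.
- by move=> t; apply: pcontB; apply: cpf; lra.
- by move=> t; exact: pcontZ.
Qed.
End Holomorphic.

(** * Division and orders of vanishing *)

Section Division.
Variable R : realType.
Local Notation C := (Cplx R).
Implicit Types (f g : C -> C) (z w a : C) (D : set C).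

(** The divided difference with its removable singularity filled in; iterating it peels off powers
    of z - a. *)
Definition quo f a z := if z == a then dv f a else (f z - f a) / (z - a).

Lemma quoE f a z : f z = f a + (z - a) * quo f a z.
Proof.
rewrite /quo; case: eqP => [->|/eqP za]; first by rewrite subrr mul0r addr0.
by rewrite mulrC divfK ?subr_eq0// addrC subrK.
Qed.

Lemma quo_diag f a : quo f a a = dv f a. Proof. by rewrite /quo eqxx. Qed.

Lemma hol_quo_center f a (r : R) : 0 < r -> (forall z, nrm (z - a) < r -> hol_at f z) ->
  hol_at (quo f a) a.
Proof.
move=> r0 hf; have [m dm] := hol_dv r0 hf.
(* The quadratic Taylor coefficient, half of f'' at [a]. *)
exists (m / 2) => e e0; have [d d0 H] := dm e e0.
exists (Num.min r d) => [|z]; first by rewrite lt_min r0.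
rewrite lt_min => /andP[zr zd]; rewrite quo_diag /quo; case: eqP => [->|/eqP za].
  by rewrite !subrr mulr0 subr0 nrm0 mulr0.
have za' : z - a != 0 by rewrite subr_eq0.
have na : 0 < nrm (z - a) by rewrite nrm_gt0.
rewrite -(ler_pM2r na) -nrmM.
pose F u := f u - (dv f a * u + m / 2 * (u - a) ^+ 2).
rewrite (_ : _ * (z - a) = F z - F a); last by rewrite /F subrr expr0n mulr0; field.
apply: (@segment_MVI _ F (fun u => dv f u - (dv f a + m * (u - a)))) => t t01.
  apply: cderB.
    apply: hol_cder; apply: hf; apply: segment_dist => //.
    by rewrite subrr nrm0.
  apply: cderD; first by have := cderZ (dv f a) (cder_id (a + rc t * (z - a))); rewrite mulr1.
  apply: cder_eq (cderZ (m / 2) (cderX 2 (cderB (cder_id _) (cder_cst a _)))) _.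
  by rewrite expr1 subr0 mulr1; field.
have seg := segment_len z a t01.
rewrite opprD addrA; apply: le_trans (H _ _) _; first exact: le_lt_trans seg zd.
by rewrite ler_pM2l.
Qed.

Lemma hol_quo f a (r : R) z : 0 < r -> (forall z, nrm (z - a) < r -> hol_at f z) ->
  hol_at f z -> hol_at (quo f a) z.
Proof.
move=> r0 hf fz; have [->|za] := eqVneq z a; first exact: hol_quo_center r0 hf.
apply: (@hol_near _ (fun z => (f z - f a) / (z - a))).
  exists (nrm (z - a)) => [|w wz]; first by rewrite nrm_sub_gt0.
  by rewrite /quo ifF//; apply/eqP => wa; rewrite wa nrmC ltxx in wz.
apply: hol_div; [apply: holB => //; exact: hol_cst|apply: holB; [exact: hol_id|exact: hol_cst]|].
by rewrite subr_eq0.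
Qed.

(** The maximum principle carries the bound from the circle, where the denominator has modulus r, to
    the inside. This takes the place of Cauchy's estimates; [lip_bound] uses it once and
    [taylor2_bound] twice. *)
Lemma quo_bound f a (r M : R) : 0 < r -> (forall z, nrm (z - a) <= r -> hol_at f z) ->
  (forall z, nrm (z - a) <= r -> nrm (f z) <= M) ->
  forall z, nrm (z - a) <= r -> nrm (quo f a z) <= (M + M) / r.
Proof.
move=> r0 hf fM; apply: max_modulus => // [z zr|z zr].
  by apply: hol_quo r0 _ (hf _ zr) => w /ltW; exact: hf.
have za : z != a by rewrite -nrm_sub_gt0 zr.
rewrite /quo (negbTE za) nrmM nrmV zr ler_pM2r ?invr_gt0//.
by apply: le_trans (nrmB _ _) _; rewrite lerD// fM ?zr// subrr nrm0 ltW.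
Qed.

Lemma lip_bound f a (r M : R) : 0 < r -> (forall z, nrm (z - a) <= r -> hol_at f z) ->
  (forall z, nrm (z - a) <= r -> nrm (f z) <= M) ->
  forall z, nrm (z - a) <= r -> nrm (f z - f a) <= (M + M) / r * nrm (z - a).
Proof.
move=> r0 hf fM z zr; rewrite (quoE f a z) (addrC (f a)) addrK nrmM mulrC.
by rewrite ler_wpM2r ?nrm_ge0//; exact: quo_bound.
Qed.

Lemma taylor2_bound f a (r M : R) : 0 < r -> (forall z, nrm (z - a) <= r -> hol_at f z) ->
  (forall z, nrm (z - a) <= r -> nrm (f z) <= M) ->
  forall z, nrm (z - a) <= r ->
    nrm (f z - f a - dv f a * (z - a)) <= ((M + M) / r + (M + M) / r) / r * nrm (z - a) ^+ 2.
Proof.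
move=> r0 hf fM z zr; rewrite (quoE f a z) (quoE (quo f a) a z) quo_diag.
rewrite (_ : _ - _ = quo (quo f a) a z * (z - a) ^+ 2); last by ring.
rewrite nrmM nrmX ler_wpM2r ?exprn_ge0 ?nrm_ge0//.
apply: quo_bound => // w wr; last exact: quo_bound.
by apply: hol_quo r0 _ (hf _ wr) => u /ltW; exact: hf.
Qed.

Definition hol_on D f := forall z, D z -> hol_at f z.

Lemma ball_in D a : open D -> D a -> exists2 r : R, 0 < r & forall z, nrm (z - a) < r -> D z.
Proof. by move=> /open_nrm oD /oD. Qed.

Lemma cball_in D a : open D -> D a -> exists2 r : R, 0 < r & forall z, nrm (z - a) <= r -> D z.
Proof.
move=> oD /(ball_in oD)[r r0 H]; exists (r / 2) => [|z zr]; first by rewrite divr_gt0.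
by apply: H; lra.
Qed.

Lemma hol_on_quo D f a : open D -> D a -> hol_on D f -> hol_on D (quo f a).
Proof.
move=> oD Da hf z Dz; have [r r0 H] := ball_in oD Da.
by apply: hol_quo r0 _ (hf _ Dz) => w /H; exact: hf.
Qed.

(** A factorization holding at every point, with a cofactor holomorphic on all of [D], so that no
    local patching is needed; [derive1n_factor] relates it to the derivatives used for
    multiplicities. *)
Definition vanishes D f a n := exists2 g, hol_on D g & forall z, f z = (z - a) ^+ n * g z.

Definition finite_order D f a :=
  exists n g, [/\ hol_on D g, forall z, f z = (z - a) ^+ n * g z & g a != 0].

Lemma vanishesS D f a n g : open D -> D a -> hol_on D g -> (forall z, f z = (z - a) ^+ n * g z) ->
  g a = 0 -> vanishes D f a n.+1.
Proof.
move=> oD Da hg fg ga; exists (quo g a); first exact: hol_on_quo.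
by move=> z; rewrite fg (quoE g a z) ga add0r exprSr mulrA.
Qed.

Lemma finite_order_or D f a : open D -> D a -> hol_on D f ->
  finite_order D f a \/ forall n, vanishes D f a n.
Proof.
move=> oD Da hf; have [fo|nfo] := pselect (finite_order D f a); [by left|right].
elim=> [|n [g hg fg]]; first by exists f => // z; rewrite expr0 mul1r.
apply: (vanishesS oD Da hg fg); apply/eqP/negPn/negP => ga.
by apply: nfo; exists n, g; split.
Qed.

(** The n-th cofactor is at most M / r^n by the maximum principle, so within r / 2 of [a] the
    function is at most M / 2^n for every n. *)
Lemma infinite_order_zero D f a : open D -> D a -> hol_on D f -> (forall n, vanishes D f a n) ->
  exists2 r : R, 0 < r & forall z, nrm (z - a) < r -> f z = 0.
Proof.
move=> oD Da hf van; have [r1 r10 Hr1] := cball_in oD Da.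
have [d d0 Hd] := hol_cont (hf a Da) ltr01.
pose r := Num.min r1 (d / 2).
have r0 : 0 < r by rewrite lt_min r10 divr_gt0.
have rr1 : r <= r1 by rewrite ge_min lexx.
have rd : r <= d / 2 by rewrite ge_min lexx orbT.
set M := nrm (f a) + 1.
have fM z : nrm (z - a) <= r -> nrm (f z) <= M.
  move=> zr; rewrite -(subrK (f a) (f z)) (le_trans (nrmD _ _))// addrC lerD2l.
  by apply/ltW/Hd; lra.
exists (r / 2) => [|z zr]; first by rewrite divr_gt0.
apply: nrm0_eq0; apply/eqP; rewrite eq_le nrm_ge0 andbT; apply/ler_addgt0Pr => e e0; rewrite add0r.
have [n Hn] := small_dyadic M e0; apply: le_trans (ltW Hn).
have [g hg fg] := van n.
have M0 : 0 <= M by rewrite /M; have := nrm_ge0 (f a); lra.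
have gM : nrm (g z) <= M / r ^+ n.
  apply: (@max_modulus _ g a r) => //; last by lra.
    by move=> u ur; apply/hg/Hr1; lra.
  move=> u ur; rewrite ler_pdivlMr ?exprn_gt0// mulrC -{1}ur -nrmX -nrmM -fg.
  by apply: fM; rewrite ur.
rewrite fg nrmM nrmX; apply: le_trans (ler_wpM2l _ gM) _; first by rewrite exprn_ge0// nrm_ge0.
rewrite mulrCA ler_wpM2l// -exprVn -exprVn -exprMn lerXn2r ?nnegrE ?mulr_ge0 ?invr_ge0 ?nrm_ge0 ?(ltW r0)//.
by rewrite ler_pdivrMr//; lra.
Qed.

Lemma finite_order_isolated D f a : D a -> open D -> finite_order D f a ->
  exists2 r : R, 0 < r & forall z, 0 < nrm (z - a) < r -> f z != 0.
Proof.
move=> Da oD [n [g [hg fg ga]]].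
have [d d0 H] := hol_cont (hg a Da) (e := nrm (g a)) ltac:(by rewrite nrm_gt0).
exists d => // z /andP[z0 zd]; rewrite fg mulf_neq0 ?expf_neq0 -?nrm_gt0//.
by have := H z zd; have := nrmBl (g a) (g z); rewrite nrmC; lra.
Qed.

(** The points near which [f] vanishes identically form an open set, closed in [D] because a finite
    order at a limit point would isolate it from other zeros. *)
Theorem identity_theorem D f : domain D -> hol_on D f -> (exists2 z, D z & f z != 0) ->
  forall a, D a -> finite_order D f a.
Proof.
move=> [_ oD cD] hf [z0 Dz0 fz0] a Da.
have [//|van] := finite_order_or oD Da hf.
pose A := [set b : C | D b /\ exists2 r : R, 0 < r & forall z, nrm (z - b) < r -> f z = 0].
have oA : open A.
  apply/open_nrm => b [Db [r r0 Hr]]; have [r' r'0 Hr'] := ball_in oD Db.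
  exists (Num.min r r') => [|w]; first by rewrite lt_min r0.
  rewrite lt_min => /andP[wr wr']; split; first exact: Hr'.
  exists (r - nrm (w - b)) => [|u uw]; first by rewrite subr_gt0.
  apply: Hr; rewrite (_ : u - b = (u - w) + (w - b)); last by ring.
  by apply: le_lt_trans (nrmD _ _) _; lra.
suff AD : A = D.
  by have : A z0; [rewrite AD|case=> _ [r r0 /(_ z0)]; rewrite subrr nrm0 => /(_ r0)/eqP; rewrite (negbTE fz0)].
apply: cD.
- by exists a; split => //; exact: infinite_order_zero van.
- by exists A => //; rewrite eqEsubset; split=> b [] // Db Ab.
- exists (closure A); first exact: closed_closure.
  rewrite eqEsubset; split=> [b Ab|b [Db cb]].
    by split; [case: Ab|exact: subset_closure].
  split=> //; have [fo|vb] := finite_order_or oD Db hf; last exact: infinite_order_zero vb.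
  have [r r0 Hr] := finite_order_isolated Db oD fo.
  have /cb[u [[Du [s s0 Hs]] ur]] : nbhs b [set u : C | nrm (u - b) < r].
    by apply/nbhs_nrm; exists r.
  exfalso.
  (* The approximating point [u] may be [b] itself; in that case it is shifted slightly into the
     punctured disc. *)
  have [v [v1 v2]] : exists v : C, nrm (v - u) < s /\ 0 < nrm (v - b) < r.
    have [ub|ub] := eqVneq u b; last first.
      by exists u; rewrite subrr nrm0 nrm_sub_gt0 ub ur.
    exists (b + rc (Num.min s r / 2)); rewrite ub !(addrC b) addrK nrm_rc.
    have m0 : 0 < Num.min s r by rewrite lt_min s0 r0.
    have m1 : Num.min s r <= s by rewrite ge_min lexx.
    have m2 : Num.min s r <= r by rewrite ge_min lexx orbT.
    rewrite gtr0_norm; lra.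
  by have := Hr v v2; rewrite (Hs v v1) eqxx.
Qed.

(** One differentiation turns (z - a)^(n+1) g into (z - a)^n ((n + 1) g + (z - a) g'), a function of
    the same kind with n lowered, which drives the induction. *)
Lemma derive1n_factor D a n f g : open D -> D a -> hol_on D g ->
  (forall z, D z -> f z = (z - a) ^+ n * g z) ->
  (forall j, (j < n)%N -> derive1n j f a = 0) /\ derive1n n f a = n`!%:R * g a.
Proof.
move=> oD Da; elim: n f g => [|n IH] f g hg fg.
  by split => // ; rewrite /= fg// expr0 !mul1r.
have [r r0 Hr] := ball_in oD Da.
have hdg : hol_on D (dv g).
  move=> z Dz; have [s s0 Hs] := ball_in oD Dz.
  by apply: hol_dv s0 _ => w /Hs; exact: hg.
have df z : D z -> derive1 f z = (z - a) ^+ n * (n.+1%:R * g z + (z - a) * dv g z).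
  move=> Dz; apply: cder_derive1; have [s s0 Hs] := ball_in oD Dz.
  apply: (@cder_near _ (fun z => (z - a) ^+ n.+1 * g z)).
    by exists s => // w /Hs Dw; rewrite fg.
  apply: cder_eq (cderM (cderX n.+1 (cderB (cder_id z) (cder_cst a z))) (hol_cder (hg z Dz))) _.
  by rewrite -pred_Sn subr0 mulr1 exprS; ring.
have [|IH1 IH2] := IH (derive1 f) (fun z => n.+1%:R * g z + (z - a) * dv g z) _ df.
  move=> z Dz; apply: holD; first by apply: holM; [exact: hol_cst|exact: hg].
  by apply: holM; [apply: holB; [exact: hol_id|exact: hol_cst]|exact: hdg].
split=> [[|j] jn|]; last 2 first.
- by rewrite /derive1n iterSr; exact: IH1.
- by rewrite /derive1n iterSr -/(derive1n n _) IH2 subrr mul0r addr0 factS natrM; ring.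
by rewrite /derive1n /= fg// subrr expr0n mul0r.
Qed.

Lemma multiplicity_ge_vanishes D f a n : open D -> D a -> hol_on D f ->
  multiplicity_ge f a n -> vanishes D f a n.
Proof.
move=> oD Da hf mf.
suff H k : (k <= n)%N -> vanishes D f a k by exact: H.
elim: k => [_|k IH kn]; first by exists f => // z; rewrite expr0 mul1r.
have [g hg fg] := IH (ltnW kn).
apply: (vanishesS oD Da hg fg).
have [_] := derive1n_factor oD Da hg (fun z _ => fg z).
rewrite mf// => /esym/eqP; rewrite mulf_eq0 => /orP[|/eqP//].
by rewrite pnatr_eq0 -leqn0 leqNgt fact_gt0.
Qed.

Lemma multiplicity_le_order D f a n : open D -> D a -> hol_on D f ->
  multiplicity_le f a n -> exists k g,
  [/\ (k <= n)%N, hol_on D g, forall z, f z = (z - a) ^+ k * g z & g a != 0].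
Proof.
move=> oD Da hf mf; apply: contrapT => nex; apply: mf.
suff H k : (k <= n.+1)%N -> vanishes D f a k.
  have [g hg fg] := H _ (leqnn _).
  by have [] := derive1n_factor oD Da hg (fun z _ => fg z).
elim: k => [_|k IH kn]; first by exists f => // z; rewrite expr0 mul1r.
have [g hg fg] := IH (ltnW kn).
apply: (vanishesS oD Da hg fg); apply/eqP/negPn/negP => ga.
by apply: nex; exists k, g; split.
Qed.
End Division.

(** * Compactness, logarithms and the Schwarz-Pick lemma *)

Section Logarithm.
Variable R : realType.
Local Notation C := (Cplx R).
Implicit Types (f g v s : C -> C) (z w a : C).

Lemma nrm_tri z w a : nrm (z - a) <= nrm (z - w) + nrm (w - a).
Proof. by have := nrmD (z - w) (w - a); rewrite (addrA (z - w)) subrK. Qed.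

Lemma continuous_rc : continuous (@rc R).
Proof.
move=> x A /nbhs_nrm[e e0 H]; apply/nbhs_ballP; exists e => // y.
rewrite /ball /= => xy; apply: H; rewrite -rcB nrm_rc distrC; exact: xy.
Qed.

Lemma compact_cball a (r : R) : compact [set z : C | nrm (z - a) <= r].
Proof.
pose I (x : R) := [set` `[x - r, x + r]%R].
pose sq := (fun p : R * R => mkC p.1 p.2 : C) @` (I (cRe a) `*` I (cIm a)).
have csq : compact sq.
  apply: continuous_compact; last by apply: compact_setX; exact: segment_compact.
  apply: continuous_subspaceT.
  rewrite (_ : (fun p : R * R => mkC p.1 p.2) = (fun p => rc p.1 + cI R * rc p.2)); last first.
    by apply/funext => p; rewrite mkCE.
  move=> p; apply: cvgD.
    by apply: (@cvg_comp _ _ _ fst (@rc R) _ (nbhs p.1)); [exact: cvg_fst|exact: continuous_rc].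
  apply: cvgM; first exact: cvg_cst.
  by apply: (@cvg_comp _ _ _ snd (@rc R) _ (nbhs p.2)); [exact: cvg_snd|exact: continuous_rc].
apply: subclosed_compact csq _.
  rewrite -[X in closed X]setCK; apply: open_closedC; apply/open_nrm => z /= /negP.
  rewrite -ltNge => rz; exists (nrm (z - a) - r) => [|w wz]; first by rewrite subr_gt0.
  apply/negP; rewrite -ltNge.
  have := nrm_tri z w a; rewrite (nrmC z w); lra.
move=> z /= zr; exists (cRe z, cIm z); last by rewrite /= mkC_ReIm.
have := nrm_Re (z - a); have := nrm_Im (z - a); rewrite cReB cImB => h1 h2.
split; rewrite /I /= in_itv /=.
  by have := le_trans h2 zr; rewrite ler_norml => ?; lra.
by have := le_trans h1 zr; rewrite ler_norml => ?; lra.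
Qed.

Definition qcont (q : C -> R) z := forall e : R, 0 < e ->
  exists2 d : R, 0 < d & forall w, nrm (w - z) < d -> `|q w - q z| < e.

Lemma cball_max (q : C -> R) a (r : R) : 0 <= r ->
  (forall z, nrm (z - a) <= r -> qcont q z) ->
  exists2 z0, nrm (z0 - a) <= r & forall z, nrm (z - a) <= r -> q z <= q z0.
Proof.
move=> r0 cq.
have [||z0 z0r H] := @compact_EVT_max C R q _ _ (@compact_cball a r).
- by exists a; rewrite /= subrr nrm0.
- apply: continuous_in_subspaceT => z; rewrite inE /= => zr.
  move=> A /nbhs_ballP[e e0 HA]; have [d d0 Hd] := cq z zr e e0.
  apply/nbhs_nrm; exists d => // w /Hd wz; apply: HA.
  by rewrite /ball /= distrC.
- exists z0; first by move: z0r; rewrite inE.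
  by move=> z zr; apply: H; rewrite inE.
Qed.

Lemma ccont_nrm f z : ccont f z -> qcont (fun z => nrm (f z)) z.
Proof.
move=> cf e e0; have [d d0 H] := cf e e0; exists d => // w /H; apply: le_lt_trans.
exact: nrm_dist.
Qed.

Lemma cball_bounded f a (r : R) : 0 <= r -> (forall z, nrm (z - a) <= r -> ccont f z) ->
  exists M, forall z, nrm (z - a) <= r -> nrm (f z) <= M.
Proof.
move=> r0 cf; have [|z0 _ H] := @cball_max (fun z => nrm (f z)) a r r0.
  by move=> z /cf/ccont_nrm.
by exists (nrm (f z0)).
Qed.

(** Makes integrands along a segment total, as the lemmas on [cint] ask for continuity at every real
    parameter. *)
Definition clamp (t : R) : R := Num.max 0 (Num.min t 1).

Lemma clamp_itv t : 0 <= clamp t <= 1.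
Proof. by rewrite /clamp le_max lexx /= ge_max ler01 ge_min lexx orbT. Qed.

Lemma clamp_id t : 0 <= t <= 1 -> clamp t = t.
Proof. by move=> /andP[t0 t1]; rewrite /clamp min_l// max_r. Qed.

Lemma clamp_lip t t' : `|clamp t - clamp t'| <= `|t - t'|.
Proof.
have h1 := ler_norm (t - t'); have h2 := ler_norm (t' - t); rewrite distrC in h2.
rewrite /clamp ler_norml; case: (leP t 1) => h3; case: (leP t' 1) => h4;
  rewrite ?(max_r ler01); try (case: (leP 0 t) => h5); try (case: (leP 0 t') => h6);
  apply/andP; split; lra.
Qed.

Lemma pcont_clamp_seg g a b (r : R) t : (forall z, nrm (z - a) < r -> ccont g z) -> nrm b < r ->
  pcont (fun t => g (a + rc (clamp t) * b)) t.
Proof.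
move=> cg br; apply: (ccont_pcont (p := fun t => a + rc (clamp t) * b)).
  apply: cg; rewrite (addrC a) addrK nrmM nrm_rc.
  have /andP[c0 c1] := clamp_itv t; rewrite ger0_norm//.
  by apply: le_lt_trans br; rewrite ler_piMl ?nrm_ge0.
apply: pcontD; first exact: pcont_cst.
under eq_fun do rewrite mulrC; apply: pcontZ => e e0; exists e => // s st.
by rewrite -rcB nrm_rc; apply: le_lt_trans st; exact: clamp_lip.
Qed.

(** The primitive is z - a times the mean of [g] over the segment from [a] to z. Differentiating
    under the integral leaves the integral of the t-derivative of t g(a + t (z - a)), which is g
    z. *)
Lemma primitive_ball g a (r : R) : 0 < r -> (forall z, nrm (z - a) < r -> hol_at g z) ->
  exists W, forall z, nrm (z - a) < r -> cder W z (g z).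
Proof.
move=> r0 hg.
have cg z : nrm (z - a) < r -> ccont g z by move=> /hg/hol_cont.
have hdg z : nrm (z - a) < r -> hol_at (dv g) z.
  move=> zr; apply: (@hol_dv _ _ _ (r - nrm (z - a))); first by rewrite subr_gt0.
  move=> w wz; apply: hg; have := nrm_tri w z a; lra.
pose J z := cint (fun t => g (a + rc (clamp t) * (z - a))) 0 1.
exists (fun z => (z - a) * J z) => z zr.
pose J' := cint (fun t => rc (clamp t) * dv g (a + rc (clamp t) * (z - a))) 0 1.
have cJ w t : nrm (w - a) < r -> pcont (fun t => g (a + rc (clamp t) * (w - a))) t.
  by move=> wr; apply: pcont_clamp_seg cg wr.
have ccl t : pcont (fun t => rc (clamp t)) t.
  by move=> e e0; exists e => // u ut; rewrite -rcB nrm_rc; apply: le_lt_trans ut; exact: clamp_lip.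
have cJ' t : pcont (fun t => rc (clamp t) * dv g (a + rc (clamp t) * (z - a))) t.
  by apply: pcontM => //; apply: pcont_clamp_seg zr => w /hdg/hol_cont.
have JJ' : cder J z J'.
  pose d := (r - nrm (z - a)) / 3.
  have d0 : 0 < d by rewrite divr_gt0// subr_gt0.
  have dr : nrm (z - a) + d * 3 = r by rewrite /d divfK//; ring.
  have [M HM] := @cball_bounded g a (nrm (z - a) + d * 2) ltac:(have := nrm_ge0 (z - a); lra)
     (fun w wr => cg w ltac:(lra)).
  pose K := ((M + M) / d + (M + M) / d) / d.
  have key u u' : nrm (u - a) <= nrm (z - a) -> nrm (u' - u) <= d ->
     nrm (g u' - g u - dv g u * (u' - u)) <= K * nrm (u' - u) ^+ 2.
    move=> ua uu; apply: taylor2_bound => // w wu.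
      by apply: hg; have := nrm_tri w u a; lra.
    by apply: HM; have := nrm_tri w u a; lra.
  have K0 : 0 <= K.
    have M0 : 0 <= M by apply: le_trans (HM a _); rewrite ?nrm_ge0// subrr nrm0 addr_ge0 ?nrm_ge0//; lra.
    have d0' := ltW d0; have H1 : 0 <= (M + M) / d by rewrite divr_ge0 ?addr_ge0.
    by rewrite divr_ge0 ?addr_ge0.
  move=> e e0; exists (Num.min d (e / (K + 1))).
    by rewrite lt_min d0 divr_gt0// ltr_wpDl.
  move=> w; rewrite lt_min => /andP[wd]; rewrite ltr_pdivlMr ?ltr_wpDl// => we.
  have wr : nrm (w - a) < r.
    by have := nrm_tri w z a; lra.
  apply: (@le_trans _ _ (K * nrm (w - z) ^+ 2)); last first.
    rewrite expr2 mulrA ler_wpM2r ?nrm_ge0// (le_trans _ (ltW we))// mulrC.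
    by rewrite ler_wpM2l ?nrm_ge0// lerDl.
  rewrite /J /J' (mulrC _ (w - z)) -cintZ// -!cintB//; try (by move=> t; exact: cJ);
    try (by move=> t; exact: pcontZ); try (by move=> t; apply: pcontB; exact: cJ).
  rewrite -[X in _ <= X]mulr1 -{2}(subr0 1); apply: cint_bound => // t.
    by apply: pcontB; [apply: pcontB; exact: cJ|exact: pcontZ].
  move=> _; have /andP[c0 c1] := clamp_itv t; set c := rc (clamp t).
  have nc : nrm c <= 1 by rewrite nrm_rc ger0_norm.
  have E : a + c * (w - a) - (a + c * (z - a)) = c * (w - z) by ring.
  have nE : nrm (c * (w - z)) <= nrm (w - z) by rewrite nrmM ler_piMl ?nrm_ge0.
  set u := a + c * (z - a) in E *; set u' := a + c * (w - a) in E *.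
  have -> : (w - z) * (c * dv g u) = dv g u * (u' - u) by rewrite E; ring.
  apply: le_trans (key u u' _ _) _; rewrite ?E.
  - by rewrite /u (addrC a) addrK nrmM ler_piMl ?nrm_ge0.
  - by apply: le_trans nE (ltW wd).
  - by rewrite ler_wpM2l// lerXn2r ?nnegrE ?nrm_ge0.
apply: cder_eq (cderM (cderB (cder_id z) (cder_cst a z)) JJ') _.
rewrite subr0 mul1r /J /J' -cintZ// -cintD//; try (by move=> t; exact: cJ); try (by move=> t; exact: pcontZ).
rewrite (@cintE _ _ (fun t => rc t * g (a + rc t * (z - a))))// => [|t t01].
  by rewrite rc1 rc0 !mul1r mul0r subr0 (addrC a) subrK.
rewrite clamp_id//.
have Ht : nrm (a + rc t * (z - a) - a) < r.
  by apply: le_lt_trans zr; exact: segment_len.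
have Hp : pder (fun t => a + rc t * (z - a)) t (z - a).
  have -> : (fun t => a + rc t * (z - a)) = (fun t => a + (z - a) * rc t).
    by apply/funext => u; rewrite mulrC.
  by have := pderD (pder_cst a t) (pderZ (z - a) (pder_rc t)); rewrite add0r mulr1.
apply: pder_eq (pderM (pder_rc t) (cder_pder (hol_cder (hg _ Ht)) Hp)) _.
by ring.
Qed.

Lemma zero_derivative_ball f a (r : R) : (forall z, nrm (z - a) < r -> cder f z 0) ->
  forall z, nrm (z - a) < r -> f z = f a.
Proof.
move=> fd z zr; apply/eqP; rewrite -subr_eq0 -nrm_eq0 eq_le nrm_ge0 andbT -(mul0r (nrm (z - a))).
apply: (@segment_MVI _ f (fun=> 0)) => t t01; last by rewrite nrm0.
by apply: fd; apply: le_lt_trans zr; exact: segment_len.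
Qed.

Lemma polar (c : C) : c != 0 -> exists2 t : R, `|t| <= pi & rc (nrm c) * cis t = c.
Proof.
move=> c0; have n0 : 0 < nrm c by rewrite nrm_gt0.
set x := cRe c / nrm c; set y := cIm c / nrm c.
have xy : x ^+ 2 + y ^+ 2 = 1.
  by rewrite /x /y !expr_div_n -mulrDl -nrm_sqr divff// expf_neq0// gt_eqF.
have x1 : -1 <= x <= 1.
  by rewrite -ler_norml -(ler_pXn2r (n := 2)) ?nnegrE// expr1n real_normK ?num_real// -xy lerDl sqr_ge0.
have sy : Num.sqrt (1 - x ^+ 2) = `|y| by rewrite -xy (addrC (x ^+ 2)) addrK sqrtr_sqr.
have cx : cos (acos x) = x by rewrite acosK// in_itv.
have sx : sin (acos x) = `|y| by rewrite sin_acos// sy.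
have fin t : cos t = x -> sin t = y -> rc (nrm c) * cis t = c.
  move=> ct st; apply: c_ext; rewrite ?cReM ?cImM cRe_rc cIm_rc /cis cRe_mk cIm_mk ct st mul0r.
    by rewrite subr0 mulrC divfK// gt_eqF.
  by rewrite addr0 mulrC divfK// gt_eqF.
case: (leP 0 y) => y0.
  exists (acos x); first by rewrite ger0_norm ?acos_ge0// acos_lepi.
  by apply: fin => //; rewrite sx ger0_norm.
exists (- acos x); first by rewrite normrN ger0_norm ?acos_ge0// acos_lepi.
by apply: fin; rewrite ?cosN ?sinN// sx ltr0_norm// opprK.
Qed.

Lemma cexp_surj (c : C) : c != 0 -> exists z, cexp z = c.
Proof.
move=> c0; have [t _ Ht] := polar c0; exists (mkC (ln (nrm c)) t).
by rewrite /cexp cRe_mk cIm_mk lnK ?posrE ?nrm_gt0.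
Qed.

(** If W is a primitive of v' / v, then v exp(-W) has derivative 0; its constant value is absorbed
    into W as an additive constant. *)
Lemma log_ball v a (r : R) : 0 < r -> (forall z, nrm (z - a) < r -> hol_at v z) ->
  (forall z, nrm (z - a) < r -> v z != 0) ->
  exists2 L, (forall z, nrm (z - a) < r -> cder L z (dv v z / v z)) &
    forall z, nrm (z - a) < r -> v z = cexp (L z).
Proof.
move=> r0 hv v0.
have [|W HW] := @primitive_ball (fun z => dv v z / v z) a r r0.
  move=> z zr; apply: hol_div; [|exact: hv|exact: v0].
  apply: (@hol_dv _ _ _ (r - nrm (z - a))); first by rewrite subr_gt0.
  move=> w wz; apply: hv; have := nrm_tri w z a; lra.
have a0 : nrm (a - a) < r by rewrite subrr nrm0.
pose u z := v z * cexp (- W z).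
have ua z : nrm (z - a) < r -> u z = u a.
  apply: zero_derivative_ball => w wr.
  apply: cder_eq (cderM (hol_cder (hv w wr))
    (cder_comp (cderN (HW w wr)) (cder_cexp (- W w)))) _.
  by field; exact: v0.
have [c Hc] : exists c, cexp c = u a.
  by apply: cexp_surj; rewrite mulf_neq0 ?v0// cexp_neq0.
exists (fun z => W z + c) => z zr.
  by have := cderD (HW z zr) (cder_cst c z); rewrite addr0.
by rewrite cexpD Hc -(ua z zr) /u mulrCA -cexpD addrN cexp0 mulr1.
Qed.

(** Ahlfors' comparison at a local maximum, without second derivatives. If the distortion exceeded 1
    at [z0], the quotient [H] of pseudo-hyperbolic displacements from s z0 and [z0] would have
    modulus at least some q > 1 nearby. Together with maximality this forces |E| strictly below |E
    z0| on a small circle, against the mean value property; up to a constant, [E] is the derivative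
    of [s] in disc coordinates centred at [z0] and s z0. *)
Lemma schwarz_pick_local s z0 (d : R) : 0 < d -> nrm z0 < 1 ->
  (forall z, nrm (z - z0) < d -> hol_at s z) ->
  (forall z, nrm (z - z0) < d -> nrm (s z) < 1) ->
  (forall z, nrm (z - z0) < d -> nrm z < 1 ->
     nrm (dv s z) * (1 - nrm z ^+ 2) / (1 - nrm (s z) ^+ 2)
     <= nrm (dv s z0) * (1 - nrm z0 ^+ 2) / (1 - nrm (s z0) ^+ 2)) ->
  nrm (dv s z0) * (1 - nrm z0 ^+ 2) / (1 - nrm (s z0) ^+ 2) <= 1.
Proof.
move=> d0 z01 hs s1 smax; rewrite leNgt; apply/negP => Q1.
set s0 := s z0 in smax Q1 *.
have s01 : nrm s0 < 1 by apply: s1; rewrite subrr nrm0.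
have sqlt1 (z : C) : nrm z < 1 -> 0 < 1 - nrm z ^+ 2.
  by move=> z1; rewrite subr_gt0 expr_lt1 ?nrm_ge0.
have al0 := sqlt1 _ z01; have be0 := sqlt1 _ s01.
set al := 1 - nrm z0 ^+ 2 in smax Q1 al0 *; set be := 1 - nrm s0 ^+ 2 in smax Q1 be0 *.
pose az z := 1 - cj z0 * z; pose bz z := 1 - cj s0 * s z.
have mA z : nrm (az z) ^+ 2 - nrm (z - z0) ^+ 2 = al * (1 - nrm z ^+ 2).
  have := moebius_identity (- z0) z; rewrite nrmN -/al => <-.
  by rewrite /az (_ : cj (- z0) = - cj z0) ?mulNr//; exact: rmorphN.
have mB z : nrm (bz z) ^+ 2 - nrm (s z - s0) ^+ 2 = be * (1 - nrm (s z) ^+ 2).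
  have := moebius_identity (- s0) (s z); rewrite nrmN -/be => <-.
  by rewrite /bz (_ : cj (- s0) = - cj s0) ?mulNr//; exact: rmorphN.
have one_sub (u v : C) : nrm u < 1 -> nrm v < 1 -> 1 - cj u * v != 0.
  move=> u1 v1; rewrite -nrm_gt0; have := nrmBl 1 (cj u * v).
  rewrite nrm1 nrmM nrm_cj; apply: lt_le_trans; rewrite subr_gt0.
  by apply: le_lt_trans v1; rewrite ler_piMl ?nrm_ge0// ltW.
pose r := Num.min d (1 - nrm z0).
have r0 : 0 < r by rewrite lt_min d0 subr_gt0.
have rz z : nrm (z - z0) < r -> nrm (z - z0) < d /\ nrm z < 1.
  rewrite lt_min => /andP[-> h]; split => //.
  by have := nrmD (z - z0) z0; rewrite subrK; lra.
have a_neq0 z : nrm (z - z0) < r -> az z != 0 by move=> /rz[_ z1]; exact: one_sub.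
have b_neq0 z : nrm (z - z0) < r -> bz z != 0 by move=> /rz[/s1 z1 _]; exact: one_sub.
have hola z : hol_at az z.
  by apply: holB; [exact: hol_cst|apply: holM; [exact: hol_cst|exact: hol_id]].
have holb z : nrm (z - z0) < r -> hol_at bz z.
  by move=> /rz[zd _]; apply: holB; [exact: hol_cst|apply: holM; [exact: hol_cst|exact: hs]].
have z0r : nrm (z0 - z0) < r by rewrite subrr nrm0.
have nal : nrm (az z0) = al.
  rewrite /az (mulrC (cj z0)) mul_cj -rc1 -rcB nrm_rc gtr0_norm//.
have nbe : nrm (bz z0) = be.
  rewrite /bz (mulrC (cj s0)) mul_cj -rc1 -rcB nrm_rc gtr0_norm//.
pose H z := quo s z0 z * (az z / bz z).
set Q0 := nrm (dv s z0) * al / be in Q1 smax.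
have nH : nrm (H z0) = Q0 by rewrite /H quo_diag !nrmM nrmV nal nbe mulrA.
have cH : ccont H z0.
  apply: hol_cont; apply: holM; first exact: hol_quo_center d0 hs.
  by apply: hol_div => //; [exact: holb|exact: b_neq0].
pose q := (1 + Q0) / 2.
have q1 : 1 < q by rewrite /q; lra.
have [d1 d10 Hd1] := cH (q - 1) ltac:(lra).
pose E z := dv s z * (az z ^+ 2 / bz z ^+ 2).
pose rho := Num.min r d1 / 2.
have rho0 : 0 < rho by rewrite divr_gt0// lt_min r0.
have rr : rho < r by have : Num.min r d1 <= r by [rewrite ge_min lexx]; rewrite /rho; lra.
have rd1 : rho < d1 by have : Num.min r d1 <= d1 by [rewrite ge_min lexx orbT]; rewrite /rho; lra.
have holE z : nrm (z - z0) <= rho -> hol_at E z.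
  move=> zrho; have zr : nrm (z - z0) < r by lra.
  apply: holM.
    apply: (@hol_dv _ _ _ (r - rho)); first by rewrite subr_gt0.
    by move=> w wz; apply: hs; have [] := rz w ltac:(have := nrm_tri w z z0; lra).
  by apply: hol_div; rewrite ?expf_neq0 ?b_neq0//; apply: holX => //; exact: holb.
pose T := nrm (E z0).
have TE : T = nrm (dv s z0) * al ^+ 2 / be ^+ 2.
  by rewrite /T /E !nrmM nrmV !nrmX nal nbe mulrA.
have T0 : 0 < T.
  rewrite TE; have : 0 < nrm (dv s z0).
    rewrite lt_def nrm_ge0 andbT; apply/eqP => S0.
    by move: Q1; rewrite /Q0 S0 !mul0r ltr10.
  by move=> ?; rewrite divr_gt0 ?mulr_gt0 ?exprn_gt0.
(* On the circle |E| / T is at most (1 - q^2 x) / (1 - x) with x = m / A, hence at most 1 - (q^2 -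
   1) x; the 4 comes from [A4]. *)
have : T <= T * (1 - (q ^+ 2 - 1) * rho ^+ 2 / 4).
  apply: (max_center (f := E) rho0 holE) => z zrho.
  have zr : nrm (z - z0) < r by lra.
  have [zd z1] := rz z zr; have sz1 := s1 z zd.
  have bz0 := sqlt1 _ z1; have bs0 := sqlt1 _ sz1.
  set A := nrm (az z) ^+ 2; set B := nrm (bz z) ^+ 2; set m := nrm (z - z0) ^+ 2.
  set n := nrm (s z - s0) ^+ 2; set S := nrm (dv s z).
  have A0 : 0 < A by rewrite exprn_gt0// nrm_gt0 a_neq0.
  have B0 : 0 < B by rewrite exprn_gt0// nrm_gt0 b_neq0.
  have A4 : A <= 4.
    have h : nrm (az z) <= 2.
      have := nrmB 1 (cj z0 * z); rewrite -/(az z) nrm1 nrmM nrm_cj.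
      have : nrm z0 * nrm z <= 1 by rewrite mulr_ile1 ?nrm_ge0// ltW.
      lra.
    have -> : 4 = 2 ^+ 2 :> R by ring.
    by rewrite lerXn2r ?nnegrE ?nrm_ge0.
  have hA : A - m = al * (1 - nrm z ^+ 2) := mA z.
  have hB : B - n = be * (1 - nrm (s z) ^+ 2) := mB z.
  have Am : 0 < A - m by rewrite hA mulr_gt0.
  have Bn : 0 < B - n by rewrite hB mulr_gt0.
  have ineq1 : S * (A - m) <= T * (B - n).
    have := smax z zd z1; rewrite -/S ler_pdivrMr// => h.
    rewrite hA mulrCA.
    apply: le_trans (ler_wpM2l (ltW al0) h) _.
    rewrite hB TE /Q0 le_eqVlt; apply/orP; left; apply/eqP; field.
    by rewrite gt_eqF.
  have ineq2 : q ^+ 2 * (m * B) <= n * A.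
    have nHz : q <= nrm (H z).
      have := Hd1 z ltac:(by rewrite zrho); have := nrmBl (H z0) (H z); rewrite nH nrmC /q; lra.
    have -> : n * A = nrm (H z) ^+ 2 * (m * B).
      rewrite /n (quoE s z0 z) -/s0 (addrC s0) addrK /H !nrmM nrmV /A /B /m !exprMn exprVn.
      by field; rewrite nrm_eq0 b_neq0.
    rewrite ler_wpM2r ?mulr_ge0 ?exprn_ge0 ?nrm_ge0//.
    by rewrite lerXn2r ?nnegrE ?nrm_ge0//; lra.
  have m0 : 0 <= m by rewrite exprn_ge0 ?nrm_ge0.
  have k0 : 0 <= q ^+ 2 - 1 by rewrite subr_ge0 exprn_ege1// ltW.
  rewrite /E !nrmM nrmV !nrmX -/A -/B -/S mulrA ler_pdivrMr// -zrho -/m.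
  rewrite -(ler_pM2r Am); set k := q ^+ 2 - 1 in k0 *.
  have qk : q ^+ 2 = k + 1 by rewrite /k subrK.
  have step1 : S * A * (A - m) <= T * (B * (A - q ^+ 2 * m)).
    have h1 := ler_wpM2r (ltW A0) ineq1; have h2 := ler_wpM2l (ltW T0) ineq2; lra.
  apply: le_trans step1 _.
  rewrite (_ : T * _ * B * (A - m) = T * (B * ((1 - k * m / 4) * (A - m)))); last by ring.
  rewrite ler_pM2l// ler_pM2l//.
  have h3 : 0 <= k * m * (4 - A + m) by rewrite mulr_ge0 ?mulr_ge0//; lra.
  rewrite qk; lra.
rewrite leNgt => /negP; apply; rewrite gtr_pMr// ltrBlDr ltrDl divr_gt0//.
by rewrite mulr_gt0 ?exprn_gt0// subr_gt0 exprn_egt1.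
Qed.
End Logarithm.

(** * The metric and the Landau bound *)

Section Metric.
Variable R : realType.
Local Notation C := (Cplx R).
Implicit Types (f g v s w : C -> C) (z a u : C) (q : C -> R).

Lemma qcontP q z : qcont q z <-> {for z, continuous q}.
Proof.
split=> [cq A /nbhs_ballP[e e0 HA]|cq e e0].
  have [d d0 Hd] := cq e e0; apply/nbhs_nrm; exists d => // w /Hd wz; apply: HA.
  by rewrite /ball /= distrC.
have /nbhs_nrm[d d0 Hd] : nbhs z (q @^-1` (ball (q z) e)).
  by apply: cq; apply/nbhs_ballP; exists e.
by exists d => // w /Hd; rewrite /ball /= distrC.
Qed.

Lemma qcontM q q' z : qcont q z -> qcont q' z -> qcont (fun z => q z * q' z) z.
Proof. by move=> /qcontP c1 /qcontP c2; apply/qcontP; exact: continuousM. Qed.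

Lemma qcontB q q' z : qcont q z -> qcont q' z -> qcont (fun z => q z - q' z) z.
Proof.
move=> c1 c2 e e0; have e2 : 0 < e / 2 by rewrite divr_gt0.
have [d1 d10 H1] := c1 _ e2; have [d2 d20 H2] := c2 _ e2.
exists (Num.min d1 d2) => [|w]; first by rewrite lt_min d10.
rewrite lt_min => /andP[/H1 + /H2]; rewrite !ltr_norml => /andP[? ?] /andP[? ?].
by apply/andP; split; lra.
Qed.

Lemma qcontV q z : q z != 0 -> qcont q z -> qcont (fun z => (q z)^-1) z.
Proof. by move=> q0 /qcontP c1; have /qcontP := continuousV q0 c1. Qed.

Lemma qcont_comp (phi : R -> R) q z : {for q z, continuous phi} -> qcont q z ->
  qcont (fun z => phi (q z)) z.
Proof.
by move=> cphi /qcontP cq; apply/qcontP; apply: (@cvg_comp _ _ _ q phi _ (nbhs (q z))).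
Qed.

Lemma qcont_sqrt q z : qcont q z -> qcont (fun z => Num.sqrt (q z)) z.
Proof. by move=> cq; apply: (qcont_comp (phi := Num.sqrt)) => //; exact: sqrt_continuous. Qed.

Lemma qcontX q z n : qcont q z -> qcont (fun z => q z ^+ n) z.
Proof. by move=> cq; apply: (qcont_comp (phi := fun x => x ^+ n)) => //; exact: exprn_continuous. Qed.

Lemma qcont_cst (c : R) z : qcont (fun=> c) z.
Proof. by move=> e e0; exists 1 => // w _; rewrite subrr normr0. Qed.

Lemma qcont_max q q' z : qcont q z -> qcont q' z -> qcont (fun z => Num.max (q z) (q' z)) z.
Proof.
move=> c1 c2 e e0; have [d1 d10 H1] := c1 e e0; have [d2 d20 H2] := c2 e e0.
exists (Num.min d1 d2) => [|w]; first by rewrite lt_min d10.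
rewrite lt_min => /andP[/H1 + /H2]; rewrite !ltr_norml => /andP[? ?] /andP[? ?].
by apply/andP; split; case: (leP (q z) (q' z)) => h; case: (leP (q w) (q' w)) => h'; lra.
Qed.

Lemma qcont_min q q' z : qcont q z -> qcont q' z -> qcont (fun z => Num.min (q z) (q' z)) z.
Proof.
move=> c1 c2 e e0; have [d1 d10 H1] := c1 e e0; have [d2 d20 H2] := c2 e e0.
exists (Num.min d1 d2) => [|w]; first by rewrite lt_min d10.
rewrite lt_min => /andP[/H1 + /H2]; rewrite !ltr_norml => /andP[? ?] /andP[? ?].
by apply/andP; split; case: (leP (q z) (q' z)) => h; case: (leP (q w) (q' w)) => h'; lra.
Qed.

Lemma qcont_lip (phi : C -> R) f z : (forall u u', `|phi u - phi u'| <= nrm (u - u')) ->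
  ccont f z -> qcont (fun z => phi (f z)) z.
Proof.
by move=> lip cf e e0; have [d d0 H] := cf e e0; exists d => // w /H; apply: le_lt_trans.
Qed.

Definition zc (k : int) : C := rc k%:~R.
Definition nearest u : int := Num.floor (cRe u + 2^-1).
Definition distZ u : R := nrm (u - zc (nearest u)).

Lemma nearest_Re u : `|cRe u - (nearest u)%:~R| <= 2^-1.
Proof.
have h1 := floor_le (cRe u + 2^-1); have h2 := floorD1_gt (cRe u + 2^-1).
rewrite /nearest; rewrite intrD in h2; rewrite ler_norml.
apply/andP; split; lra.
Qed.

Lemma distZ_min u (k : int) : distZ u <= nrm (u - zc k).
Proof.
rewrite /distZ -(ler_pXn2r (n := 2)) ?nnegrE ?nrm_ge0// !nrm_sqr !cReB !cImB /zc !cRe_rc !cIm_rc lerD2r.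
have h := nearest_Re u.
have [->|nk] := eqVneq k (nearest u); first by [].
rewrite -[X in X <= _]real_normK ?num_real// -[X in _ <= X]real_normK ?num_real//.
rewrite lerXn2r ?nnegrE//; apply: le_trans h _.
have k1 : 1 <= `|k%:~R - (nearest u)%:~R| :> R.
  rewrite -intrB -intr_norm -[1]/(1%:~R) ler_int.
  by rewrite -gtz0_ge1 normr_gt0 subr_eq0.
have h := nearest_Re u; have := ler_normD (cRe u - (nearest u)%:~R) (k%:~R - cRe u).
rewrite addrC addrA subrK (distrC k%:~R (cRe u)); lra.
Qed.

Lemma distZ_lip u u' : `|distZ u - distZ u'| <= nrm (u - u').
Proof.
have h (v v' : C) : distZ v - distZ v' <= nrm (v - v').
  have := distZ_min v (nearest v'); rewrite -/(distZ v').
  by have := nrm_tri v v' (zc (nearest v')); rewrite -/(distZ v'); lra.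
by rewrite ler_norml; have := h u u'; have := h u' u; rewrite (nrmC u' u); lra.
Qed.

Lemma distZ_ge0 u : 0 <= distZ u. Proof. exact: nrm_ge0. Qed.

Lemma zc_sep (j k : int) : j != k -> 1 <= nrm (zc j - zc k).
Proof.
move=> jk; rewrite /zc -rcB nrm_rc -intrB -intr_norm -[1]/(1%:~R) ler_int.
by rewrite -gtz0_ge1 normr_gt0 subr_eq0.
Qed.

Lemma distZ_small u (k : int) : nrm (u - zc k) < 2^-1 -> distZ u = nrm (u - zc k).
Proof.
move=> uk; have [kn|kn] := eqVneq k (nearest u); first by rewrite /distZ -kn.
have := zc_sep kn; have := nrm_tri (zc k) u (zc (nearest u)).
rewrite (nrmC (zc k) u) -/(distZ u); have := distZ_min u k; lra.
Qed.

Lemma distZ_bound u : distZ u ^+ 2 <= 4^-1 + cIm u ^+ 2.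
Proof.
rewrite /distZ nrm_sqr cReB cImB /zc cRe_rc cIm_rc subr0 lerD2r.
have h := nearest_Re u.
rewrite -real_normK ?num_real// (_ : 4^-1 = 2^-1 ^+ 2); last by field.
by rewrite lerXn2r ?nnegrE.
Qed.

Lemma distZ_ge_Im u : `|cIm u| <= distZ u.
Proof.
by have := nrm_Im (u - zc (nearest u)); rewrite cImB /zc cIm_rc subr0.
Qed.

Definition root4 (x : R) : R := Num.sqrt (Num.sqrt x).
Lemma root4_ge0 x : 0 <= root4 x. Proof. exact: sqrtr_ge0. Qed.
Lemma root4K x : 0 <= x -> root4 x ^+ 4 = x.
Proof.
by move=> x0; rewrite (exprM _ 2 2) sqr_sqrtr ?sqrtr_ge0// sqr_sqrtr.
Qed.

(** The cap 3/2 keeps [tau] in the range where [eta_mono] applies; it is inactive for distances up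
    to 4 ([tau_small]). *)
Definition tau u : R := Num.min (root4 (distZ u)) (3 / 2).
(** 15 / eta t is the pull-back of |ds| / (1 - |s|^2) under s = u^(3/4) / 20 with |u| = t^4: the
    derivative has modulus 3 / (80 t), and 1 - |s|^2 = 1 - t^6 / 400. *)
Definition eta (t : R) : R := t * (400 - t ^+ 6).
(** A continuous cut-off descending from 1 to 0 on [7/2, 4], where the half-plane density is the
    larger one, so that the maximum of the two metrics does not notice it. *)
Definition chi (y : R) : R := Num.max 0 (Num.min 1 (2 * (4 - y))).

Lemma tau_ge0 u : 0 <= tau u.
Proof. by rewrite le_min root4_ge0 /=; lra. Qed.

Lemma tau_le u : tau u <= 3 / 2. Proof. by rewrite ge_min lexx orbT. Qed.

Lemma pow6_le (t : R) : 0 <= t <= 3 / 2 -> t ^+ 6 <= 12.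
Proof.
move=> /andP[t0 t1]; have : t ^+ 6 <= (3 / 2) ^+ 6 by rewrite lerXn2r ?nnegrE//; lra.
move=> h; apply: le_trans h _; rewrite -subr_ge0 (_ : _ - _ = 39 / 64); last by field.
lra.
Qed.

Lemma eta_mono (t t' : R) : 0 <= t -> t <= t' -> t' <= 3 / 2 -> eta t <= eta t'.
Proof.
move=> t0 tt t1; have t'0 : 0 <= t' by lra.
have p (t5 : R) : 0 <= t5 -> t5 <= 3 / 2 -> 0 <= t5 ^+ 6 <= 12.
  by move=> h1 h2; apply/andP; split; [exact: exprn_ge0|apply: pow6_le; rewrite h1].
have /andP[a0 a1] := p t t0 ltac:(lra); have /andP[b0 b1] := p t' t'0 t1.
rewrite /eta -subr_ge0.
rewrite (_ : _ - _ = (t' - t) * (400 - (t' ^+ 6 + t' ^+ 5 * t + t' ^+ 4 * t ^+ 2 + t' ^+ 3 * t ^+ 3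
   + t' ^+ 2 * t ^+ 4 + t' * t ^+ 5 + t ^+ 6))); last by ring.
have h i j : (i + j = 6)%N -> t' ^+ i * t ^+ j <= 12.
  move=> ij; apply: le_trans b1; rewrite -ij exprD ler_wpM2l ?exprn_ge0//.
  by rewrite lerXn2r ?nnegrE.
have h1 := h 5 1 erefl; have h2 := h 4 2 erefl; have h3 := h 3 3 erefl.
have h4 := h 2 4 erefl; have h5 := h 1 5 erefl; rewrite !expr1 in h1 h5.
rewrite mulr_ge0 ?subr_ge0//; lra.
Qed.
End Metric.

(** * Numerical comparison of the two densities *)

Section RealBounds.
Variable R : realType.
Local Notation C := (Cplx R).
Implicit Types (u : C).

Lemma le_root4 (x t : R) : 0 <= x -> 0 <= t -> t ^+ 4 <= x -> t <= root4 x.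
Proof.
by move=> x0 t0 h; rewrite -(ler_pXn2r (n := 4)) ?nnegrE ?root4_ge0// root4K.
Qed.

Lemma root4_le (x t : R) : 0 <= x -> 0 <= t -> x <= t ^+ 4 -> root4 x <= t.
Proof.
by move=> x0 t0 h; rewrite -(ler_pXn2r (n := 4)) ?nnegrE ?root4_ge0// root4K.
Qed.

Lemma eta_ge (t : R) : 0 <= t <= 3 / 2 -> 388 * t <= eta t.
Proof.
move=> /[dup] /pow6_le h /andP[t0 _]; rewrite /eta mulrC ler_wpM2l//; lra.
Qed.

Lemma eta_le (t : R) : 0 <= t -> eta t <= 400 * t.
Proof.
by move=> t0; rewrite /eta mulrC ler_wpM2r// gerBl exprn_ge0.
Qed.

Lemma tau_small u : distZ u <= 4 -> tau u = root4 (distZ u) /\ tau u ^+ 4 = distZ u.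
Proof.
move=> h; have E : tau u = root4 (distZ u).
  rewrite /tau min_l//; apply: root4_le; [exact: distZ_ge0|lra|].
  by apply: le_trans h _; rewrite -subr_ge0 (_ : _ - _ = 17 / 16); [lra|field].
by rewrite E root4K ?distZ_ge0.
Qed.

Lemma tau_gt0 u : 0 < distZ u -> 0 < tau u.
Proof.
move=> h; rewrite lt_min; apply/andP; split; last by lra.
by rewrite /root4 sqrtr_gt0 sqrtr_gt0.
Qed.

Lemma chi_itv (y : R) : 0 <= chi y <= 1.
Proof. by rewrite /chi le_max lexx /= ge_max ler01 ge_min lexx. Qed.

Lemma chi1 (y : R) : y <= 7 / 2 -> chi y = 1.
Proof. by move=> h; rewrite /chi min_l ?max_r//; lra. Qed.

Lemma chi_gt0 (y : R) : 0 < chi y -> y < 4.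
Proof. by rewrite /chi lt_max ltxx /= lt_min => /andP[_]; lra. Qed.

(** Keeps the transition strip of [chi] away from points where the near metric realizes the
    maximum. *)
Lemma near_lt_sigma u : 7 / 2 <= `|cIm u| -> `|cIm u| <= 4 ->
  15 / eta (tau u) < (2 * (`|cIm u| + 12))^-1.
Proof.
set y := `|cIm u| => y1 y2.
have d1 := distZ_ge_Im u; rewrite -/y in d1.
(* 34/25 is a lower estimate of (7/2)^(1/4); it suffices because 388 * 34/25 > 15 * 32. *)
have t1 : 34 / 25 <= tau u.
  rewrite le_min; apply/andP; split; last by lra.
  apply: le_root4; [exact: distZ_ge0|lra|].
  apply: le_trans d1; apply: le_trans y1.
  by rewrite (exprM _ 2 2) !expr2; lra.
have h := @eta_ge (tau u) ltac:(by rewrite tau_ge0 tau_le).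
have e0 : 0 < eta (tau u) by lra.
rewrite ltr_pdivrMr// mulrC ltr_pdivlMr; lra.
Qed.

(** |Im w| has a corner on the real axis, where no single half-plane metric supports the minimum of
    two from below; the near metric has to win there. The shift 12 and the scale 20 are tuned to
    this and to [near_lt_sigma]. *)
Lemma near_gt_sigma u : cIm u = 0 -> 0 < distZ u -> (2 * (0 + 12))^-1 < 15 / eta (tau u).
Proof.
move=> u0 d0; have t0 := tau_gt0 d0.
have d1 : distZ u <= 2^-1.
  rewrite -(ler_pXn2r (n := 2)) ?nnegrE ?distZ_ge0//.
  by have := distZ_bound u; rewrite u0 expr0n addr0 (_ : 4^-1 = 2^-1 ^+ 2)//; field.
(* 17/20 is an upper estimate of (1/2)^(1/4), and 400 * 17/20 < 15 * 24. *)
have t1 : tau u <= 17 / 20.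
  rewrite ge_min; apply/orP; left; apply: root4_le; [exact: distZ_ge0|lra|].
  by apply: le_trans d1 _; rewrite (exprM _ 2 2) !expr2; lra.
have h := eta_le (ltW t0).
have h2 := @eta_ge (tau u) ltac:(by rewrite tau_ge0 tau_le).
have e0 : 0 < eta (tau u) by lra.
rewrite ltr_pdivlMr// mulrC ltr_pdivrMr; lra.
Qed.
End RealBounds.

(** * The derivative near a ramification point *)

Section Landau.
Variable R : realType.
Local Notation C := (Cplx R).
Implicit Types (z u : C).

(** If w - c vanishes to order q >= 2, then |w'|^4 has order 4 (q - 1) > q. The alternative w' = 0
    covers [z1] itself and the case of w locally constant. *)
Lemma ramified_small (w : C -> C) z1 (r : R) (c : C) : 0 < r ->
  (forall z, nrm (z - z1) < r -> hol_at w z) -> w z1 = c -> dv w z1 = 0 ->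
  forall e : R, 0 < e -> exists2 d : R, 0 < d & forall z, nrm (z - z1) < d ->
    dv w z = 0 \/ nrm (dv w z) ^+ 4 < e * nrm (w z - c).
Proof.
move=> r0 hw wc dw0 e e0.
pose D := [set z : C | nrm (z - z1) < r].
have oD : open D.
  apply/open_nrm => z /= zr; exists (r - nrm (z - z1)) => [|u uz]; first by rewrite subr_gt0.
  by rewrite /D /=; have := nrm_tri u z z1; lra.
have D1 : D z1 by rewrite /D /= subrr nrm0.
pose f z := w z - c.
have hf : hol_on D f by move=> z zD; apply: holB; [exact: hw|exact: hol_cst].
have dfw z : D z -> cder f z (dv w z).
  by move=> zD; have := cderB (hol_cder (hw z zD)) (cder_cst c z); rewrite subr0.
have [[p [g [hg fg g1]]]|inf] := finite_order_or oD D1 hf; last first.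
  have [s s0 Hs] := infinite_order_zero oD D1 hf inf.
  exists (Num.min r s) => [|z]; first by rewrite lt_min r0.
  rewrite lt_min => /andP[zr zs]; left; apply: cder_unique (dfw z zr) _.
  apply: (@cder_near _ (fun=> 0)); last exact: cder_cst.
  exists (s - nrm (z - z1)) => [|u uz]; first by rewrite subr_gt0.
  by rewrite Hs//; have := nrm_tri u z z1; lra.
case: p fg => [|[|p]] fg.
- by have := fg z1; rewrite expr0 mul1r /f wc subrr => /esym/eqP; rewrite (negbTE g1).
- have : cder f z1 (g z1).
    apply: (@cder_near _ (fun z => (z - z1) * g z)); first by exists 1 => // z _; rewrite fg expr1.
    apply: cder_eq (cderM (cderB (cder_id z1) (cder_cst z1 z1)) (hol_cder (hg z1 D1))) _.
    by rewrite subr0 subrr mul1r mul0r addr0.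
  by move=> /(cder_unique (dfw z1 D1)); rewrite dw0 => /esym/eqP; rewrite (negbTE g1).
pose G z := p.+2%:R * g z + (z - z1) * dv g z.
have dG z : D z -> dv w z = (z - z1) ^+ p.+1 * G z.
  move=> zD; apply: cder_unique (dfw z zD) _.
  apply: (@cder_near _ (fun z => (z - z1) ^+ p.+2 * g z)); first by exists 1 => // u _; rewrite fg.
  apply: cder_eq (cderM (cderX p.+2 (cderB (cder_id z) (cder_cst z1 z))) (hol_cder (hg z zD))) _.
  by rewrite -pred_Sn subr0 mulr1 [in X in _ + X * _]exprS /G; ring.
have hG : hol_at G z1.
  apply: holD; first by apply: holM; [exact: hol_cst|exact: hg].
  apply: holM; first by apply: holB; [exact: hol_id|exact: hol_cst].
  by apply: hol_dv r0 _ => z /hg.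
have [d1 d10 H1] := hol_cont hG ltr01.
have [d2 d20 H2] := hol_cont (hg z1 D1) (e := nrm (g z1) / 2) ltac:(by rewrite divr_gt0// nrm_gt0).
pose G0 := nrm (G z1) + 1; pose k := nrm (g z1) / 2.
have k0 : 0 < k by rewrite divr_gt0// nrm_gt0.
have G00 : 0 < G0 by rewrite ltr_wpDl ?nrm_ge0.
exists (Num.min 1 (Num.min r (Num.min d1 (Num.min d2 (e * k / G0 ^+ 4))))).
  rewrite !lt_min ltr01 r0 d10 d20 /=.
  by apply: divr_gt0; [exact: mulr_gt0|exact: exprn_gt0].
move=> z; rewrite !lt_min => /and5P[z1' zr zd1 zd2]; rewrite ltr_pdivlMr ?exprn_gt0// => zk.
have [->|zz1] := eqVneq z z1; [by left|right].
have rho0 : 0 < nrm (z - z1) by rewrite nrm_sub_gt0.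
rewrite (dG z zr) -/(f z) fg !nrmM !nrmX; set rho := nrm (z - z1) in z1' zk rho0 *.
have GG : nrm (G z) <= G0.
  by rewrite -(subrK (G z1) (G z)) (le_trans (nrmD _ _))// addrC lerD2l ltW// H1.
have gg : k <= nrm (g z).
  by have := H2 z zd2; have := nrmBl (g z1) (g z); rewrite nrmC -/k /k; lra.
rewrite mulrCA; apply: (@lt_le_trans _ _ (rho ^+ p.+2 * (e * k))); last first.
  by rewrite ler_pM2l ?exprn_gt0// ler_pM2l.
rewrite exprMn; apply: (@le_lt_trans _ _ (rho ^+ p.+2 * (rho * G0 ^+ 4))); last first.
  by rewrite ltr_pM2l ?exprn_gt0.
rewrite mulrA -exprSr; apply: ler_pM; rewrite ?exprn_ge0 ?nrm_ge0//.
  have pp : (p.+3 <= p.+1 * 4)%N by rewrite -addn3 addnC mulSn leq_add// leq_pmulr.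
  rewrite -exprM; apply: ler_wiXn2l pp; exact: ltW.
by rewrite lerXn2r ?nnegrE ?nrm_ge0// ltW.
Qed.
End Landau.

(** * The Landau bound by comparison of metrics *)

Section LandauBound.
Variable R : realType.
Local Notation C := (Cplx R).
Implicit Types (z u : C).
Variable w : C -> C.
Hypothesis hw : forall z, nrm z < 2 -> hol_at w z.
Hypothesis ramified : forall z k, nrm z < 2 -> w z = zc R k -> dv w z = 0.

Let Y z : R := `|cIm (w z)|.
Let N z : R := nrm (dv w z).
Let sigma z : R := (2 * (Y z + 12))^-1.
(** Over an integer [eta] is 0 and division by zero makes [near] 0. Only the product with [N] has to
    be continuous, and its limit there is indeed 0, as w' vanishes. *)
Let near z : R := 15 / eta (tau (w z)) * chi (Y z).
Let Q z : R := Num.max (sigma z * N z) (near z * N z) * (1 - nrm z ^+ 2).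

Lemma ball_hol z u : nrm z <= 1 -> nrm (u - z) < 1 -> hol_at w u.
Proof. by move=> z1 uz; apply: hw; have := nrm_tri u z 0; rewrite !subr0; lra. Qed.

Lemma sigma_gt0 z : 0 < sigma z.
Proof. by rewrite invr_gt0 mulr_gt0// ltr_wpDl ?normr_ge0. Qed.

Lemma near_ge0 z : 0 <= near z.
Proof.
have /andP[c0 _] := chi_itv (Y z); rewrite mulr_ge0// divr_ge0//.
by have := @eta_ge R (tau (w z)) ltac:(by rewrite tau_ge0 tau_le); have := tau_ge0 (w z); lra.
Qed.

Lemma N_cont z : nrm z <= 1 -> qcont N z.
Proof.
move=> z1; apply: ccont_nrm; apply: hol_cont; apply: (@hol_dv _ _ _ 1) => // u.
exact: ball_hol.
Qed.

Lemma w_cont z : nrm z <= 1 -> ccont w z.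
Proof. by move=> z1; apply: hol_cont; apply: hw; lra. Qed.

Lemma Y_cont z : nrm z <= 1 -> qcont Y z.
Proof.
move=> z1; apply: (qcont_lip (phi := fun u => `|cIm u|)) (w_cont z1) => u u'.
by apply: le_trans (ler_dist_dist _ _) _; rewrite -cImB nrm_Im.
Qed.

Lemma nearN_cont z : nrm z <= 1 -> qcont (fun z => near z * N z) z.
Proof.
move=> z1; have z2 : nrm z < 2 by lra.
have cd : qcont (fun z => distZ (w z)) z by apply: (qcont_lip (@distZ_lip R)) (w_cont z1).
have [d0|d0] := eqVneq (distZ (w z)) 0; last first.
  have dp : 0 < distZ (w z) by rewrite lt_def d0 distZ_ge0.
  have tp := tau_gt0 dp.
  have ct : qcont (fun z => tau (w z)) z.
    by apply: qcont_min; [do 2 apply: qcont_sqrt|exact: qcont_cst].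
  apply: qcontM; last exact: N_cont.
  apply: qcontM; last first.
    apply: qcont_max; first exact: qcont_cst.
    apply: qcont_min; first exact: qcont_cst.
    apply: qcontM; first exact: qcont_cst.
    by apply: qcontB; [exact: qcont_cst|exact: Y_cont].
  apply: qcontM; first exact: qcont_cst.
  have et0 : 0 < eta (tau (w z)).
    by have := @eta_ge R (tau (w z)) ltac:(by rewrite tau_ge0 tau_le); lra.
  apply: qcontV; first by rewrite gt_eqF.
  apply: qcontM => //; apply: qcontB; first exact: qcont_cst.
  exact: qcontX.
have wz : w z = zc R (nearest (w z)).
  by move: d0; rewrite /distZ => /nrm0_eq0/eqP; rewrite subr_eq0 => /eqP.
have dz := ramified z2 wz.
move=> e e0.
(* With e^4 the conclusion reads N u < e t, and dividing 15 N u by eta t >= 388 t leaves less than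
   [e]. *)
have [d1 d10 H1] := @ramified_small R w z 1 _ ltr01 (fun u => @ball_hol z u z1) wz dz (e ^+ 4) (exprn_gt0 _ e0).
have [d2 d20 H2] := w_cont z1 (e := 2^-1) ltac:(by rewrite invr_gt0).
exists (Num.min d1 d2) => [|u]; first by rewrite lt_min d10.
rewrite lt_min => /andP[/H1 {}H1 /H2 {}H2].
rewrite {2}/N dz nrm0 mulr0 subr0 ger0_norm; last first.
  by apply: mulr_ge0; [exact: near_ge0|exact: nrm_ge0].
case: H1 => [H1|H1]; first by rewrite /N H1 nrm0 mulr0.
rewrite {1}wz in H2; have dE := distZ_small H2; rewrite -dE in H1 H2.
have dp : 0 < distZ (w u).
  rewrite lt_def distZ_ge0 andbT; apply/eqP => h; move: H1; rewrite h mulr0 ltNge exprn_ge0 ?nrm_ge0//.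
have [tE t4] := @tau_small R (w u) ltac:(lra).
have tp := tau_gt0 dp; set t := tau (w u) in tE t4 tp.
have Nt : N u < e * t.
  rewrite -(ltr_pXn2r (n := 4)) ?nnegrE ?nrm_ge0 ?mulr_ge0 ?(ltW tp) ?(ltW e0)//.
  by rewrite exprMn t4.
have et := @eta_ge R t ltac:(by rewrite tau_ge0 tau_le).
have et0 : 0 < eta t by lra.
have /andP[c0 c1] := chi_itv (Y u).
apply: (@le_lt_trans _ _ (15 / eta t * N u)).
  by rewrite ler_wpM2r ?nrm_ge0// ler_piMr// divr_ge0// ltW.
rewrite mulrAC ltr_pdivrMr//.
have : e * (388 * t) <= e * eta t by rewrite ler_pM2l.
have : 0 < e * t by rewrite mulr_gt0.
lra.
Qed.

Lemma sigmaN_cont z : nrm z <= 1 -> qcont (fun z => sigma z * N z) z.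
Proof.
move=> z1; apply: qcontM; last exact: N_cont.
apply: qcontV; first by have := sigma_gt0 z; rewrite invr_gt0 => /gt_eqF ->.
apply: qcontM; first exact: qcont_cst.
have : qcont (fun z => Y z - (- 12)) z by apply: qcontB; [exact: Y_cont|exact: qcont_cst].
by rewrite opprK.
Qed.

Lemma Q_cont z : nrm z <= 1 -> qcont Q z.
Proof.
move=> z1; apply: qcontM.
  by apply: qcont_max; [exact: sigmaN_cont|exact: nearN_cont].
apply: qcontB; first exact: qcont_cst.
by apply: qcontX; apply: ccont_nrm (hol_cont (hol_id z)).
Qed.

Lemma local_cont_lt (q : C -> R) z (a : R) : qcont q z -> q z < a ->
  exists2 d : R, 0 < d & forall u, nrm (u - z) < d -> q u < a.
Proof.
move=> cq qa; have [d d0 H] := cq (a - q z) ltac:(by rewrite subr_gt0).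
by exists d => // u /H; rewrite ltr_norml => /andP[_]; lra.
Qed.

(* The near metric is supported at [z0] by the pull-back of the hyperbolic metric of the disc
   under [(w - k)^(3/4) / 20]. *)
Lemma near_max_le1 z0 : nrm z0 < 1 -> (forall z, nrm z < 1 -> Q z <= Q z0) ->
  sigma z0 <= near z0 -> 0 < N z0 -> Q z0 <= 1.
Proof.
move=> z01 Qmax sn Np; have z01' := ltW z01.
have c0 : 0 < chi (Y z0).
  have /andP[c0 _] := chi_itv (Y z0); rewrite lt_def c0 andbT; apply/eqP => h.
  by have := sigma_gt0 z0; rewrite ltNge (le_trans sn)// /near h mulr0.
have Y4 := chi_gt0 c0.
(* In the transition strip of [chi] the half-plane density would be larger, so the cut-off equals 1
   around [z0]. *)
have Y72 : Y z0 < 7 / 2.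
  rewrite ltNge; apply/negP => h; have := near_lt_sigma h (ltW Y4).
  rewrite -/(Y z0) -/(sigma z0) ltNge (le_trans sn)// /near ler_piMr//.
    have := @eta_ge R (tau (w z0)) ltac:(by rewrite tau_ge0 tau_le); have := tau_ge0 (w z0) => h1 h2.
    by rewrite divr_ge0//; lra.
  by have /andP[] := chi_itv (Y z0).
pose k := nearest (w z0).
pose f z := w z - zc R k.
have fz0 : f z0 != 0.
  apply/eqP => /eqP; rewrite subr_eq0 => /eqP h; move: Np.
  by rewrite /N (ramified _ h) ?nrm0 ?ltxx//; lra.
have f4 : nrm (f z0) < 4.
  rewrite -(ltr_pXn2r (n := 2)) ?nnegrE ?nrm_ge0//.
  apply: le_lt_trans (distZ_bound (w z0)) _.
  have : cIm (w z0) ^+ 2 <= (7 / 2) ^+ 2.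
    by rewrite -[X in X <= _]real_normK ?num_real// lerXn2r ?nnegrE ?normr_ge0 ?(ltW Y72)//; lra.
  by rewrite !expr2; lra.
have cf z : nrm z <= 1 -> ccont f z.
  by move=> z1; apply: hol_cont; apply: holB; [apply: hw; lra|exact: hol_cst].
have [d1 d10 H1] := local_cont_lt (Y_cont z01') Y72.
have [d2 d20 H2] := local_cont_lt (ccont_nrm (cf _ z01')) f4.
have [d3 d30 H3] := cf _ z01' (nrm (f z0)) ltac:(by rewrite nrm_gt0).
pose d := Num.min (1 - nrm z0) (Num.min d1 (Num.min d2 d3)).
have d0 : 0 < d by rewrite !lt_min subr_gt0 z01 d10 d20 d30.
have dall z : nrm (z - z0) < d -> [/\ nrm z < 1, Y z < 7 / 2, nrm (f z) < 4 & f z != 0].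
  rewrite !lt_min => /and4P[h0 /H1 h1 /H2 h2 /H3 h3]; split => //.
    by have := nrm_tri z z0 0; rewrite !subr0; lra.
  apply/eqP => h; move: h3; rewrite h sub0r nrmN ltxx//.
have hf z : nrm (z - z0) < d -> hol_at f z.
  by move=> /dall[z1 _ _ _]; apply: holB; [apply: hw; lra|exact: hol_cst].
have [L dL fL] := @log_ball R f z0 d d0 hf (fun z zd => let: And4 _ _ _ h := dall z zd in h).
have dfw z : nrm (z - z0) < d -> dv f z = dv w z.
  move=> /dall[z1 _ _ _]; apply: cder_dv.
  by have := cderB (hol_cder (hw (z := z) ltac:(lra))) (cder_cst (zc R k) z); rewrite subr0.
(* The modulus |f z|^(1/4), expressed through the logarithm that also supplies a branch of
   f^(3/4). *)
pose E z := expR (cRe (L z) / 4).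
have E0 z : 0 < E z by exact: expR_gt0.
have E4 z : nrm (z - z0) < d -> E z ^+ 4 = nrm (f z).
  by move=> zd; rewrite (fL z zd) nrm_cexp /E -expRM_natr divfK.
have E32 z : nrm (z - z0) < d -> E z < 3 / 2.
  move=> zd; rewrite -(ltr_pXn2r (n := 4)) ?nnegrE ?(ltW (E0 z))//.
  by have [_ _ h _] := dall z zd; rewrite E4// (exprM _ 2 2) !expr2; lra.
pose s z := cexp (3 / 4 * L z) / 20.
have n20 : nrm (20^-1 : C) = 20^-1 by rewrite nrmV nrm_nat.
have ns z : nrm (s z) = E z ^+ 3 / 20.
  rewrite /s nrmM n20 nrm_cexp /E -expRM_natr; congr (expR _ / _).
  rewrite (_ : 3 / 4 = rc (3 / 4)); last by rewrite rcM rcV !rc_nat.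
  by rewrite cReM cRe_rc cIm_rc mul0r subr0; field.
have ds z : nrm (z - z0) < d -> cder s z (s z * (3 / 4) * (dv w z / f z)).
  move=> zd; have H := cder_comp (cderZ (3 / 4) (dL z zd)) (cder_cexp (3 / 4 * L z)).
  apply: cder_eq (cderM H (cder_cst 20^-1 z)) _.
  by rewrite (dfw z zd) mulr0 addr0 /s; ring.
have nds z : nrm (z - z0) < d -> nrm (dv s z) = 3 * N z / (80 * E z).
  move=> zd; have n34 : nrm (3 / 4 : C) = 3 / 4 by rewrite nrmM nrmV !nrm_nat.
  rewrite (cder_dv (ds z zd)) nrmM (nrmM (s z)) ns n34 (nrmM (dv w z)) nrmV -(E4 z zd) -/(N z).
  by field; rewrite gt_eqF.
have six z : nrm (z - z0) < d -> E z ^+ 6 <= 12.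
  by move=> zd; apply: pow6_le; rewrite (ltW (E0 z)) (ltW (E32 z zd)).
have ratio z : nrm (z - z0) < d ->
    nrm (dv s z) * (1 - nrm z ^+ 2) / (1 - nrm (s z) ^+ 2) = 15 / eta (E z) * N z * (1 - nrm z ^+ 2).
  move=> zd; have h6 := six z zd; rewrite (nds z zd) ns /eta.
  have p6 : 0 < 400 - E z ^+ 6 by rewrite subr_gt0 (le_lt_trans h6)// ltr_nat.
  by field; rewrite !gt_eqF.
(* The distance to the fixed integer [k] is at least the distance to the nearest one and [eta]
   increases, so the metric belonging to [k] lies below; equality at [z0] is [Q0]. *)
have Qs z : nrm (z - z0) < d -> 15 / eta (E z) * N z * (1 - nrm z ^+ 2) <= Q z.
  move=> zd; have [z1 yz fz4 fz] := dall z zd.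
  have z2 : 0 <= 1 - nrm z ^+ 2 by rewrite subr_ge0 expr_le1 ?nrm_ge0 ?(ltW z1).
  rewrite ler_wpM2r// le_max; apply/orP; right.
  have dle : distZ (w z) <= nrm (f z) := distZ_min (w z) k.
  have [dz|dz] := eqVneq (distZ (w z)) 0.
    have wz : w z = zc R (nearest (w z)).
      by move: dz; rewrite /distZ => /nrm0_eq0/eqP; rewrite subr_eq0 => /eqP.
    have z2' : nrm z < 2 by lra.
    by rewrite /N (ramified z2' wz) nrm0 !mulr0.
  have dp : 0 < distZ (w z) by rewrite lt_def dz distZ_ge0.
  have tp := tau_gt0 dp.
  have [_ t4] := @tau_small R (w z) ltac:(lra).
  rewrite ler_wpM2r ?nrm_ge0// /near chi1 ?(ltW yz)// mulr1 ler_pM2l//.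
  have et := @eta_ge R (tau (w z)) ltac:(by rewrite tau_ge0 tau_le).
  have te : tau (w z) <= E z.
    by rewrite -(ler_pXn2r (n := 4)) ?nnegrE ?tau_ge0 ?(ltW (E0 z))// t4 E4.
  have em := eta_mono (ltW tp) te (ltW (E32 z zd)).
  by rewrite lef_pV2 ?posrE//; lra.
have z0d : nrm (z0 - z0) < d by rewrite subrr nrm0.
have Q0 : Q z0 = 15 / eta (E z0) * N z0 * (1 - nrm z0 ^+ 2).
  rewrite /Q max_r; last by rewrite ler_wpM2r ?nrm_ge0.
  rewrite /near chi1 ?(ltW Y72)// mulr1.
  have [_ t4] := @tau_small R (w z0) (ltW f4).
  have -> : tau (w z0) = E z0; last by [].
  apply/eqP; rewrite -(eqrXn2 (n := 4)) ?tau_ge0 ?(ltW (E0 z0))// t4 E4//.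
rewrite Q0 -ratio//; apply: (@schwarz_pick_local R s z0 d) => // z zd.
- by exists (s z * (3 / 4) * (dv w z / f z)); exact: ds.
- rewrite ns ltr_pdivrMr// mul1r.
  have := E32 z zd; have h0 := E0 z => h1.
  have : E z ^+ 3 <= (3 / 2) ^+ 3 by rewrite lerXn2r ?nnegrE ?(ltW h0)//; lra.
  by rewrite (_ : (3 / 2) ^+ 3 = 27 / 8 :> R); [lra|field].
- move=> z1; rewrite !ratio// -Q0; apply: le_trans (Qs z zd) _; exact: Qmax.
Qed.
(* Off the real axis the metric is supported by that of a half-plane. *)
Lemma sigma_max_le1 z0 : nrm z0 < 1 -> (forall z, nrm z < 1 -> Q z <= Q z0) ->
  near z0 < sigma z0 -> 0 < N z0 -> Q z0 <= 1.
Proof.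
move=> z01 Qmax ns Np; have z01' := ltW z01.
(* On the real axis [near_gt_sigma] would contradict the assumption that the half-plane density is
   the larger. *)
have y0 : cIm (w z0) != 0.
  apply/eqP => h.
  have dp : 0 < distZ (w z0).
    rewrite lt_def distZ_ge0 andbT; apply/eqP => dz.
    have wz : w z0 = zc R (nearest (w z0)).
      by move: dz; rewrite /distZ => /nrm0_eq0/eqP; rewrite subr_eq0 => /eqP.
    by move: Np; rewrite /N (ramified _ wz) ?nrm0 ?ltxx//; lra.
  have := near_gt_sigma h dp; have Y0 : Y z0 = 0 by rewrite /Y h normr0.
  rewrite ltNge => /negP; apply; move: ns; rewrite /near /sigma Y0 chi1; last by lra.
  by rewrite mulr1 => /ltW.
(* The sign moves w z0 into the upper half-plane, where |Im w| is locally an imaginary part. *)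
pose eps : C := if 0 < cIm (w z0) then 1 else -1.
have neps : nrm eps = 1 by rewrite /eps; case: ifP => _; rewrite ?nrmN nrm1.
have Ieps z : cIm (eps * w z) = if 0 < cIm (w z0) then cIm (w z) else - cIm (w z).
  by rewrite /eps; case: ifP => _; rewrite ?mul1r// mulN1r cImN.
have I0 : 0 < cIm (eps * w z0).
  by rewrite Ieps; case: ifPn => //; rewrite -leNgt oppr_gt0 lt_neqAle y0.
have hew z : nrm z < 2 -> cder (fun z => eps * w z) z (eps * dv w z).
  by move=> z2; apply: cderZ; exact: hol_cder (hw z2).
have [d1 d10 H1] := cder_cont (hew z0 ltac:(lra)) I0.
pose d := Num.min (1 - nrm z0) d1.
have d0 : 0 < d by rewrite lt_min subr_gt0 z01.
have dall z : nrm (z - z0) < d -> nrm z < 1 /\ 0 < cIm (eps * w z).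
  rewrite lt_min => /andP[h0 /H1 h1]; split.
    by have := nrm_tri z z0 0; rewrite !subr0; lra.
  have := le_lt_trans (nrm_Im _) h1; rewrite cImB ltr_norml; lra.
have YE z : nrm (z - z0) < d -> Y z = cIm (eps * w z).
  move=> /dall[_]; rewrite Ieps /Y; case: ifP => _ h; first by rewrite gtr0_norm.
  by rewrite ltr0_norm// -oppr_gt0.
pose W z := eps * w z + cI R * rc 12.
have IW z : cIm (W z) = cIm (eps * w z) + 12.
  by rewrite /W cImD [X in _ + X]cImM cIm_rc cRe_rc /cI /cRe /cIm /=; ring.
pose s z := (W z - cI R) / (W z + cI R).
have nWi z : nrm (W z + cI R) ^+ 2 - nrm (W z - cI R) ^+ 2 = 4 * cIm (W z).
  by rewrite !nrm_sqr !cReD !cImD cReN cImN /cI /cRe /cIm /=; ring.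
have Wi z : nrm (z - z0) < d -> W z + cI R != 0.
  move=> /dall[_ h]; apply/eqP => /(congr1 (@cIm R)); rewrite cImD IW /cI /cIm /= -/(cIm _) => h2.
  by move: h; rewrite ltNge => /negP; apply; lra.
have dW z : nrm (z - z0) < d -> cder W z (eps * dv w z).
  by move=> /dall[z1 _]; have := cderD (hew z ltac:(lra)) (cder_cst (cI R * rc 12) z); rewrite addr0.
have ds z : nrm (z - z0) < d -> cder s z (2 * cI R * (eps * dv w z) / (W z + cI R) ^+ 2).
  move=> zd; have H := dW z zd.
  apply: cder_eq (cder_div (cderB H (cder_cst (cI R) z)) (cderD H (cder_cst (cI R) z)) (Wi z zd)) _.
  by congr (_ / _); ring.
have pW z : nrm (z - z0) < d -> 0 < nrm (W z + cI R) by move=> zd; rewrite nrm_gt0 Wi.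
have ratio z : nrm (z - z0) < d ->
    nrm (dv s z) * (1 - nrm z ^+ 2) / (1 - nrm (s z) ^+ 2) = sigma z * N z * (1 - nrm z ^+ 2).
  move=> zd; have pz := pW z zd; have E1 := nWi z; have [z1 h] := dall z zd.
  rewrite (cder_dv (ds z zd)) /sigma (YE z zd) -IW.
  have Ip : 0 < cIm (W z) by rewrite IW; lra.
  have -> : 1 - nrm (s z) ^+ 2 = 4 * cIm (W z) / nrm (W z + cI R) ^+ 2.
    by rewrite /s nrmM nrmV -E1; field; rewrite gt_eqF.
  rewrite nrmM nrmV nrmX nrmM (nrmM 2) nrm_cI nrm_nat (nrmM eps) neps -/(N z).
  by field; rewrite !gt_eqF.
have z0d : nrm (z0 - z0) < d by rewrite subrr nrm0.
have Q0 : Q z0 = sigma z0 * N z0 * (1 - nrm z0 ^+ 2).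
  by rewrite /Q max_l// ler_wpM2r ?nrm_ge0// ltW.
rewrite Q0 -ratio//; apply: (@schwarz_pick_local R s z0 d) => // z zd.
- by eexists; exact: ds zd.
- have [_ h] := dall z zd; rewrite /s nrmM nrmV ltr_pdivrMr ?pW// mul1r.
  rewrite -(ltr_pXn2r (n := 2)) ?nnegrE ?nrm_ge0// -subr_gt0 nWi IW mulr_gt0//; lra.
- move=> z1; rewrite !ratio// -Q0; apply: le_trans (Qmax z z1).
  have z2 : 0 <= 1 - nrm z ^+ 2 by rewrite subr_ge0 expr_le1 ?nrm_ge0 ?(ltW z1).
  by rewrite ler_wpM2r// le_max lexx.
Qed.

(** Holomorphy on the disc of radius 2 makes [Q] continuous on the closed unit disc, and the factor
    1 - |z|^2 kills it on the boundary. A maximum above 1 would be interior with w' nonzero, and one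
    of the two supporting metrics excludes it. *)
Theorem landau z : nrm z < 1 -> nrm (dv w z) * (1 - nrm z ^+ 2) <= 2 * (`|cIm (w z)| + 12).
Proof.
move=> z1; have [|z0 z0r Qmax] := @cball_max R Q 0 1 ler01.
  by move=> u; rewrite subr0; exact: Q_cont.
rewrite subr0 in z0r.
have Qm u : nrm u < 1 -> Q u <= Q z0 by move=> u1; apply: Qmax; rewrite subr0 ltW.
have Q1 : Q z0 <= 1.
  rewrite leNgt; apply/negP => Q1.
  have z01 : nrm z0 < 1.
    rewrite lt_neqAle z0r andbT; apply/eqP => h.
    by move: Q1; rewrite /Q h expr1n subrr mulr0 ltNge ler01.
  have Np : 0 < N z0.
    rewrite lt_def nrm_ge0 andbT; apply/eqP => h.
    by move: Q1; rewrite /Q h !mulr0 maxxx mul0r ltNge ler01.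
  move: Q1; rewrite ltNge => /negP; apply.
  by case: (leP (sigma z0) (near z0)) => h; [exact: near_max_le1|exact: sigma_max_le1].
have w0 : 0 <= 1 - nrm z ^+ 2 by rewrite subr_ge0 expr_le1 ?nrm_ge0 ?(ltW z1).
have : sigma z * N z * (1 - nrm z ^+ 2) <= 1.
  apply: le_trans Q1; apply: le_trans (Qm z z1); rewrite ler_wpM2r//.
  by rewrite le_max lexx.
have p0 : 0 < 2 * (Y z + 12) by apply: mulr_gt0 => //; apply: ltr_wpDl => //; exact: normr_ge0.
by rewrite /sigma -mulrA mulrC ler_pdivrMr// mul1r.
Qed.
End LandauBound.

(** * Schottky's theorem *)

Section Gronwall.
Variable R : realType.

(** The exponential of arsinh y. *)
Definition gsh (y : R) : R := y + Num.sqrt (y ^+ 2 + 1).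

Lemma gsh_sqrt (y : R) : `|y| < Num.sqrt (y ^+ 2 + 1).
Proof. by rewrite -sqrtr_sqr ltr_sqrt ?ltrDl// ltr_wpDl ?sqr_ge0. Qed.

Lemma gsh_gt0 y : 0 < gsh y.
Proof. by have := gsh_sqrt y; have := ler_norm (- y); rewrite normrN /gsh; lra. Qed.

Lemma is_derive_ln_gsh (y : R) : is_derive y 1 (@ln R \o gsh) (Num.sqrt (y ^+ 2 + 1))^-1.
Proof.
have s0 : 0 < y ^+ 2 + 1 by rewrite ltr_wpDl ?sqr_ge0.
have q0 : 0 < Num.sqrt (y ^+ 2 + 1) by rewrite sqrtr_gt0.
have dsq : is_derive y 1 (fun y : R => y ^+ 2 + 1) (2 * y).
  apply/is_derive_rder => e e0; exists e => // s se.
  rewrite (_ : _ - _ - _ = (s - y) * (s - y)); last by ring.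
  by rewrite normrM ler_wpM2r// ltW.
have dg : is_derive y 1 gsh (1 + (2 * Num.sqrt (y ^+ 2 + 1))^-1 * (2 * y)).
  have -> : gsh = id + (Num.sqrt \o (fun y : R => y ^+ 2 + 1)) by [].
  have dc := @is_derive1_comp R Num.sqrt (fun y : R => y ^+ 2 + 1) y _ _ (is_derive1_sqrt s0) dsq.
  exact: (is_deriveD (is_derive_id y 1) dc).
have dl := @is_derive1_comp R (@ln R) gsh y _ _ (is_derive1_ln (gsh_gt0 y)) dg.
apply: is_derive_eq dl _.
have := gsh_gt0 y; rewrite /gsh; set q := Num.sqrt _ in q0 *; move=> g0.
by field; rewrite !gt_eqF.
Qed.

(* [ln (y + sqrt (y^2 + 1))] grows at bounded speed, whatever the sign of [y]. *)
Lemma gronwall (y dy : R -> R) (K B : R) : 0 <= K -> 0 <= B ->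
  (forall t : R, 0 <= t <= 1 -> is_derive t 1 y (dy t)) ->
  (forall t, 0 <= t <= 1 -> dy t <= K * (`|y t| + 12)) ->
  y 0 <= B -> y 1 <= expR (13 * K) * (2 * B + 1).
Proof.
move=> K0 B0 dyP dyK y0.
have := @real_MVI R ((@ln R \o gsh) \o y) (fun t => (Num.sqrt (y t ^+ 2 + 1))^-1 * dy t) 0 1 (13 * K) ler01.
rewrite subr0 mulr1 => H.
have {}H : ln (gsh (y 1)) - ln (gsh (y 0)) <= 13 * K.
  apply: H => t t01; first exact: (@is_derive1_comp R _ y t _ _ (is_derive_ln_gsh (y t)) (dyP t t01)).
  (* The square root exceeds |y| and is at least 1, so |y| + 12 is at most 13 times it. *)
  have h := gsh_sqrt (y t); have q1 : 1 <= Num.sqrt (y t ^+ 2 + 1).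
    by rewrite -[X in X <= _]sqrtr1 ler_wsqrtr// lerDr sqr_ge0.
  set q := Num.sqrt _ in h q1 *.
  have q0 : 0 < q by lra.
  rewrite mulrC ler_pdivrMr//; apply: le_trans (dyK t t01) _.
  by rewrite (mulrC 13) -mulrA ler_wpM2l//; lra.
have g0 := gsh_gt0 (y 0); have g1 := gsh_gt0 (y 1).
have : gsh (y 1) <= expR (13 * K) * gsh (y 0).
  have e1 : expR (ln (gsh (y 1))) = gsh (y 1) by rewrite lnK ?posrE.
  have e0 : expR (ln (gsh (y 0))) = gsh (y 0) by rewrite lnK ?posrE.
  rewrite -e1 -e0 -expRD ler_expR; lra.
have y1 : y 1 <= gsh (y 1) by rewrite /gsh lerDl sqrtr_ge0.
move=> h; apply: le_trans y1 _; apply: le_trans h _; rewrite ler_pM2l ?expR_gt0//.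
have sq : Num.sqrt (y 0 ^+ 2 + 1) <= `|y 0| + 1.
  rewrite -[X in _ <= X]ger0_norm ?addr_ge0// -sqrtr_sqr ler_sqrt ?sqr_ge0//.
  rewrite sqrrD real_normK ?num_real// expr1n lerD2r lerDl mulr1 mulrn_wge0//.
(* For negative y 0 the two terms of [gsh] add up to at most 1, so a very negative start costs
   nothing. *)
rewrite /gsh; case: (ler0P (y 0)) sq; lra.
Qed.
End Gronwall.

(** * Schottky's theorem on discs *)

Section Schottky.
Variable R : realType.
Local Notation C := (Cplx R).
Implicit Types (z c : C).

Lemma cis_intr (k : int) : cis (pi *+ 2 * k%:~R) = 1 :> C.
Proof.
have nat_case n : cis (pi *+ 2 * n%:R) = 1 :> C.
  elim: n => [|n IH]; first by rewrite mulr0 cis0.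
  by rewrite -natr1 mulrDr cisD IH mul1r mulr1 cis2pi.
case: k => n; first exact: nat_case.
rewrite NegzE mulrNz mulrN; have := cisD (pi *+ 2 * n.+1%:R) (- (pi *+ 2 * n.+1%:R) : R).
by rewrite addrN cis0 nat_case mul1r => ->.
Qed.

Definition ramified_over1 (v : C -> C) (A : set C) :=
  [/\ forall z, A z -> hol_at v z, forall z, A z -> v z != 0 &
      forall z, A z -> v z = 1 -> dv v z = 0].

Definition ballC c (r : R) : set C := [set z | nrm (z - c) < r].

(** Since ln |v| = - 2 pi Im w, the one-sided [gronwall] along a radius needs an upper bound for |v
    c| only; v c may be arbitrarily close to 0. Rescaling to a fixed disc makes [M'] independent of
    c and r. *)
Theorem schottky (M : R) : exists M' : R, forall (v : C -> C) c (r : R), 0 < r ->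
  ramified_over1 v (ballC c r) -> nrm (v c) <= M ->
  forall z, nrm (z - c) <= r / 4 -> nrm (v z) <= M'.
Proof.
have p0 := two_pi_gt0 R; set p := pi *+ 2 in p0.
pose B := `|M| / p.
have B0 : 0 <= B by rewrite divr_ge0// ltW.
exists (expR (p * (expR (13 * 2) * (2 * B + 1)))) => v c r r0 [hv v0 v1] vM z zr.
have [L dL vL] := log_ball r0 hv v0.
have r2 : 0 < r / 2 by rewrite divr_gt0.
pose kap : C := rc p * cI R.
have kap0 : kap != 0 by rewrite mulf_neq0 ?cI_neq0// rc_eq0 gt_eqF.
(* The disc of radius r becomes the disc of radius 2 required by [landau], and the target point
   satisfies |x| <= 1/2. *)
pose pt (x : C) := c + rc (r / 2) * x.
have ptB x : nrm x < 2 -> nrm (pt x - c) < r.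
  move=> x2; rewrite /pt (addrC c) addrK nrmM nrm_rc gtr0_norm//.
  have : r / 2 * nrm x < r / 2 * 2 by rewrite ltr_pM2l.
  by rewrite divfK.
pose w x := L (pt x) / kap.
have dw x : nrm x < 2 -> cder w x (dv v (pt x) / v (pt x) * rc (r / 2) / kap).
  move=> /ptB xB.
  have hp : cder pt x (rc (r / 2)).
    by have := cderD (cder_cst c x) (cderZ (rc (r / 2)) (cder_id x)); rewrite add0r mulr1.
  have := cderZ (kap^-1) (cder_comp hp (dL _ xB)); rewrite mulrC.
  by under eq_fun do rewrite mulrC.
have wL x : L (pt x) = kap * w x by rewrite /w mulrC divfK.
have ReL x : cRe (L (pt x)) = p * (- cIm (w x)).
  by rewrite wL /kap !cReM !cImM cRe_rc cIm_rc /cI /cRe /cIm /=; ring.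
have hw x : nrm x < 2 -> hol_at w x by move=> x2; eexists; exact: dw.
have ram x k : nrm x < 2 -> w x = zc R k -> dv w x = 0.
  move=> x2 wk; rewrite (cder_dv (dw x x2)) v1 ?mul0r//; first exact: ptB.
  rewrite (vL _ (ptB x x2)) wL wk /cexp /kap /zc.
  rewrite !cReM !cImM !cRe_rc !cIm_rc /cI /cRe /cIm /= !(mulr0, mul0r, mulr1, subr0, addr0, add0r, oppr0).
  by rewrite expR0 cis_intr mulr1.
have LB := landau hw ram.
pose x1 := (z - c) / rc (r / 2).
have x1n : nrm x1 <= 2^-1.
  rewrite nrmM nrmV nrm_rc gtr0_norm// ler_pdivrMr//.
  by rewrite (_ : 2^-1 * (r / 2) = r / 4)//; field.
have ptx : pt x1 = z by rewrite /pt /x1 mulrC divfK ?rc_eq0 ?gt_eqF// addrC subrK.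
have pt0 : pt 0 = c by rewrite /pt mulr0 addr0.
have zB : nrm (z - c) < r by lra.
have cB : nrm (c - c) < r by rewrite subrr nrm0.
rewrite (vL z zB) nrm_cexp ler_expR -ptx ReL ler_pM2l//.
have sg t : 0 <= t <= 1 -> nrm (rc t * x1) <= 2^-1.
  by move=> /andP[t0 t1]; rewrite nrmM nrm_rc ger0_norm//; apply: le_trans x1n; rewrite ler_piMl ?nrm_ge0.
have := @gronwall R (fun t => - cIm (w (rc t * x1))) (fun t => - cIm (dv w (rc t * x1) * x1)) 2 B
  ltac:(lra) B0.
rewrite rc1 rc0 mul1r mul0r; apply=> [t t01|t t01|].
- have h := sg t t01.
  have hp : pder (fun t => rc t * x1) t x1.
    have -> : (fun t => rc t * x1) = (fun t => x1 * rc t) by apply/funext => u; rewrite mulrC.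
    by have := pderZ x1 (pder_rc t); rewrite mulr1.
  have := pder_Im (pderZ (-1) (cder_pder (hol_cder (hw (rc t * x1) ltac:(lra))) hp)).
  rewrite mulN1r cImN; under eq_fun do rewrite mulN1r cImN; by [].
(* Along the radius 1 - |x|^2 >= 3/4 and |x1| <= 1/2, so the speed is at most 4/3 (|Im w| + 12),
   within K = 2. *)
- have h := sg t t01; have := LB (rc t * x1) ltac:(lra).
  set N := nrm (dv w _); set Y := cIm (w _) => h1.
  apply: le_trans (ler_norm _) _; rewrite normrN; apply: le_trans (nrm_Im _) _; rewrite nrmM -/N.
  rewrite normrN.
  have N0 : 0 <= N by exact: nrm_ge0.
  have q : nrm (rc t * x1) ^+ 2 <= 4^-1.
    by rewrite (_ : 4^-1 = 2^-1 ^+ 2) ?lerXn2r ?nnegrE ?nrm_ge0//; field.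
  have h2 : N * (3 / 4) <= N * (1 - nrm (rc t * x1) ^+ 2) by rewrite ler_wpM2l//; lra.
  have h3 : N * nrm x1 <= N * 2^-1 by rewrite ler_wpM2l.
  have := normr_ge0 Y; lra.
- rewrite /B ler_pdivlMr// mulrC -ReL pt0 -ler_expR -nrm_cexp -(vL c cB).
  apply: le_trans vM _; apply: le_trans (ler_norm _) _; apply: le_trans (expR_ge1Dx _); lra.
Qed.
End Schottky.

(** * Punctured discs in logarithmic coordinates *)

Section LogCoordinates.
Variable R : realType.
Local Notation C := (Cplx R).
Implicit Types (z a : C) (v : C -> C) (r rho : R).

Definition pballC a r : set C := [set z | 0 < nrm (z - a) < r].

Lemma ramified_log v a r x (l : R) : ramified_over1 v (pballC a r) -> expR (cRe x + l) <= r ->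
  ramified_over1 (fun u => v (a + cexp u)) (ballC x l).
Proof.
move=> [hv v0 v1] xr.
have inP u : ballC x l u -> pballC a r (a + cexp u).
  rewrite /ballC /pballC /= => ux; rewrite (addrC a) addrK nrm_cexp expR_gt0 /=.
  apply: lt_le_trans xr; rewrite ltr_expR.
  by have := nrm_Re (u - x); rewrite cReB => h; have := ler_norm (cRe u - cRe x); lra.
have dvV u : ballC x l u -> cder (fun u => v (a + cexp u)) u (dv v (a + cexp u) * cexp u).
  move=> ux; apply: (cder_comp (f := fun u => a + cexp u)).
    by have := cderD (cder_cst a u) (cder_cexp u); rewrite add0r.
  by apply: hol_cder; apply: hv; exact: inP.
split=> u ux.
- by eexists; exact: dvV.
- by apply: v0; exact: inP.
- by move=> vu; rewrite (cder_dv (dvV u ux)) v1 ?mul0r//; exact: inP.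
Qed.

Lemma circle_arg z1 z2 a rho : 0 < rho -> nrm (z1 - a) = rho -> nrm (z2 - a) = rho ->
  exists x1 x2 : C, [/\ a + cexp x1 = z1, a + cexp x2 = z2, nrm (x2 - x1) <= pi & expR (cRe x1) = rho].
Proof.
move=> rho0 h1 h2.
have n1 : z1 - a != 0 by rewrite -nrm_gt0 h1.
have n2 : z2 - a != 0 by rewrite -nrm_gt0 h2.
have [x1 H1] := cexp_surj n1.
have q0 : (z2 - a) / (z1 - a) != 0 by rewrite mulf_neq0// invr_eq0.
have [t tpi] := polar q0; rewrite nrmM nrmV h1 h2 divff ?gt_eqF// rc1 mul1r => Ht.
exists x1, (x1 + mkC 0 t); split.
- by rewrite H1 addrC subrK.
- by rewrite cexpD H1 /cexp cRe_mk cIm_mk expR0 rc1 mul1r Ht mulrC divfK// addrC subrK.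
- rewrite (addrC x1) addrK; apply: le_trans (nrm_le _) _.
  by rewrite cRe_mk cIm_mk normr0 add0r.
- by rewrite -nrm_cexp H1.
Qed.

Lemma pi_le4 : pi <= 4 :> R.
Proof. by have := pihalf_lt2 R; lra. Qed.

(** Two points of one circle have logarithms at distance at most pi, below 16 / 4, so one use of
    [schottky] on a disc of radius 16 reaches the whole circle. *)
Lemma circle_bound (M : R) : exists M' : R, forall v a r rho z1 z2,
  ramified_over1 v (pballC a r) -> 0 < rho -> rho * expR 16 <= r ->
  nrm (z1 - a) = rho -> nrm (z2 - a) = rho -> nrm (v z1) <= M -> nrm (v z2) <= M'.
Proof.
have [M' HM'] := schottky M; exists M' => v a r rho z1 z2 rv rho0 rr h1 h2 vM.
have [x1 [x2 [E1 E2 x12 ex]]] := circle_arg rho0 h1 h2.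
rewrite -E2; apply: (HM' (fun u => v (a + cexp u)) x1 16) => //.
- by apply: ramified_log rv _; rewrite expRD ex.
- by rewrite E1.
- by apply: le_trans x12 _; have := pi_le4; lra.
Qed.

(* If [v] has a zero at [a] only, the circles on which [|v|] reaches 1/2 are mapped to small loops
   near a point at distance 1/2 from [v a = 0], against the maximum principle. *)
Lemma circle_zero : exists2 l : R, 0 < l & forall v a r rho,
  ramified_over1 v (pballC a r) -> hol_at v a -> v a = 0 -> 0 < rho -> rho * expR l <= r ->
  exists2 z, nrm (z - a) = rho & nrm (v z) <= 2^-1.
Proof.
have [M HM] := schottky (1 : R).
(* Where |v| <= |M| on the logarithmic disc of radius l / 4, an increment over distance 4 is at most
   4 * 2 |M| / (l / 4) = 32 |M| / l <= 1/4. *)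
pose l := 16 + 128 * `|M|.
have l16 : 16 <= l by rewrite /l; have := normr_ge0 M; lra.
exists l; first by lra.
move=> v a r rho rv ha va rho0 rr; apply: contrapT => nex.
have r_lt : rho < r.
  apply: lt_le_trans rr; rewrite -{1}(mulr1 rho) ltr_pM2l// -expR0 ltr_expR; lra.
have big z : nrm (z - a) = rho -> 2^-1 < nrm (v z).
  by move=> zr; rewrite ltNge; apply/negP => h; apply: nex; exists z.
have [hv v0 v1] := rv.
have hol z : nrm (z - a) <= rho -> hol_at v z.
  move=> zr; have [->//|za] := eqVneq z a.
  by apply: hv; rewrite /pballC /= nrm_sub_gt0 za; lra.
pose p (t : R) := a + rc t.
(* |v| along a radius, rising from 0 at the centre to above 1/2 on the circle; an intermediate value
   gives a point [z1] with |v z1| = 1/2. *)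
pose q (t : R) := nrm (v (p (clamp (t / rho) * rho))).
have cint01 t : 0 <= clamp t * rho <= rho.
  have /andP[c0 c1] := clamp_itv t; rewrite mulr_ge0 ?(ltW rho0)//= ler_piMl//; exact: ltW.
have cq : {within `[0, rho], continuous q}.
  apply: continuous_subspaceT => t; apply/cvgrPdist_lt => e e0.
  have pin : nrm (p (clamp (t / rho) * rho) - a) <= rho.
    have /andP[k0 k1] := cint01 (t / rho).
    by rewrite /p (addrC a) addrK nrm_rc ger0_norm.
  have [d d0 Hd] := hol_cont (hol _ pin) e0.
  apply/nbhs_ballP; exists d => // s; rewrite /ball_ /= => ts.
  apply: le_lt_trans (nrm_dist _ _) _; rewrite nrmC; apply: Hd.
  rewrite /p opprD addrACA subrr add0r -rcB nrm_rc -mulrBl normrM (gtr0_norm rho0).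
  rewrite distrC in ts; apply: le_lt_trans ts.
  apply: le_trans (ler_wpM2r (ltW rho0) (clamp_lip _ _)) _.
  by rewrite -mulrBl normrM normfV (gtr0_norm rho0) divfK// gt_eqF.
have q0 : q 0 = 0 by rewrite /q mul0r clamp_id ?lexx ?ler01// mul0r /p rc0 addr0 va nrm0.
have q1 : 2^-1 < q rho.
  rewrite /q divff ?gt_eqF// clamp_id ?lexx ?ler01// mul1r; apply: big.
  by rewrite /p (addrC a) addrK nrm_rc gtr0_norm.
have [|t tin qt] := IVT (ltW rho0) cq (v := 2^-1).
  by rewrite q0; apply/andP; split; [rewrite ge_min invr_ge0 ler0n|rewrite le_max (ltW q1) orbT].
pose s := clamp (t / rho) * rho.
have /andP[s0 s1] : 0 <= s <= rho by exact: cint01.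
pose z1 := p s.
have vz1 : nrm (v z1) = 2^-1 by exact: qt.
have z1s : nrm (z1 - a) = s by rewrite /z1 /p (addrC a) addrK nrm_rc ger0_norm.
have sp : 0 < s.
  rewrite lt_def s0 andbT; apply/eqP => h; move: vz1; rewrite /z1 h /p rc0 addr0 va nrm0 => /esym/eqP.
  by rewrite invr_eq0 pnatr_eq0.
have close z : nrm (z - a) = s -> nrm (v z - v z1) <= 4^-1.
  move=> zs; have [x1 [x2 [E1 E2 x12 ex]]] := circle_arg sp z1s zs.
  have rV : ramified_over1 (fun u => v (a + cexp u)) (ballC x1 l).
    apply: ramified_log rv _; rewrite expRD ex; apply: le_trans rr.
    by rewrite ler_wpM2r// ltW// expR_gt0.
  have l0 : 0 < l by lra.
  have bV u : nrm (u - x1) <= l / 4 -> nrm (v (a + cexp u)) <= `|M|.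
    move=> ux; apply: le_trans (ler_norm M); apply: (HM _ x1 l l0 rV) => //.
    by rewrite E1 vz1; lra.
  have [hV _ _] := rV.
  have := @lip_bound R (fun u => v (a + cexp u)) x1 (l / 4) `|M| ltac:(by rewrite divr_gt0).
  rewrite /= E1 => H; have pi4 := pi_le4.
  have := H _ bV x2; rewrite E2 => {}H.
  apply: le_trans (H _ _) _; [by move=> u ux; apply: hV; rewrite /ballC /=; lra|by lra|].
  have M0 := normr_ge0 M.
  have h1 : (`|M| + `|M|) / (l / 4) * nrm (x2 - x1) <= (`|M| + `|M|) / (l / 4) * 4.
    by rewrite ler_wpM2l//; [rewrite divr_ge0//; lra|lra].
  apply: le_trans h1 _; rewrite mulrAC ler_pdivrMr ?divr_gt0//; rewrite /l; lra.
(* v - v z1 is at most 1/4 on the circle through [z1], but has modulus 1/2 at the centre. *)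
have := @max_modulus R (fun z => v z - v z1) a s 4^-1 sp.
have aa : nrm (a - a) <= s by rewrite subrr nrm0.
move=> /(_ _ close a aa); rewrite va sub0r nrmN vz1 => h.
have : (2^-1 : R) <= 4^-1; last by lra.
apply: h => z zs; apply: holB; last exact: hol_cst.
by apply: hol; lra.
Qed.
End LogCoordinates.

(** * Spreading bounds over the domain *)

Section Spreading.
Variable R : realType.
Local Notation C := (Cplx R).
Implicit Types (z a b : C) (r rho : R).

Lemma connected_spread (D G : set C) : domain D -> (exists2 b, D b & G b) ->
  (forall b, D b -> G b -> exists2 d : R, 0 < d & forall z, nrm (z - b) < d -> D z -> G z) ->
  (forall a, D a -> (forall d : R, 0 < d -> exists b, [/\ D b, G b & nrm (b - a) < d]) -> G a) ->
  forall a, D a -> G a.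
Proof.
move=> [_ oD cD] [b0 Db0 Gb0] Gopen Gclosed.
pose A := [set z | D z /\ G z].
suff AD : A = D by move=> a Da; have : A a by [rewrite AD]; case.
have oA : open A.
  apply/open_nrm => z [Dz Gz]; have [d d0 Hd] := Gopen z Dz Gz; have [s s0 Hs] := ball_in oD Dz.
  exists (Num.min d s) => [|w]; first by rewrite lt_min d0.
  by rewrite lt_min => /andP[wd /Hs Dw]; split => //; exact: Hd.
apply: cD.
- by exists b0.
- by exists A => //; rewrite eqEsubset; split=> b [] // Db Ab.
- exists (closure A); first exact: closed_closure.
  rewrite eqEsubset; split=> [b Ab|b [Db cb]].
    by split; [case: Ab|exact: subset_closure].
  split=> //; apply: Gclosed => // d d0.
  have /cb[u [[Du Gu] ud]] : nbhs b [set u : C | nrm (u - b) < d].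
    by apply/nbhs_nrm; exists d.
  by exists u.
Qed.

Variables (D : set C) (psi f0 : C -> C) (m : nat).
Hypothesis D_dom : domain D.
Hypothesis psi_hol : hol_on D psi.
Hypothesis psi_zeros : forall z, D z -> psi z = 0 -> multiplicity_le psi z m.
Hypothesis f0_hol : hol_on D f0.
Hypothesis f0_neq : exists2 z, D z & f0 z != psi z.

(* Members of the family, seen through their common set of [psi]-points, that of [f0]. *)
Definition member (f : C -> C) :=
  [/\ hol_on D f,
      forall z, D z -> f z = 0 -> multiplicity_ge f z (2 * (m + 1))%N &
      forall z, D z -> (f z = psi z <-> f0 z = psi z)].

Definition good a r p (psi1 : C -> C) (c : R) :=
  [/\ 0 < r /\ 0 < c, forall z, nrm (z - a) < r -> D z,
      forall z, 0 < nrm (z - a) < r -> psi z != 0 /\ f0 z != psi z,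
      hol_on D psi1 /\ (forall z, psi z = (z - a) ^+ p * psi1 z) &
      (forall z, nrm (z - a) < r -> c <= nrm (psi1 z)) /\ (psi a = 0 -> (p <= m)%N)].

Lemma good_exists a : D a -> exists r p psi1 c, good a r p psi1 c.
Proof.
move=> Da; have [_ oD _] := D_dom.
have [p [psi1 [h1 pE p1 pm]]] : exists p psi1, [/\ hol_on D psi1, forall z, psi z = (z - a) ^+ p * psi1 z,
    psi1 a != 0 & psi a = 0 -> (p <= m)%N].
  have [pa|pa] := eqVneq (psi a) 0.
    have [k [g [km hg gE ga]]] := multiplicity_le_order oD Da psi_hol (psi_zeros Da pa).
    by exists k, g; split.
  by exists 0%N, psi; split=> // z; rewrite expr0 mul1r.
have [r1 r10 H1] := ball_in oD Da.
have hd : hol_on D (fun z => f0 z - psi z).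
  by move=> z Dz; apply: holB; [exact: f0_hol|exact: psi_hol].
have [|r2 r20 H2] := finite_order_isolated Da oD (identity_theorem D_dom hd _ Da).
  by have [z Dz fz] := f0_neq; exists z => //; rewrite subr_eq0.
have c0 : 0 < nrm (psi1 a) / 2 by rewrite divr_gt0// nrm_gt0.
have [r3 r30 H3] := hol_cont (h1 a Da) c0.
exists (Num.min r1 (Num.min r2 r3)), p, psi1, (nrm (psi1 a) / 2).
have low z : nrm (z - a) < r3 -> nrm (psi1 a) / 2 <= nrm (psi1 z).
  by move=> /H3; have := nrmBl (psi1 a) (psi1 z); rewrite nrmC; lra.
split => //.
- by rewrite !lt_min r10 r20 r30.
- by move=> z; rewrite !lt_min => /andP[/H1].
- move=> z /andP[z0]; rewrite !lt_min => /and3P[_ z2 z3]; split.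
    rewrite pE mulf_neq0 ?expf_neq0 -?nrm_gt0//.
    by apply: lt_le_trans (low z z3).
  by rewrite -subr_eq0; apply: H2; rewrite z0.
- by split=> // z; rewrite !lt_min => /and3P[_ _ /low].
Qed.

Definition vq (f : C -> C) z := 1 - f z / psi z.

Lemma vq_f f z : psi z != 0 -> f z - psi z = - (psi z * vq f z).
Proof. by move=> pz; rewrite /vq mulrBr mulr1 (mulrC (psi z)) divfK// opprB. Qed.

(** v = 1 means f = 0; the multiplicity there is at least 2, so f' = 0 as well, and the derivative
    of f / psi vanishes. *)
Lemma vq_ramified f a r p psi1 c : member f -> good a r p psi1 c ->
  ramified_over1 (vq f) (pballC a r).
Proof.
move=> [hf f_zeros fsh] [[r0 c0] inD pn _ _].
have inD' z : pballC a r z -> D z by rewrite /pballC /= => /andP[_]; exact: inD.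
have dvv z : pballC a r z -> cder (vq f) z (0 - (dv f z * psi z - f z * dv psi z) / psi z ^+ 2).
  move=> /[dup] /inD' Dz /pn[pz _]; apply: cderB; first exact: cder_cst.
  by apply: cder_div => //; apply: hol_cder; [exact: hf|exact: psi_hol].
split=> z zP.
- by eexists; exact: dvv.
- have [pz fz] := pn z zP; apply/eqP => v0.
  have := vq_f f pz; rewrite v0 mulr0 oppr0 => /eqP; rewrite subr_eq0 => /eqP.
  by move=> /(fsh z (inD' z zP)) h; rewrite h eqxx in fz.
- move=> v1; have [pz fz] := pn z zP.
  have fz0 : f z = 0.
    have := vq_f f pz; rewrite v1 mulr1 => /eqP; rewrite subr_eq => /eqP ->.
    by rewrite addNr.
  have : derive1n 1 f z = 0.
    by apply: (f_zeros z (inD' z zP) fz0); rewrite addn1 mulnS.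
  by rewrite /derive1n /= -dvE (cder_dv (dvv z zP)) fz0 => ->; rewrite !mul0r subr0 mul0r subr0.
Qed.

Lemma vq_bound f z (K : R) : psi z != 0 -> nrm (f z) <= K -> nrm (vq f z) <= 1 + K / nrm (psi z).
Proof.
move=> pz fK; rewrite /vq; apply: le_trans (nrmB _ _) _; rewrite nrm1 lerD2l nrmM nrmV.
by rewrite ler_pM2r// invr_gt0 nrm_gt0.
Qed.

Lemma f_bound f z (K P : R) : psi z != 0 -> nrm (vq f z) <= K -> nrm (psi z) <= P ->
  nrm (f z) <= P * (1 + K).
Proof.
move=> pz vK pP; rewrite (_ : f z = psi z * (1 - vq f z)); last first.
  by rewrite /vq subKr mulrC divfK.
rewrite nrmM; apply: ler_pM; rewrite ?nrm_ge0//.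
by apply: le_trans (nrmB _ _) _; rewrite nrm1 lerD2l.
Qed.

Lemma good_psi_bound a r p psi1 c rho : good a r p psi1 c -> 0 < rho -> rho < r ->
  exists P : R, forall z, nrm (z - a) <= rho -> nrm (psi z) <= P.
Proof.
move=> [[r0 c0] inD _ _ _] rho0 rr; apply: cball_bounded; first exact: ltW.
by move=> z zr; apply: hol_cont; apply: psi_hol; apply: inD; lra.
Qed.

Lemma expR_room (rho l r : R) : 0 < rho -> 0 < l -> rho * expR l <= r -> rho < r.
Proof.
move=> rho0 l0; apply: lt_le_trans; rewrite -{1}(mulr1 rho) ltr_pM2l// -expR0 ltr_expR; lra.
Qed.

(** Dividing by [psi] is safe on the circle but maybe not at [a], so v is bounded on the circle and
    the maximum principle is applied to f itself. *)
Lemma bounded_spread a r p psi1 c b rho (K : R) : good a r p psi1 c ->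
  nrm (b - a) = rho -> 0 < rho -> rho * expR 16 <= r ->
  exists M : R, forall f, member f -> nrm (f b) <= K -> forall z, nrm (z - a) <= rho -> nrm (f z) <= M.
Proof.
move=> gd br rho0 rr; have rr' := expR_room rho0 (ltr0Sn _ 15) rr.
have [P HP] := good_psi_bound gd rho0 rr'.
have [M' HM'] := circle_bound (1 + K / nrm (psi b)).
have [[r0 c0] inD pn _ _] := gd.
exists (P * (1 + M')) => f mf fK.
have [hf _ _] := mf.
apply: max_modulus => // z zr.
  by apply: hf; apply: inD; lra.
have [pz _] := pn z ltac:(by rewrite zr rho0).
have [pb _] := pn b ltac:(by rewrite br rho0).
apply: f_bound => //; last by apply: HP; rewrite zr.
by apply: (HM' (vq f) a r rho b z (vq_ramified mf gd)) => //; exact: vq_bound.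
Qed.

Lemma min_modulus f a rho (K : R) : 0 < rho -> 0 < K -> (forall z, nrm (z - a) <= rho -> hol_at f z) ->
  (forall z, nrm (z - a) <= rho -> f z != 0) -> (forall z, nrm (z - a) = rho -> K <= nrm (f z)) ->
  forall z, nrm (z - a) <= rho -> K <= nrm (f z).
Proof.
move=> rho0 K0 hf f0' fK z zr.
have := @max_modulus R (fun z => (f z)^-1) a rho K^-1 rho0.
move=> /(_ _ _ z zr); rewrite nrmV lef_pV2 ?posrE ?nrm_gt0 ?f0'//; apply.
  by move=> u ur; apply: holV; [exact: hf|exact: f0'].
by move=> u ur; rewrite nrmV lef_pV2 ?posrE ?nrm_gt0 ?f0' ?ur// fK.
Qed.

(** The threshold [K] is the same for all members. In the two cases where the centre is a common
    [psi]-point the conclusion comes from a contradiction: a value at the centre is too small for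
    the size on the circle. *)
Lemma infinite_spread : exists2 l : R, 0 < l & forall a r p psi1 c b rho (B : R), good a r p psi1 c ->
  nrm (b - a) = rho -> 0 < rho -> rho * expR l <= r ->
  exists K : R, forall f, member f -> K < nrm (f b) -> forall z, nrm (z - a) <= rho -> B <= nrm (f z).
Proof.
have [l0 l00 Hl0] := circle_zero R.
(* Room e^16 for [circle_bound] and e^l0 for [circle_zero]. *)
exists (16 + l0); first by lra.
move=> a r p psi1 c b rho B gd br rho0 rr.
have rr16 : rho * expR 16 <= r.
  by apply: le_trans rr; rewrite ler_pM2l// ler_expR; lra.
have rrl : rho * expR l0 <= r.
  by apply: le_trans rr; rewrite ler_pM2l// ler_expR; lra.
have rr' := expR_room rho0 (ltr0Sn _ 15) rr16.
have [P HP] := good_psi_bound gd rho0 rr'.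
have [[r0 c0] inD pn [hpsi1 psiE] [plow pm]] := gd.
have [_ oD _] := D_dom.
have Da : D a by apply: inD; rewrite subrr nrm0.
have rp0 : 0 < rho ^+ p by rewrite exprn_gt0.
have P0 : 0 <= P by apply: le_trans (HP a _); rewrite ?nrm_ge0// subrr nrm0 ltW.
(* the size [L] of [vq f] on the circle that makes all three cases work *)
pose L := 1 + (`|B| + P) / (c * rho ^+ p) + nrm (psi1 a) / c.
have L1 : 1 <= L.
  rewrite /L -addrA lerDl addr_ge0// divr_ge0 ?addr_ge0 ?mulr_ge0 ?nrm_ge0//; exact: ltW.
have cL1 : nrm (psi1 a) + c <= c * L.
  rewrite /L !mulrDr mulr1 (mulrC c (nrm _ / c)) divfK ?gt_eqF//.
  have : 0 <= c * ((`|B| + P) / (c * rho ^+ p)).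
    by rewrite mulr_ge0 ?divr_ge0 ?addr_ge0 ?mulr_ge0//; exact: ltW.
  lra.
have cL2 : `|B| + P <= c * rho ^+ p * L.
  have cp0 : 0 < c * rho ^+ p by rewrite mulr_gt0.
  rewrite /L !mulrDr (mulrC _ (_ / (c * rho ^+ p))) divfK ?gt_eqF//.
  have h1 : 0 <= c * rho ^+ p * 1 by rewrite mulr1 ltW.
  have h2 : 0 <= c * rho ^+ p * (nrm (psi1 a) / c).
    by rewrite mulr_ge0 ?divr_ge0 ?nrm_ge0 ?(ltW c0)// ltW.
  lra.
have [M' HM'] := circle_bound L.
exists (nrm (psi b) * (1 + M')) => f mf fb.
have rv := vq_ramified mf gd; have [hf f_zeros fsh] := mf.
have [pb _] := pn b ltac:(by rewrite br rho0).
(* Contrapositive of [circle_bound]: one point of the circle with |v| <= L would bound v b, hence f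
   b. *)
have vbig z : nrm (z - a) = rho -> L < nrm (vq f z).
  move=> zr; rewrite ltNge; apply/negP => vL.
  have := HM' (vq f) a r rho z b rv rho0 rr16 zr br vL => vb.
  by move: fb; rewrite ltNge (f_bound pb vb (lexx _)).
have hdiff z : nrm (z - a) <= rho -> hol_at (fun z => f z - psi z) z.
  by move=> zr; apply: holB; [apply: hf|apply: psi_hol]; apply: inD; lra.
have dbig z : nrm (z - a) = rho -> c * rho ^+ p * L <= nrm (f z - psi z).
  move=> zr; have [pz _] := pn z ltac:(by rewrite zr rho0).
  rewrite (vq_f f pz) nrmN nrmM psiE nrmM nrmX zr (mulrC c).
  apply: ler_pM; rewrite ?mulr_ge0 ?(ltW rp0) ?(ltW c0)//; [by lra| |exact: ltW (vbig z zr)].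
  by rewrite ler_pM2l// plow// zr.
have dn0 z : 0 < nrm (z - a) <= rho -> f z - psi z != 0.
  move=> /andP[z0 zr]; have [_ fz] := pn z ltac:(by rewrite z0; lra).
  rewrite subr_eq0; apply/eqP => h; move: fz.
  by rewrite (fsh z (inD z ltac:(lra))).1 ?eqxx.
have [f0a|f0a] := eqVneq (f0 a) (psi a); last first.
  move=> z zr.
  have : c * rho ^+ p * L <= nrm (f z - psi z).
    apply: (@min_modulus (fun z => f z - psi z) a rho) => //.
      by rewrite !mulr_gt0//; lra.
    move=> u ur; have [->|ua] := eqVneq u a; last by apply: dn0; rewrite nrm_sub_gt0 ua.
    by rewrite subr_eq0; apply/eqP => /(fsh a Da) h; rewrite h eqxx in f0a.
  have := nrmB (f z) (psi z); have := HP z zr; have := ler_norm B; lra.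
have fa : f a = psi a by apply/(fsh a Da).
have [pa|pa] := eqVneq (psi a) 0; exfalso.
  have [g hg gE] := multiplicity_ge_vanishes oD Da hf (f_zeros a Da (etrans fa pa)).
  have pm' := pm pa.
  pose q := (2 * (m + 1) - p)%N.
  have qE : (2 * (m + 1) = p + q.-1.+1)%N.
    have pq : (p < 2 * (m + 1))%N by rewrite mul2n -addnn addn1 addSn ltnS (leq_trans pm')// leq_addr.
    by rewrite prednK /q ?subn_gt0// subnKC// ltnW.
  (* (f - psi) / (z - a)^p with the singularity removed. The positive exponent leaves k a = - psi1
     a, the same for all members, and [cL1] makes this smaller than c L. *)
  pose k z := (z - a) ^+ q.-1.+1 * g z - psi1 z.
  have kE z : f z - psi z = (z - a) ^+ p * k z.
    by rewrite gE psiE qE exprD /k; ring.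
  have hk z : nrm (z - a) <= rho -> hol_at k z.
    move=> zr; have Dz : D z by apply: inD; lra.
    apply: holB; last exact: hpsi1.
    by apply: holM; [apply: holX; apply: holB; [exact: hol_id|exact: hol_cst]|exact: hg].
  have ka : nrm (k a) = nrm (psi1 a).
    by rewrite /k subrr exprS !mul0r sub0r nrmN.
  have p1a : 0 < nrm (psi1 a).
    by apply: lt_le_trans (plow a _) => //; rewrite subrr nrm0.
  have : c * L <= nrm (k a).
    apply: (@min_modulus k a rho); rewrite ?subrr ?nrm0 ?(ltW rho0)//.
    - by rewrite mulr_gt0//; lra.
    - move=> u ur; have [->|ua] := eqVneq u a; first by rewrite -nrm_gt0 ka.
      have := dn0 u ltac:(by rewrite nrm_sub_gt0 ua).
      by rewrite kE mulf_eq0 negb_or => /andP[].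
    - move=> u ur; have := dbig u ur; rewrite kE nrmM nrmX ur (mulrC c) -mulrA.
      by rewrite ler_pM2l.
  by rewrite ka; lra.
have hva : hol_at (vq f) a.
  apply: holB; first exact: hol_cst.
  by apply: hol_div => //; [exact: hf|exact: psi_hol].
have va : vq f a = 0 by rewrite /vq fa divff// subrr.
have [z zr vz] := Hl0 (vq f) a r rho rv hva va rho0 rrl.
by have := vbig z zr; lra.
Qed.
End Spreading.

(** * Montel's theorem and the spherical distance *)

Section Montel.
Variable R : realType.
Local Notation C := (Cplx R).
Implicit Types (z a : C) (D K : set C).

Lemma extract (P : nat -> nat -> Prop) : (forall j N, exists2 n, (N <= n)%N & P j n) ->
  exists phi : nat -> nat, (forall i j, (i < j)%N -> (phi i < phi j)%N) /\ forall j, P j (phi j).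
Proof.
move=> H.
have /choice[nxt Hn] : forall jN : nat * nat, exists n, (jN.2 <= n)%N /\ P jN.1 n.
  by move=> [j N]; have [n h1 h2] := H j N; exists n.
pose phi := fix phi j := if j is i.+1 then nxt (i.+1, (phi i).+1) else nxt (0%N, 0%N).
have step j : (phi j < phi j.+1)%N by have [] := Hn (j.+1, (phi j).+1).
exists phi; split=> [i j|[|j]]; last 2 first.
- by have [] := Hn (0%N, 0%N).
- by have [] := Hn (j.+1, (phi j).+1).
elim: j => // j IH; rewrite ltnS leq_eqVlt => /orP[/eqP ->//|/IH h].
exact: ltn_trans h (step j).
Qed.

(** Along an ultrafilter bounded sequences converge at all points simultaneously, so no diagonal
    extraction is required. *)
Lemma ultra_limit (U : set_system nat) (x : nat -> C) (M : R) : UltraFilter U ->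
  (forall n, nrm (x n) <= M) ->
  exists l : C, forall e : R, 0 < e -> U [set n | nrm (x n - l) < e].
Proof.
move=> UU xM.
have [|l [_ lc]] := @compact_cball R 0 M (x @ U) _.
  suff : U [set n | nrm (x n - 0) <= M] by [].
  by apply: filterE => n /=; rewrite subr0.
exists l => e e0.
have [//|nU] := in_ultra_setVsetC [set n | nrm (x n - l) < e] UU.
have [||y [yl yn]] := lc (~` [set z : C | nrm (z - l) < e]) [set z : C | nrm (z - l) < e].
- exact: nU.
- by apply/nbhs_nrm; exists e.
- by exfalso; apply: yl.
Qed.

(** Stated for any filter of indices, as it serves both the ultrafilter of [montel] and the tails of
    a sequence. *)
Lemma compact_uniform (I : Type) (F : set_system I) (P : I -> C -> Prop) K : Filter F -> compact K ->
  (forall a, K a -> exists2 d : R, 0 < d & F [set i | forall z, nrm (z - a) < d -> P i z]) ->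
  F [set i | forall z, K z -> P i z].
Proof.
move=> FF /compact_near_coveringP cK H; apply: (cK I F P FF) => a /H[d d0 Fd].
exists ([set z : C | nrm (z - a) < d], [set i | forall z, nrm (z - a) < d -> P i z]) => /=.
  by split => //; apply/nbhs_nrm; exists d.
by move=> [z i] /= [zd Hi]; exact: Hi.
Qed.

(** The usual compact exhaustion; the distance to the complement is quantified pointwise, so the
    condition is vacuous when [D] is the whole plane. *)
Definition exhaust D (j : nat) : set C :=
  [set z | nrm z <= j%:R /\ forall y, ~ D y -> j.+1%:R^-1 <= nrm (z - y)].

Lemma compact_exhaust D j : compact (exhaust D j).
Proof.
apply: (subclosed_compact _ (@compact_cball R 0 j%:R)); last by move=> z [zj _] /=; rewrite subr0.
rewrite -[X in closed X]setCK; apply: open_closedC; apply/open_nrm => z nz.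
have [zj|zj] := leP (nrm z) j%:R; last first.
  exists (nrm z - j%:R) => [|w wz [wj _]]; first by rewrite subr_gt0.
  by have := nrmBl z w; rewrite nrmC; lra.
have [y [Dy yz]] : exists y, ~ D y /\ nrm (z - y) < j.+1%:R^-1.
  apply: contrapT => nex; apply: nz; split=> // y Dy; rewrite leNgt; apply/negP => h.
  by apply: nex; exists y.
exists (j.+1%:R^-1 - nrm (z - y)) => [|w wz [_ /(_ y Dy)]]; first by rewrite subr_gt0.
by have := nrm_tri w z y; move: wz; move: (j.+1%:R^-1 : R) => k; lra.
Qed.

Lemma exhaust_sub D j : exhaust D j `<=` D.
Proof.
move=> z [_ H]; apply: contrapT => /H; rewrite subrr nrm0 leNgt invr_gt0 ltr0n//.
Qed.

Lemma nat_ge (x : R) : exists N : nat, x <= N%:R.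
Proof. by exists (Num.truncn x).+1; apply/ltW/truncnS_gt. Qed.

Lemma small_inv (e : R) : 0 < e -> exists N : nat, forall j, (N <= j)%N -> j.+1%:R^-1 < e.
Proof.
move=> e0; have [N HN] := nat_ge e^-1; exists N => j Nj.
rewrite -[e]invrK ltf_pV2 ?posrE ?invr_gt0 ?ltr0n//; apply: le_lt_trans HN _.
by rewrite ltr_nat ltnS.
Qed.

Lemma exhaust_compact D K : open D -> compact K -> K `<=` D ->
  exists N, forall j, (N <= j)%N -> K `<=` exhaust D j.
Proof.
move=> oD cK KD.
have [N _ H] : \oo [set j | forall z, K z -> exhaust D j z].
  apply: compact_uniform => // a /KD Da; have [r r0 Hr] := ball_in oD Da.
  exists (r / 2); first by rewrite divr_gt0.
  have [N1 HN1] := nat_ge (nrm a + r).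
  have [N2 HN2] := small_inv (divr_gt0 r0 (ltr0Sn R 1)).
  exists (maxn N1 N2) => // j /= jN z zr.
  have j1 : (N1 <= j)%N by rewrite (leq_trans _ jN)// leq_maxl.
  have j2 : (N2 <= j)%N by rewrite (leq_trans _ jN)// leq_maxr.
  split.
    apply: le_trans (_ : nrm a + r <= _); last by apply: le_trans HN1 _; rewrite ler_nat.
    by have := nrmD (z - a) a; rewrite subrK; lra.
  move=> y Dy; rewrite leNgt; apply/negP => zy; apply: Dy; apply: Hr.
  have := nrm_tri y z a; rewrite (nrmC y z); move: (HN2 j j2) zy.
  by move: (j.+1%:R^-1 : R) => k; lra.
by exists N => j jN z Kz; exact: H.
Qed.

(** Pointwise limits along one ultrafilter come first; uniform Taylor bounds make the limit
    holomorphic, and Lipschitz bounds make convergence uniform on compact sets. A subsequence is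
    selected only at the end, its j-th index being good on the j-th exhausting set. *)
Theorem montel D (g : nat -> C -> C) : open D -> (forall n, hol_on D (g n)) ->
  (forall a, D a -> exists (d M : R), 0 < d /\ forall n z, nrm (z - a) < d -> nrm (g n z) <= M) ->
  exists phi : nat -> nat, (forall i j, (i < j)%N -> (phi i < phi j)%N) /\
  exists2 l : C -> C, hol_on D l &
    forall K, compact K -> K `<=` D -> forall e : R, 0 < e ->
      exists N, forall n, (N <= n)%N -> forall z, K z -> nrm (g (phi n) z - l z) < e.
Proof.
move=> oD hg bd.
have [U [UU sU]] := ultraFilterLemma eventually_filter.
have FU : ProperFilter U := ultra_proper.
have data a : D a -> exists r M : R, [/\ 0 < r, forall z, nrm (z - a) <= r -> D z &
    forall n z, nrm (z - a) <= r -> nrm (g n z) <= M].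
  move=> Da; have [d [M [d0 HM]]] := bd a Da; have [r r0 Hr] := cball_in oD Da.
  exists (Num.min r (d / 2)), M; split.
  - by rewrite lt_min r0 divr_gt0.
  - by move=> z; rewrite le_min => /andP[/Hr].
  - by move=> n z; rewrite le_min => /andP[_ zd]; apply: HM; lra.
have /choice[l Hl] : forall z, exists l : C, D z -> forall e : R, 0 < e -> U [set n | nrm (g n z - l) < e].
  move=> z; have [Dz|nDz] := pselect (D z); last by exists 0.
  have [r [M [r0 _ HM]]] := data z Dz.
  have [l Hl] := @ultra_limit U (fun n => g n z) M UU (fun n => HM n z ltac:(by rewrite subrr nrm0 ltW)).
  by exists l.
have hl : hol_on D l.
  move=> a Da; have [r [M [r0 rD HM]]] := data a Da.
  have hr n z : nrm (z - a) <= r -> hol_at (g n) z by move=> /rD; exact: hg.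
  have M0 : 0 <= M by apply: le_trans (HM 0%N a _); rewrite ?nrm_ge0// subrr nrm0 ltW.
  have dvb n : nrm (dv (g n) a) <= (M + M) / r.
    by rewrite -quo_diag; apply: (quo_bound r0 (hr n) (HM n)); rewrite subrr nrm0 ltW.
  have [lam Hlam] := @ultra_limit U (fun n => dv (g n) a) ((M + M) / r) UU dvb.
  pose K := ((M + M) / r + (M + M) / r) / r.
  have K0 : 0 <= K by rewrite divr_ge0 ?(ltW r0)// addr_ge0// divr_ge0 ?addr_ge0 ?(ltW r0).
  have key z : nrm (z - a) <= r -> nrm (l z - l a - lam * (z - a)) <= K * nrm (z - a) ^+ 2.
    move=> zr; apply/ler_addgt0Pr => e e0.
    (* Two errors from the values and one, weighted by |z - a|, from the derivative add up to
       [e]. *)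
    pose k := 2 + nrm (z - a).
    have k0 : 0 < k by rewrite ltr_pwDl ?nrm_ge0.
    have ek : 0 < e / k by rewrite divr_gt0.
    have HU : U ([set n | nrm (g n z - l z) < e / k] `&` [set n | nrm (g n a - l a) < e / k]
       `&` [set n | nrm (dv (g n) a - lam) < e / k]).
      by apply: filterI; [apply: filterI; apply: Hl => //; exact: rD|exact: Hlam].
    have [n [[/= n1 n2] n3]] := filter_ex HU.
    have T := taylor2_bound r0 (hr n) (HM n) zr; rewrite -/K in T.
    rewrite (_ : _ - _ - _ = (g n z - g n a - dv (g n) a * (z - a)) - (g n z - l z) + (g n a - l a)
       + (dv (g n) a - lam) * (z - a)); last by ring.
    apply: le_trans (nrmD _ _) _; rewrite nrmM.
    apply: le_trans (lerD (nrmD _ _) (lexx _)) _.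
    apply: le_trans (lerD (lerD (nrmB _ _) (lexx _)) (lexx _)) _.
    have h3 : nrm (dv (g n) a - lam) * nrm (z - a) <= e / k * nrm (z - a).
      by rewrite ler_wpM2r ?nrm_ge0// ltW.
    have -> : e = e / k * 2 + e / k * nrm (z - a) by rewrite -mulrDr -/k divfK// gt_eqF.
    lra.
  exists lam => e e0; exists (Num.min r (e / (K + 1))).
    by rewrite lt_min r0 divr_gt0// ltr_wpDl.
  move=> z; rewrite lt_min => /andP[zr]; rewrite ltr_pdivlMr ?ltr_wpDl// => ze.
  apply: le_trans (key z (ltW zr)) _; rewrite expr2 mulrA ler_wpM2r ?nrm_ge0//.
  by apply: le_trans (ltW ze); rewrite mulrC ler_wpM2l ?nrm_ge0// lerDl.
have unif K : compact K -> K `<=` D -> forall e : R, 0 < e ->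
    U [set n | forall z, K z -> nrm (g n z - l z) < e].
  move=> cK KD e e0; apply: compact_uniform => // a /KD Da.
  have [r [M [r0 rD HM]]] := data a Da.
  have e3 : 0 < e / 3 by rewrite divr_gt0.
  have [d d0 Hd] := hol_cont (hl a Da) e3.
  have hr n z : nrm (z - a) <= r -> hol_at (g n) z by move=> /rD; exact: hg.
  have M0 : 0 <= M by apply: le_trans (HM 0%N a _); rewrite ?nrm_ge0// subrr nrm0 ltW.
  pose L := (M + M) / r.
  have L0 : 0 <= L by rewrite divr_ge0 ?(ltW r0)// addr_ge0.
  exists (Num.min r (Num.min d (e / 3 / (L + 1)))).
    by rewrite !lt_min r0 d0 divr_gt0// ltr_wpDl.
  apply: filterS (Hl a Da _ e3) => n /= na z; rewrite !lt_min => /and3P[zr /Hd zd].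
  rewrite ltr_pdivlMr ?ltr_wpDl// => zL.
  have lipn := lip_bound r0 (hr n) (HM n) (ltW zr); rewrite -/L in lipn.
  rewrite (_ : _ - _ = (g n z - g n a) + (g n a - l a) - (l z - l a)); last by ring.
  apply: le_lt_trans (nrmB _ _) _; apply: le_lt_trans (lerD (nrmD _ _) (lexx _)) _.
  have := nrm_ge0 (z - a); lra.
have [|phi [incr Hphi]] := @extract (fun j n => forall z, exhaust D j z -> nrm (g n z - l z) < j.+1%:R^-1).
  move=> j N.
  have j0 : 0 < j.+1%:R^-1 :> R by rewrite invr_gt0 ltr0n.
  have HU : U ([set n | forall z, exhaust D j z -> nrm (g n z - l z) < j.+1%:R^-1] `&` [set n | (N <= n)%N]).
    apply: filterI; first by apply: unif j0; [exact: compact_exhaust|exact: exhaust_sub].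
    by apply: sU; exact: nbhs_infty_ge.
  by have [n [h1 h2]] := filter_ex HU; exists n.
exists phi; split => //; exists l => // K cK KD e e0.
have [N1 H1] := exhaust_compact oD cK KD; have [N2 H2] := small_inv e0.
exists (maxn N1 N2) => n nN z Kz.
apply: lt_trans (H2 n _); last by rewrite (leq_trans _ nN)// leq_maxr.
by apply: Hphi; apply: (H1 n) => //; rewrite (leq_trans _ nN)// leq_maxl.
Qed.

Lemma asin_small (e : R) : 0 < e -> exists2 d : R, 0 < d & forall x, 0 <= x < d -> asin x < e.
Proof.
move=> e0.
have as0 : asin (0 : R) = 0.
  by rewrite -{1}(@sin0 R) sinK// in_itv/=; have := pi_gt0 R; lra.
have /cvgrPdist_lt/(_ e e0) := @continuous_asin R 0 ltac:(by rewrite ltrN10 ltr01).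
move=> /nbhs_ballP[d /= d0 Hd]; exists d => // x /andP[x0 xd].
have := Hd x; rewrite /ball /= as0 !sub0r !normrN (ger0_norm x0) => /(_ xd).
exact: le_lt_trans (ler_norm _).
Qed.

Lemma spherical_dist_finite (e : R) : 0 < e -> exists2 d : R, 0 < d &
  forall z w : C, nrm (z - w) < d -> spherical_dist (Some z) (Some w) < e.
Proof.
move=> e0; have [d d0 Hd] := asin_small (divr_gt0 e0 (ltr0Sn R 1)).
exists d => // z w zw; rewrite /spherical_dist mulrC -ltr_pdivlMr//; apply: Hd.
rewrite /half_chord -/(nrm _) -/(nrm z) -/(nrm w).
have s1 (u : C) : 1 <= Num.sqrt (1 + nrm u ^+ 2).
  by rewrite -[X in X <= _]sqrtr1 ler_wsqrtr// lerDl sqr_ge0.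
have s1' : 1 <= Num.sqrt (1 + nrm z ^+ 2) * Num.sqrt (1 + nrm w ^+ 2).
  by rewrite mulr_ege1.
apply/andP; split; first by rewrite divr_ge0 ?nrm_ge0//; lra.
apply: le_lt_trans zw; rewrite ler_pdivrMr; last by lra.
by rewrite ler_peMr ?nrm_ge0.
Qed.

Lemma spherical_dist_infty (e : R) : 0 < e -> exists B : R,
  forall z : C, B <= nrm z -> spherical_dist (Some z) None < e.
Proof.
move=> e0; have [d d0 Hd] := asin_small (divr_gt0 e0 (ltr0Sn R 1)).
exists d^-1 => z zB; rewrite /spherical_dist mulrC -ltr_pdivlMr//; apply: Hd.
rewrite /half_chord -/(nrm z) invr_ge0 sqrtr_ge0 /=.
have n0 : 0 < nrm z by apply: lt_le_trans zB; rewrite invr_gt0.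
have h : nrm z < Num.sqrt (1 + nrm z ^+ 2).
  by rewrite -{1}(ger0_norm (nrm_ge0 z)) -sqrtr_sqr ltr_sqrt ?ltrDr// ltr_pwDl ?sqr_ge0.
rewrite -[d]invrK ltf_pV2 ?posrE ?invr_gt0//; first by apply: le_lt_trans zB h.
by apply: lt_trans h.
Qed.

Lemma spherical_dist_refl (z : C) : spherical_dist (Some z) (Some z) = 0.
Proof.
rewrite /spherical_dist /half_chord subrr -/(nrm 0) nrm0 mul0r -{1}(@sin0 R) sinK ?mulr0//.
by rewrite in_itv/=; have := pi_gt0 R; lra.
Qed.
End Montel.

(** * The theorem *)

Section Dichotomy.
Variable R : realType.
Local Notation C := (Cplx R).
Implicit Types (z a : C).
Variables (D : set C) (psi f0 : C -> C) (m : nat).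
Hypothesis D_dom : domain D.
Hypothesis psi_hol : hol_on D psi.
Hypothesis psi_zeros : forall z, D z -> psi z = 0 -> multiplicity_le psi z m.
Hypothesis f0_hol : hol_on D f0.
Hypothesis f0_neq : exists2 z, D z & f0 z != psi z.

Lemma room (r l rho : R) : rho <= r * expR (- l) -> rho * expR l <= r.
Proof.
move=> h; have := ler_wpM2r (expR_ge0 l) h.
by rewrite -mulrA -expRD addNr expR0 mulr1.
Qed.

(** A starting point for the spreading lemmas, which take a value on a circle of a good disc rather
    than at its centre. *)
Lemma anchor (l : R) : 0 < l -> exists a b, [/\ D a, D b, b != a &
  exists r p psi1 c, good D psi f0 m a r p psi1 c /\ nrm (b - a) * expR l <= r].
Proof.
move=> l0; have [[a Da] oD _] := D_dom.
have [r [p [psi1 [c gd]]]] := good_exists D_dom psi_hol psi_zeros f0_hol f0_neq Da.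
have [[r0 _] inD _ _ _] := gd.
have e0 : 0 < r * expR (- l) by rewrite mulr_gt0 ?expR_gt0.
have ba : nrm (a + rc (r * expR (- l)) - a) = r * expR (- l).
  by rewrite (addrC a) addrK nrm_rc gtr0_norm.
exists a, (a + rc (r * expR (- l))); split => //.
- by apply: inD; rewrite ba gtr_pMr// -expR0 ltr_expR oppr_lt0.
- by rewrite -nrm_sub_gt0 ba.
- by exists r, p, psi1, c; split => //; rewrite ba room.
Qed.

(** The closedness step of the connectedness argument: a limit point of [G] lies in [G], or some
    point of [G] sits on a circle about it small enough for spreading. *)
Lemma near_good a (G : C -> Prop) (l : R) : D a ->
  (forall d : R, 0 < d -> exists b, [/\ D b, G b & nrm (b - a) < d]) ->
  G a \/ exists b r p psi1 c, [/\ G b, b != a, good D psi f0 m a r p psi1 c & nrm (b - a) * expR l <= r].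
Proof.
move=> Da near_a.
have [r [p [psi1 [c gd]]]] := good_exists D_dom psi_hol psi_zeros f0_hol f0_neq Da.
have [[r0 _] _ _ _ _] := gd.
have [b [Db Gb bd]] := near_a _ (mulr_gt0 r0 (expR_gt0 (- l))).
have [<-|ba] := eqVneq b a; [by left|right].
by exists b, r, p, psi1, c; split => //; exact: room (ltW bd).
Qed.

Lemma bounded_everywhere (g : nat -> C -> C) b (K : R) : (forall n, member D psi f0 m (g n)) ->
  (exists a, [/\ D a, b != a & exists r p psi1 c, good D psi f0 m a r p psi1 c /\ nrm (b - a) * expR 16 <= r]) ->
  (forall n, nrm (g n b) <= K) ->
  forall a, D a -> exists d M : R, 0 < d /\ forall n z, nrm (z - a) < d -> nrm (g n z) <= M.
Proof.
move=> mg [a0 [Da0 ba0 [r0 [p0 [psi0 [c0 [gd0 rr0]]]]]]] gK.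
pose G a := exists d M : R, 0 < d /\ forall n z, nrm (z - a) < d -> nrm (g n z) <= M.
have spread a b' r p psi1 c (K' : R) : good D psi f0 m a r p psi1 c -> b' != a ->
    nrm (b' - a) * expR 16 <= r -> (forall n, nrm (g n b') <= K') -> G a.
  move=> gd ba rr gK'; have rho0 : 0 < nrm (b' - a) by rewrite nrm_sub_gt0.
  have [M HM] := bounded_spread psi_hol K' gd erefl rho0 rr.
  by exists (nrm (b' - a)), M; split=> // n z zr; apply: HM => //; exact: ltW.
apply: (connected_spread (G := G) D_dom).
- by exists a0 => //; exact: spread gd0 ba0 rr0 gK.
- move=> a Da [d [M [d0 HM]]]; exists d => // z zd Dz.
  exists (d - nrm (z - a)), M; split; first by rewrite subr_gt0.
  by move=> n u uz; apply: HM; have := nrm_tri u z a; lra.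
- move=> a Da /(near_good 16 Da)[//|[b' [r [p [psi1 [c [[d [M [d0 HM]]] ba gd rr]]]]]]].
  by apply: spread gd ba rr (_ : forall n, nrm (g n b') <= M) => n; apply: HM; rewrite subrr nrm0.
Qed.

Lemma infinite_everywhere : exists2 l : R, 0 < l & forall (g : nat -> C -> C) b,
  (forall n, member D psi f0 m (g n)) ->
  (exists a, [/\ D a, b != a & exists r p psi1 c, good D psi f0 m a r p psi1 c /\ nrm (b - a) * expR l <= r]) ->
  (forall K : R, exists N, forall n, (N <= n)%N -> K < nrm (g n b)) ->
  forall a, D a -> exists2 d : R, 0 < d & forall B : R, exists N, forall n, (N <= n)%N ->
    forall z, nrm (z - a) < d -> B <= nrm (g n z).
Proof.
have [l l0 Hl] := infinite_spread f0 m D_dom psi_hol; exists l => //.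
move=> g b mg [a0 [Da0 ba0 [r0 [p0 [psi0 [c0 [gd0 rr0]]]]]]] gK.
pose G a := exists2 d : R, 0 < d & forall B : R, exists N, forall n, (N <= n)%N ->
    forall z, nrm (z - a) < d -> B <= nrm (g n z).
have spread a b' r p psi1 c : good D psi f0 m a r p psi1 c -> b' != a ->
    nrm (b' - a) * expR l <= r ->
    (forall K : R, exists N, forall n, (N <= n)%N -> K < nrm (g n b')) -> G a.
  move=> gd ba rr gK'; have rho0 : 0 < nrm (b' - a) by rewrite nrm_sub_gt0.
  exists (nrm (b' - a)) => // B.
  have [K HK] := Hl a r p psi1 c b' _ B gd erefl rho0 rr.
  have [N HN] := gK' K; exists N => n nN z zr.
  by apply: HK => //; [exact: HN|exact: ltW].
apply: (connected_spread (G := G) D_dom).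
- by exists a0 => //; exact: spread gd0 ba0 rr0 gK.
- move=> a Da [d d0 HB]; exists d => // z zd Dz.
  exists (d - nrm (z - a)) => [|B]; first by rewrite subr_gt0.
  have [N HN] := HB B; exists N => n nN u uz; apply: (HN n nN).
  by have := nrm_tri u z a; lra.
- move=> a Da /(near_good l Da)[//|[b' [r [p [psi1 [c [[d d0 HB] ba gd rr]]]]]]].
  apply: spread gd ba rr _ => K; have [N HN] := HB (K + 1); exists N => n nN.
  by have := HN n nN b'; rewrite subrr nrm0 => /(_ d0); lra.
Qed.
End Dichotomy.

Lemma holomorphic_hol (R : realType) (D : set (Cplx R)) f : holomorphic_on D f <-> hol_on D f.
Proof.
split=> hf z Dz; first by exists (derive1 f z); apply: derivable_cder; exact: hf.
by have [l /cder_derivable[]] := hf z Dz.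
Qed.

Theorem corollary1p3 (R : realType) (D : set (Cplx R))
    (F : set (Cplx R -> Cplx R)) (m : nat) (psi : Cplx R -> Cplx R)
    (D_domain : domain D)
    (F_holo : forall f, F f -> holomorphic_on D f)
    (psi_holo : holomorphic_on D psi)
    (psi_neq0 : exists z, D z /\ psi z <> 0)
    (psi_zeros : forall z, D z -> psi z = 0 -> multiplicity_le psi z m)
    (F_zeros : forall f, F f ->
       forall z, D z -> f z = 0 -> multiplicity_ge f z (2 * (m + 1))%N)
    (F_share : forall f g, F f -> F g -> shares_IM D f g psi) :
  normal_family D F.
Proof.
move=> fs Ffs; have psi_hol := (holomorphic_hol D psi).1 psi_holo.
have hol n := (holomorphic_hol D _).1 (F_holo _ (Ffs n)).
pose f0 := fs 0%N.
have share n z : D z -> (fs n z = psi z <-> f0 z = psi z).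
  move=> Dz; have E := F_share _ _ (Ffs n) (Ffs 0%N).
  have : [set z | D z /\ fs n z = psi z] z = [set z | D z /\ f0 z = psi z] z by rewrite E.
  by rewrite /= => e; split=> h; [have : D z /\ fs n z = psi z|have : D z /\ f0 z = psi z] => //;
    [rewrite e|rewrite -e]; case.
have [_ oD _] := D_domain.
(* If f0 = psi on [D], every term of the sequence equals psi there, and the sequence converges as it
   stands. *)
have [f0_neq|f0_eq] := pselect (exists2 z, D z & f0 z != psi z); last first.
  exists id; split => //; left; exists psi => // K _ KD e e0; exists 0%N => n _ z /KD Dz.
  have f0z : f0 z = psi z.
    by apply: contrapT => /eqP h; apply: f0_eq; exists z.
  by rewrite (share n z Dz).2// spherical_dist_refl.
have mem n : member D psi f0 m (fs n).
  by split; [exact: hol|exact: F_zeros|exact: share].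
have [l l0 infty] := infinite_everywhere D_domain psi_hol psi_zeros (hol 0%N) f0_neq.
(* The anchor must leave room for both alternatives, e^16 for bounded spreading and e^l for infinite
   spreading. *)
have ll : 0 < 16 + l by lra.
have [a [b [Da Db ba [r [p [psi1 [c [gd rr]]]]]]]] := anchor D_domain psi_hol psi_zeros (hol 0%N) f0_neq ll.
have rr' k : k <= 16 + l -> nrm (b - a) * expR k <= r.
  by move=> kl; apply: le_trans rr; rewrite ler_wpM2l ?nrm_ge0// ler_expR.
(* Values at the single point [b] decide: a bounded subsequence leads to [montel], otherwise the
   whole sequence tends to infinity at [b]. *)
have [[B HB]|nB] := pselect (exists B : R, forall N, exists2 n, (N <= n)%N & nrm (fs n b) <= B).
  have [phi1 [incr1 Hphi1]] := extract (fun _ : nat => HB).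
  have bd := @bounded_everywhere R D psi f0 m D_domain psi_hol psi_zeros (hol 0%N) f0_neq
    (fun n => fs (phi1 n)) b B (fun n => mem (phi1 n)) _ Hphi1.
  have [|phi [incr [g hg Hg]]] := montel oD (fun n => hol (phi1 n)) (bd _).
    exists a; split => //; exists r, p, psi1, c; split => //; apply: rr'; lra.
  exists (fun n => phi1 (phi n)); split; first by move=> i j ij; apply: incr1; exact: incr.
  left; exists g; first exact/holomorphic_hol.
  move=> K cK KD e e0; have [d d0 Hd] := spherical_dist_finite e0.
  have [N HN] := Hg K cK KD d d0; exists N => n nN z Kz.
  by apply: Hd; exact: HN.
have tend K : exists N, forall n, (N <= n)%N -> K < nrm (fs n b).
  apply: contrapT => nex; apply: nB; exists K => N; apply: contrapT => nex2; apply: nex.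
  exists N => n nN; rewrite ltNge; apply/negP => h; apply: nex2; by exists n.
exists id; split => //; right => K cK KD e e0.
have [B HB] := spherical_dist_infty e0.
have [N _ HN] : \oo [set n | forall z, K z -> B <= nrm (fs n z)].
  apply: compact_uniform => // z /KD Dz.
  have [|d d0 Hd] := infty fs b mem _ tend z Dz.
    by exists a; split => //; exists r, p, psi1, c; split => //; apply: rr'; lra.
  by have [N HN] := Hd B; exists d => //; exists N.
by exists N => n nN z Kz; apply: HB; exact: HN.
Qed.
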